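(* The hyperbolic arithmetic four-manifolds $M_0=N_1/\iota$ and $M_1=N_{t_1}/\iota$, where $t_1=\sqrt{3/5}$, are not commensurable.
   Context: $\mathbb{H}^4=\{x\in\mathbb{R}^5:\langle x,x\rangle=-1,\ x_0>0\}$ with $\langle v,w\rangle=-v_0w_0+v_1w_1+v_2w_2+v_3w_3+v_4w_4$. A space-like vector $v$ determines the half-space $\{w\in\mathbb{H}^4:\langle v,w\rangle\le 0\}$. Put $t_2=\sqrt{1/2}$, $t_1=\sqrt{3/5}$. For $t\in(t_2,1]$ consider the space-like vectors $i^+=(\sqrt2,\varepsilon_i,(-1)^i/t)$ and $i^-=(\sqrt2,\varepsilon_i,-(-1)^i t)$, $i=0,\dots,7$, where $\varepsilon_0=(1,1,1)$, $\varepsilon_1=(1,-1,1)$, $\varepsilon_2=(1,-1,-1)$, $\varepsilon_3=(1,1,-1)$, $\varepsilon_4=(-1,1,-1)$, $\varepsilon_5=(-1,1,1)$, $\varepsilon_6=(-1,-1,1)$, $\varepsilon_7=(-1,-1,-1)$, and $A=(1,\sqrt2,0,0,0)$, $B=(1,0,\sqrt2,0,0)$, $C=(1,0,0,\sqrt2,0)$, $D=(1,0,0,-\sqrt2,0)$, $E=(1,0,-\sqrt2,0,0)$, $F=(1,-\sqrt2,0,0,0)$, $G=(1,0,0,0,-\sqrt2t)$, $H=(1,0,0,0,\sqrt2t)$. $P_t$ is the intersection of these 24 half-spaces; each of them contributes exactly one wall (3-dimensional face), denoted by the same symbol. The walls $i^+$ are called positive (P), the walls $i^-$ negative (N), the walls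 $A,\dots,H$ letter (L). For $t\in[t_1,1]$, $N_t$ is the hyperbolic cone-manifold obtained from four copies $P_t^{ij}$, $i,j\in\{0,1\}$, of $P_t$ by: identifying each L wall of $P_t^{0j}$ with the same wall of $P_t^{1j}$ via the identity; identifying each N wall of $P_t^{i0}$ with the same wall of $P_t^{i1}$ via the identity; identifying, in each $P_t^{ij}$, every point $x$ of the wall $k^+$, $k\in\{1,3,5,7\}$, with the point $s_{k}(x)$ of the same copy, where $s_k$ are the symmetries of $P_t$ $$s_1(x)=(x_0,x_3,x_1,-x_2,-x_4),\quad s_3(x)=(x_0,x_2,x_3,-x_1,-x_4),$$ $$s_5(x)=(x_0,-x_3,x_1,x_2,-x_4),\quad s_7(x)=(x_0,x_2,-x_3,x_1,-x_4),$$ which map $1^+,3^+,5^+,7^+$ to $0^+,2^+,6^+,4^+$ respectively. The cone-manifolds $N_1$ and $N_{t_1}$ are hyperbolic manifolds without singularities. Let $\iota$ be the fixed-point-free isometric involution of $N_t$ sending $x\in P_t^{ij}$ to $r(x)\in P_t^{1-i,1-j}$, where $r(x_0,x_1,x_2,x_3,x_4)=(x_0,-x_1,-x_2,-x_3,-x_4)$. The manifolds $M_0$ and $M_1$ are the quotients of $N_1$ and $N_{t_1}$ by $\iota$. Two subgroups $\Gamma_1,\Gamma_2<\mathrm{Isom}(\mathbb{H}^4)$ are commensurable (in the wide sense) if there is $g\in\mathrm{Isom}(\mathbb{H}^4)$ such that $g^{-1}\Gamma_1g\cap\Gamma_2$ has finite index in both $g^{-1}\Gamma_1g$ and $\Gamma_2$;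 two hyperbolic manifolds are commensurable if their fundamental groups, as subgroups of $\mathrm{Isom}(\mathbb{H}^4)$, are. *)

(* Defs.v *)
From Stdlib Require Import Relation_Operators.
From HB Require Import structures.
From mathcomp Require Import all_boot all_order all_algebra.
From mathcomp Require Import all_classical all_reals all_analysis.

Set Implicit Arguments.
Unset Strict Implicit.
Unset Printing Implicit Defensive.

Import Order.TTheory GRing.Theory Num.Theory.
Local Open Scope classical_set_scope.
Local Open Scope ring_scope.

Section HyperbolicSpace.
Variable R : realType.

Definition vec5 (x0 x1 x2 x3 x4 : R) : 'rV[R]_5 :=
  \row_(i < 5) [:: x0; x1; x2; x3; x4]`_i.

Definition hcoord (x : 'rV[R]_5) (k : nat) : R := x 0 (inord k).

Definition lor (v w : 'rV[R]_5) : R :=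
  - (hcoord v 0 * hcoord w 0) + \sum_(1 <= k < 5) hcoord v k * hcoord w k.

Definition H4 := {x : 'rV[R]_5 | (lor x x == -1) && (0 < hcoord x 0)}.

Definition arcosh (u : R) : R := ln (u + Num.sqrt (u ^+ 2 - 1)).

Definition hdist (x y : H4) : R := arcosh (- lor (val x) (val y)).

Definition is_isometry (g : H4 -> H4) : Prop :=
  bijective g /\ forall x y, hdist (g x) (g y) = hdist x y.

Definition is_isometry_group (G : set (H4 -> H4)) : Prop :=
  [/\ forall g, G g -> is_isometry g,
      G id,
      forall g h, G g -> G h -> G (g \o h)
    & forall g, G g -> exists h, [/\ G h, cancel g h & cancel h g]].

Definition acts_freely (G : set (H4 -> H4)) : Prop :=
  forall g x, G g -> g x = x -> g = id.

Definition acts_properly_discontinuously (G : set (H4 -> H4)) : Prop :=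
  forall (x : H4) (r : R), finite_set [set g : H4 -> H4 | G g /\ hdist x (g x) <= r].

(* For a bijection g, the equation says f = g^-1 \o h \o g. *)
Definition conjugate (g : H4 -> H4) (G : set (H4 -> H4)) : set (H4 -> H4) :=
  [set f : H4 -> H4 | exists2 h, G h & g \o f = h \o g].

Definition finite_index (K G : set (H4 -> H4)) : Prop :=
  K `<=` G /\
  exists S : set (H4 -> H4),
    [/\ finite_set S, S `<=` G & G = [set s \o k | s in S & k in K]].

Definition commensurable (G1 G2 : set (H4 -> H4)) : Prop :=
  exists g : H4 -> H4,
    [/\ is_isometry g,
        finite_index (conjugate g G1 `&` G2) (conjugate g G1)
      & finite_index (conjugate g G1 `&` G2) G2].

End HyperbolicSpace.

Section GluedSpaces.
Variable R : realType.

(* A metric space presented as the carrier [pt] modulo the equivalence relation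
   [same]: its points are the classes of [same], and [dist] is its distance,
   evaluated on representatives. The value +oo allows disjoint unions. *)
Record presented_space := PresentedSpace {
  pt : Type;
  dist : pt -> pt -> \bar R;
  same : pt -> pt -> Prop
}.

Definition glued_eq (X : presented_space) (E : pt X -> pt X -> Prop) :
    pt X -> pt X -> Prop :=
  clos_refl_sym_trans (pt X) (fun x y => same x y \/ E x y).

(* [chain E x y l]: one can go from x to y by finitely many moves, each being
   either a free jump between identified points or a move from z to z' of cost
   dist z z', with total cost l. *)
Inductive chain (X : presented_space) (E : pt X -> pt X -> Prop) (x : pt X) :
    pt X -> \bar R -> Prop :=
| chain_start : chain E x x 0%E
| chain_jump y z l : chain E x y l -> glued_eq E y z -> chain E x z l
| chain_move y z l : chain E x y l -> chain E x z (l + dist y z)%E.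

(* The quotient (pseudo-)metric; when geodesic pieces are glued along isometric
   subsets it is the path metric of the glued space. *)
Definition quotient_space (X : presented_space) (E : pt X -> pt X -> Prop) :
    presented_space :=
  PresentedSpace (fun x y => ereal_inf [set l | chain E x y l]) (glued_eq E).

(* f induces a bijective distance-preserving map between the classes. *)
Definition isometric (X Y : presented_space) : Prop :=
  exists f : pt X -> pt Y,
    [/\ forall x y, same x y <-> same (f x) (f y),
        forall b, exists a, same (f a) b
      & forall x y, dist (f x) (f y) = dist x y].

Definition H4_space : presented_space :=
  PresentedSpace (fun x y : H4 R => (hdist x y)%:E) eq.

Definition orbit_rel (G : set (H4 R -> H4 R)) : pt H4_space -> pt H4_space -> Prop :=
  fun x y => exists2 g, G g & g x = y.

(* G is the fundamental group of the complete hyperbolic manifold M, seen inside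
   Isom(H4) as the deck group of a universal covering H4 -> M; it is determined
   by M up to conjugacy. *)
Definition is_fundamental_group (G : set (H4 R -> H4 R)) (M : presented_space) :
    Prop :=
  [/\ is_isometry_group G,
      acts_freely G,
      acts_properly_discontinuously G
    & isometric (quotient_space (orbit_rel G)) M].

End GluedSpaces.

Section Manifolds.
Variable (R : realType) (t : R).

Definition eps (i : 'I_8) : R * R * R :=
  nth (0, 0, 0)
    [:: (1, 1, 1); (1, -1, 1); (1, -1, -1); (1, 1, -1);
        (-1, 1, -1); (-1, 1, 1); (-1, -1, 1); (-1, -1, -1)] i.

Definition pos_vec (i : 'I_8) : 'rV[R]_5 :=
  let: (e1, e2, e3) := eps i in
  vec5 (Num.sqrt 2) e1 e2 e3 ((-1) ^+ i / t).

Definition neg_vec (i : 'I_8) : 'rV[R]_5 :=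
  let: (e1, e2, e3) := eps i in
  vec5 (Num.sqrt 2) e1 e2 e3 (- ((-1) ^+ i * t)).

(* The letters A, B, ..., H are numbered 0, 1, ..., 7. *)
Definition letter_vec (i : 'I_8) : 'rV[R]_5 :=
  let s := Num.sqrt 2 in
  nth 0
    [:: vec5 1 s 0 0 0; vec5 1 0 s 0 0; vec5 1 0 0 s 0; vec5 1 0 0 (- s) 0;
        vec5 1 0 (- s) 0 0; vec5 1 (- s) 0 0 0;
        vec5 1 0 0 0 (- (s * t)); vec5 1 0 0 0 (s * t)] i.

Definition polytope :=
  {x : H4 R | [forall i : 'I_8, [&& lor (pos_vec i) (val x) <= 0,
                                    lor (neg_vec i) (val x) <= 0
                                  & lor (letter_vec i) (val x) <= 0]]}.

Definition pvec (x : polytope) : 'rV[R]_5 := val (val x).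

Definition on_wall (v : 'rV[R]_5) (x : polytope) : Prop := lor v (pvec x) = 0.

(* Only the values at k = 1, 3, 5, 7 are used. *)
Definition wall_sym (k : nat) (x : 'rV[R]_5) : 'rV[R]_5 :=
  let x0 := hcoord x 0 in let x1 := hcoord x 1 in let x2 := hcoord x 2 in
  let x3 := hcoord x 3 in let x4 := hcoord x 4 in
  match k with
  | 1 => vec5 x0 x3 x1 (- x2) (- x4)
  | 3 => vec5 x0 x2 x3 (- x1) (- x4)
  | 5 => vec5 x0 (- x3) x1 x2 (- x4)
  | 7 => vec5 x0 x2 (- x3) x1 (- x4)
  | _ => x
  end.

Definition rsym (x : 'rV[R]_5) : 'rV[R]_5 :=
  vec5 (hcoord x 0) (- hcoord x 1) (- hcoord x 2) (- hcoord x 3) (- hcoord x 4).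

(* (i, j, x) is the point x of the copy P_t^{ij}, with false = 0, true = 1. *)
Definition copies := (bool * bool * polytope)%type.

Definition copies_space : presented_space R :=
  PresentedSpace
    (fun a b : copies =>
       if a.1 == b.1 then (hdist (val a.2) (val b.2))%:E else +oo%E)
    eq.

Inductive glue : copies -> copies -> Prop :=
| glue_L (k : 'I_8) (j : bool) (x : polytope) :
    on_wall (letter_vec k) x -> glue (false, j, x) (true, j, x)
| glue_N (k : 'I_8) (i : bool) (x : polytope) :
    on_wall (neg_vec k) x -> glue (i, false, x) (i, true, x)
| glue_P (k : 'I_8) (i j : bool) (x y : polytope) :
    odd k -> on_wall (pos_vec k) x -> pvec y = wall_sym k (pvec x) ->
    glue (i, j, x) (i, j, y).

Definition N_space : presented_space R :=
  quotient_space (X := copies_space) glue.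

(* The graph of the involution iota. *)
Inductive iota_rel : copies -> copies -> Prop :=
| Iota (i j : bool) (x y : polytope) :
    pvec y = rsym (pvec x) -> iota_rel (i, j, x) (~~ i, ~~ j, y).

Definition N_mod_iota : presented_space R :=
  quotient_space (X := N_space) iota_rel.

End Manifolds.

Definition M0 (R : realType) : presented_space R := N_mod_iota 1.
Definition M1 (R : realType) : presented_space R := N_mod_iota (Num.sqrt (3 / 5)).

(* Main.v *)
(** The isometry of H^4 / G with the glued space lets one lift the polytope P_t: every
    copy of P_t has lifts to H^4 (Lorentz matrices L with p |-> p L covering the copy),
    obtained from local isometric lifts by continuation along segments, and the lifted tiles
    form a locally finite cover of H^4. All identifications are by rational matrices, in the
    basis where the form is F_t = <-2, 1, 1, 1, t^2>. If two tiles did not differ by a rational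
    Lorentz matrix, the union of the tiles of one class and the union of the others would
    meet only in countably many subspaces of codimension at least 2, which a generic segment
    avoids; so all tiles lie in one class and G_1 is conjugate into the rational
    orthogonal group of F_t, t^2 = 3/5. Conversely, for t = 1, crossing two opposite letter
    walls shows that a conjugate of G_0 contains boosts along the four coordinate axes.
    Powers of these boosts have scalar commutant, so a commensurator is, up to a scalar,
    a rational similarity between F_1 and F_t. Determinants force the factor 15 modulo
    squares, and Witt cancellation reduces <-2, 1, 1, 1, 1> = 15 <-2, 1, 1, 1, 3/5> to
    <2, 1> = <30, 15>, which fails since 2 x^2 + y^2 = 15 has no rational solution
    (look modulo 5). *)

(* The hypothesis on a group says only that its orbit space is isometric, as a space of classes with
   a pseudo-metric, to the glued space. Charts, walls and neighbours therefore have to be extracted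
   from distances. Upper bounds come from moves inside one copy; lower bounds come from 1-Lipschitz
   functions compatible with the gluings, namely the distance to the centre and the truncated
   distance to an interior point. The record [covering] collects the outcome, and the later geometry
   works from it alone. The involution gives every tile two labels: a lift of the copy [l] becomes,
   after precomposition with [r], a lift of the opposite copy. This is why statements about tiles
   have two alternatives. Rationality is obtained by a connectedness argument, not by finding the
   neighbour across each kind of wall: the gluings are rational, and the rational group and the set
   of tiles are countable, so the exceptional subspaces form a countable family. Explicit neighbours
   are needed only for the boosts, and only across letter walls; these are glued by the identity, so
   the neighbour is the mirror image. *)
Require Import Defs.
From Stdlib Require Import Relation_Operators.
From mathcomp Require Import all_boot all_order all_algebra.
From mathcomp Require Import all_classical all_reals all_analysis.
From mathcomp Require Import zify ring lra.

Set Implicit Arguments.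
Unset Strict Implicit.
Unset Printing Implicit Defensive.

Import Order.TTheory GRing.Theory Num.Theory.
Local Open Scope classical_set_scope.
Local Open Scope ring_scope.

(** * The Lorentz form and hyperbolic distance *)

Section LorentzForm.
Variable R : realType.
Implicit Types (x y z v w : 'rV[R]_5) (a b : R).

Lemma lorE v w : lor v w =
  - (hcoord v 0 * hcoord w 0) + (hcoord v 1 * hcoord w 1 + hcoord v 2 * hcoord w 2
  + hcoord v 3 * hcoord w 3 + hcoord v 4 * hcoord w 4).
Proof. by rewrite /lor unlock /= addr0 !addrA. Qed.

Lemma hcoordD v w k : hcoord (v + w) k = hcoord v k + hcoord w k.
Proof. by rewrite /hcoord mxE. Qed.

Lemma hcoordN v k : hcoord (- v) k = - hcoord v k.
Proof. by rewrite /hcoord mxE. Qed.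

Lemma hcoordZ a v k : hcoord (a *: v) k = a * hcoord v k.
Proof. by rewrite /hcoord mxE. Qed.

Lemma hcoord_vec5 a0 a1 a2 a3 a4 k : (k < 5)%N ->
  hcoord (vec5 a0 a1 a2 a3 a4 : 'rV[R]_5) k = [:: a0; a1; a2; a3; a4]`_k.
Proof. by move=> k5; rewrite /hcoord mxE inordK. Qed.

Definition hcoordE := (hcoordD, hcoordN, hcoordZ, hcoord_vec5).

Lemma row5P v w : (forall k, (k < 5)%N -> hcoord v k = hcoord w k) -> v = w.
Proof.
move=> vw; apply/rowP => i; rewrite -[i]inord_val.
by have := vw i (ltn_ord i); rewrite /hcoord.
Qed.

Lemma lorC v w : lor v w = lor w v.
Proof. by rewrite !lorE; ring. Qed.

Lemma lorDl x v w : lor (v + w) x = lor v x + lor w x.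
Proof. by rewrite !lorE !hcoordE; ring. Qed.

Lemma lorZl a v w : lor (a *: v) w = a * lor v w.
Proof. by rewrite !lorE !hcoordE; ring. Qed.

Lemma lorNl v w : lor (- v) w = - lor v w.
Proof. by rewrite !lorE !hcoordE; ring. Qed.

Lemma lorDr x v w : lor x (v + w) = lor x v + lor x w.
Proof. by rewrite !(lorC x) lorDl. Qed.

Lemma lorZr a v w : lor v (a *: w) = a * lor v w.
Proof. by rewrite !(lorC v) lorZl. Qed.

Lemma lorNr v w : lor v (- w) = - lor v w.
Proof. by rewrite !(lorC v) lorNl. Qed.

Lemma lor0l v : lor 0 v = 0.
Proof. by rewrite -[0](addNr v) lorDl lorNl addNr. Qed.

Lemma lor0r v : lor v 0 = 0.
Proof. by rewrite lorC lor0l. Qed.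

Definition lorL := (lorDl, lorDr, lorNl, lorNr, lorZl, lorZr).

Definition inH x : bool := (lor x x == -1) && (0 < hcoord x 0).

Definition future x : bool := (lor x x < 0) && (0 < hcoord x 0).

Lemma inH_lor x : inH x -> lor x x = -1.
Proof. by case/andP => /eqP. Qed.

Lemma inH_future x : inH x -> future x.
Proof. by case/andP => /eqP e p; rewrite /future e p ltrN10. Qed.

(** Cauchy-Schwarz for the space parts, obtained from Lagrange's identity (a sum of squares of 2x2
    minors), keeps their product strictly below [x0 * y0]. *)
Lemma future_lor_lt0 x y : future x -> future y -> lor x y < 0.
Proof.
rewrite /future !lorE => /andP[]; set x0 := hcoord x 0; set x1 := hcoord x 1.
set x2 := hcoord x 2; set x3 := hcoord x 3; set x4 := hcoord x 4.
set y0 := hcoord y 0; set y1 := hcoord y 1.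
set y2 := hcoord y 2; set y3 := hcoord y 3; set y4 := hcoord y 4.
move=> hx x0p /andP[hy y0p].
pose X := x1 * x1 + x2 * x2 + x3 * x3 + x4 * x4.
pose Y := y1 * y1 + y2 * y2 + y3 * y3 + y4 * y4.
pose S := x1 * y1 + x2 * y2 + x3 * y3 + x4 * y4.
have CS : S ^+ 2 <= X * Y.
  rewrite -subr_ge0.
  have -> : X * Y - S ^+ 2 = (x1 * y2 - x2 * y1) ^+ 2 + (x1 * y3 - x3 * y1) ^+ 2
    + (x1 * y4 - x4 * y1) ^+ 2 + (x2 * y3 - x3 * y2) ^+ 2
    + (x2 * y4 - x4 * y2) ^+ 2 + (x3 * y4 - x4 * y3) ^+ 2.
    by rewrite /X /Y /S; ring.
  by rewrite !addr_ge0 ?sqr_ge0.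
have X0 : 0 <= X by rewrite /X -!expr2 !addr_ge0 ?sqr_ge0.
have Y0 : 0 <= Y by rewrite /Y -!expr2 !addr_ge0 ?sqr_ge0.
have hX : X < x0 * x0 by rewrite /X; lra.
have hY : Y < y0 * y0 by rewrite /Y; lra.
suff : S < x0 * y0 by rewrite /S; lra.
have [S0|S0] := ltP S 0; first by apply: (lt_trans S0); exact: mulr_gt0.
rewrite -(@ltr_pXn2r _ 2) ?nnegrE ?mulr_ge0 ?(ltW x0p) ?(ltW y0p) //.
apply: (le_lt_trans CS); rewrite exprMn !expr2; exact: ltr_pM.
Qed.

(** Quantitative form of the positivity of the orthogonal complement of a time-like vector: a small
    norm there forces small coordinates, which is how distances control coordinates later. *)
Lemma perp_bound y v : inH y -> lor y v = 0 ->
  forall k, (k < 5)%N -> hcoord v k ^+ 2 <= hcoord y 0 ^+ 2 * lor v v.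
Proof.
case/andP => /eqP; rewrite !lorE.
set y0 := hcoord y 0; set y1 := hcoord y 1.
set y2 := hcoord y 2; set y3 := hcoord y 3; set y4 := hcoord y 4.
move=> hy y0p hv.
have : forall k, (k < 5)%N -> hcoord v k \in
   [:: hcoord v 0; hcoord v 1; hcoord v 2; hcoord v 3; hcoord v 4].
  by case=> [|[|[|[|[|]]]]] // _; rewrite !inE eqxx ?orbT.
move: hv; set v0 := hcoord v 0; set v1 := hcoord v 1.
set v2 := hcoord v 2; set v3 := hcoord v 3; set v4 := hcoord v 4.
move=> hv hk k k5.
pose V := v1 * v1 + v2 * v2 + v3 * v3 + v4 * v4.
pose Y := y1 * y1 + y2 * y2 + y3 * y3 + y4 * y4.
pose S := y1 * v1 + y2 * v2 + y3 * v3 + y4 * v4.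
have CS : S ^+ 2 <= Y * V.
  rewrite -subr_ge0.
  have -> : Y * V - S ^+ 2 = (v1 * y2 - v2 * y1) ^+ 2 + (v1 * y3 - v3 * y1) ^+ 2
    + (v1 * y4 - v4 * y1) ^+ 2 + (v2 * y3 - v3 * y2) ^+ 2
    + (v2 * y4 - v4 * y2) ^+ 2 + (v3 * y4 - v4 * y3) ^+ 2.
    by rewrite /V /Y /S; ring.
  by rewrite !addr_ge0 ?sqr_ge0.
have hY : y0 ^+ 2 = 1 + Y by rewrite /Y expr2; lra.
have hS : y0 * v0 = S by rewrite /S; lra.
have V0 : 0 <= V by rewrite /V -!expr2 !addr_ge0 ?sqr_ge0.
have Y0 : 0 <= Y by rewrite /Y -!expr2 !addr_ge0 ?sqr_ge0.
have hyv : (1 + Y) * (v0 * v0) <= Y * V by rewrite -hY; move: CS; rewrite -hS exprMn expr2.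
have VV : V <= y0 ^+ 2 * (- (v0 * v0) + (v1 * v1 + v2 * v2 + v3 * v3 + v4 * v4)).
  by rewrite hY -/V mulrDr mulrN; lra.
apply: le_trans VV; have := hk k k5; rewrite !inE.
have s1 : 0 <= v1 * v1 by rewrite -expr2 sqr_ge0.
have s2 : 0 <= v2 * v2 by rewrite -expr2 sqr_ge0.
have s3 : 0 <= v3 * v3 by rewrite -expr2 sqr_ge0.
have s4 : 0 <= v4 * v4 by rewrite -expr2 sqr_ge0.
have s0 : 0 <= v0 * v0 by rewrite -expr2 sqr_ge0.
case/or4P => [/eqP->|/eqP->|/eqP->|/orP[]/eqP->]; rewrite expr2 ?/V; try lra.
by have := mulr_ge0 Y0 s0; move: hyv; rewrite /V mulrDl mul1r; nra.
Qed.

Lemma perp_ge0 y v : inH y -> lor y v = 0 -> 0 <= lor v v.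
Proof.
move=> hy hv; have := perp_bound hy hv (k := 0) isT.
have y0 : 0 < hcoord y 0 ^+ 2 by case/andP: hy => _ ?; rewrite exprn_gt0.
by move/(le_trans (sqr_ge0 _)); rewrite pmulr_rge0.
Qed.

Lemma perp_CS y v w : inH y -> lor y v = 0 -> lor y w = 0 ->
  lor v w ^+ 2 <= lor v v * lor w w.
Proof.
move=> hy hv hw.
have ge0 a b : 0 <= lor (a *: v + b *: w) (a *: v + b *: w).
  by apply: (perp_ge0 hy); rewrite !lorL hv hw; ring.
have E a b : lor (a *: v + b *: w) (a *: v + b *: w) =
   a ^+ 2 * lor v v + 2 * a * b * lor v w + b ^+ 2 * lor w w.
  by rewrite !lorL (lorC w v); ring.
have V0 := perp_ge0 hy hv; have W0 := perp_ge0 hy hw.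
set A := lor v v in E V0 *; set B := lor w w in E W0 *; set C := lor v w in E *.
(* The first two combinations give the inequality multiplied by [B] and by [A]; [v + w] and [v - w]
   settle the case where both norms vanish. *)
have h1 := ge0 B (- C); have h2 := ge0 (- C) A.
have h3 := ge0 1 1; have h4 := ge0 1 (-1).
rewrite E in h1; rewrite E in h2; rewrite E in h3; rewrite E in h4.
have [B0|] := ltP 0 B.
  rewrite -subr_ge0 -(pmulr_rge0 _ B0); apply: le_trans h1 _.
  by rewrite le_eqVlt; apply/orP; left; apply/eqP; ring.
move=> B0'; have B0 : B = 0 by lra.
have [A0|] := ltP 0 A.
  rewrite -subr_ge0 -(pmulr_rge0 _ A0); apply: le_trans h2 _.
  by rewrite le_eqVlt; apply/orP; left; apply/eqP; ring.
move=> A0'; have A0 : A = 0 by lra.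
have -> : C = 0 by rewrite A0 B0 in h3 h4; lra.
by rewrite A0 B0 expr0n mulr0.
Qed.

Lemma lor_leN1 x y : inH x -> inH y -> lor x y <= -1.
Proof.
move=> hx hy; have xy := future_lor_lt0 (inH_future hx) (inH_future hy).
pose v := x + lor x y *: y.
have : 0 <= lor v v.
  by apply: (perp_ge0 hy); rewrite /v !lorL (inH_lor hy) (lorC y); ring.
have -> : lor v v = lor x y ^+ 2 - 1.
  by rewrite /v !lorL (inH_lor hy) (inH_lor hx) (lorC y); ring.
by move=> h; nra.
Qed.

Lemma lor_eqN1 x y : inH x -> inH y -> lor x y = -1 -> x = y.
Proof.
move=> hx hy xy; pose v := x - y.
have v0 : lor v v = 0.
  by rewrite /v !lorL (inH_lor hy) (inH_lor hx) (lorC y) xy; ring.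
have hv : lor y v = 0.
  by rewrite /v !lorL (inH_lor hy) (lorC y) xy; ring.
apply/row5P => k k5; have := perp_bound hy hv k5.
rewrite v0 mulr0 => h; have : hcoord v k ^+ 2 == 0 by rewrite eq_le h sqr_ge0.
by rewrite sqrf_eq0 /v !hcoordE subr_eq0 => /eqP.
Qed.

End LorentzForm.

(** * Hyperbolic distance and the radial projection to the hyperboloid *)

Section HyperbolicDistance.
Variable R : realType.
Implicit Types (x y z v w : 'rV[R]_5) (a b u e r : R).

Lemma arcoshD a b : 1 <= a -> 1 <= b ->
  arcosh (a * b + Num.sqrt (a ^+ 2 - 1) * Num.sqrt (b ^+ 2 - 1)) = arcosh a + arcosh b.
Proof.
move=> a1 b1; have A : 0 <= a ^+ 2 - 1 by nra.
have B : 0 <= b ^+ 2 - 1 by nra.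
rewrite /arcosh; set s := Num.sqrt (a ^+ 2 - 1); set t := Num.sqrt (b ^+ 2 - 1).
have s2 : s ^+ 2 = a ^+ 2 - 1 by rewrite sqr_sqrtr.
have t2 : t ^+ 2 = b ^+ 2 - 1 by rewrite sqr_sqrtr.
have s0 : 0 <= s by rewrite sqrtr_ge0.
have t0 : 0 <= t by rewrite sqrtr_ge0.
have -> : (a * b + s * t) ^+ 2 - 1 = (a * t + b * s) ^+ 2.
  by rewrite !sqrrD !exprMn s2 t2; ring.
rewrite sqrtr_sqr ger0_norm; last by nra.
rewrite -lnM ?posrE; [congr ln; ring | lra | lra].
Qed.

Lemma arcosh_lt u r : 1 <= u -> 1 <= r -> (arcosh u < arcosh r) = (u < r).
Proof.
move=> u1 r1; have mono : {in [pred v : R | 1 <= v] &, {homo (@arcosh R) : v w / v < w}}.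
  move=> v w; rewrite !inE => v1 w1 vw; rewrite /arcosh.
  have V : 0 <= Num.sqrt (v ^+ 2 - 1) by rewrite sqrtr_ge0.
  have VW : Num.sqrt (v ^+ 2 - 1) <= Num.sqrt (w ^+ 2 - 1) by apply: ler_wsqrtr; nra.
  rewrite ltr_ln ?posrE; lra.
by apply: (leW_mono_in (le_mono_in mono)).
Qed.

Lemma arcosh_le u r : 1 <= u -> 1 <= r -> (arcosh u <= arcosh r) = (u <= r).
Proof. by move=> u1 r1; rewrite leNgt arcosh_lt // -leNgt. Qed.

Lemma arcosh1 : arcosh (1 : R) = 0.
Proof. by rewrite /arcosh expr1n subrr sqrtr0 addr0 ln1. Qed.

Lemma arcosh_gt0 u : 1 < u -> 0 < arcosh u.
Proof. by move=> u1; rewrite -arcosh1 arcosh_lt // ltW. Qed.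

Lemma arcosh_small e : 0 < e -> exists2 r, 0 < r &
  forall u, 1 <= u -> u <= 1 + r -> arcosh u < e.
Proof.
(* For [u <= 2] one has [u ^+ 2 - 1 <= 3 * (u - 1)], so the square root stays below [3 / 4 * e]
   while [u - 1] is at most [e / 4]; then [ln (1 + x) <= x] is applied. *)
move=> e0; exists (Num.min 1 ((e / 4) ^+ 2)) => [|u u1].
  by rewrite lt_min ltr01 exprn_gt0 // divr_gt0.
set r := Num.min _ _ => ur.
have r1 : r <= 1 by rewrite ge_min lexx.
have re : r <= (e / 4) ^+ 2 by rewrite ge_min lexx orbT.
have [->|un1] := eqVneq u 1; first by rewrite arcosh1.
rewrite /arcosh; set s := Num.sqrt _.
have U : 0 <= u ^+ 2 - 1 by nra.
have s0 : 0 < s by rewrite sqrtr_gt0; have : 1 < u; [rewrite lt_neqAle eq_sym un1 | nra].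
have s2 : s ^+ 2 = u ^+ 2 - 1 by rewrite sqr_sqrtr.
have us : s < 3 / 4 * e.
  have : s ^+ 2 < (3 / 4 * e) ^+ 2 by rewrite s2; nra.
  by rewrite ltr_pXn2r ?nnegrE //; lra.
have ue : u - 1 <= e / 4 by have [h|h] := leP 1 (e / 4); nra.
apply: (@le_lt_trans _ _ (u + s - 1)); last by lra.
have -> : u + s = 1 + (u + s - 1) by ring.
rewrite [X in _ <= X](_ : _ = u + s - 1); last by ring.
apply: le_ln1Dx; lra.
Qed.

Definition d x y := arcosh (- lor x y).

Lemma d_sym x y : d x y = d y x.
Proof. by rewrite /d lorC. Qed.

Lemma lorN_ge1 x y : inH x -> inH y -> 1 <= - lor x y.
Proof. by move=> hx hy; rewrite lerNr lor_leN1. Qed.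

Lemma d_ge0 x y : inH x -> inH y -> 0 <= d x y.
Proof. by move=> hx hy; rewrite -arcosh1 arcosh_le ?lorN_ge1. Qed.

Lemma dxx x : inH x -> d x x = 0.
Proof. by move=> hx; rewrite /d (inH_lor hx) opprK arcosh1. Qed.

Lemma d_gt0 x y : inH x -> inH y -> x != y -> 0 < d x y.
Proof.
move=> hx hy xy; apply: arcosh_gt0; rewrite lt_neqAle lorN_ge1 // andbT.
by apply: contra_neq xy => h; apply: lor_eqN1 => //; rewrite h opprK.
Qed.

Lemma d_lor x y v w : inH x -> inH y -> inH v -> inH w ->
  d x y = d v w -> lor x y = lor v w.
Proof.
move=> hx hy hv hw e; have := arcosh_le (lorN_ge1 hx hy) (lorN_ge1 hv hw).
have := arcosh_le (lorN_ge1 hv hw) (lorN_ge1 hx hy).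
move: e; rewrite /d => ->; rewrite lexx => /esym h1 /esym h2; lra.
Qed.

(** With [v] and [w] the components of [x] and [z] orthogonal to [y], the addition formula for
    [arcosh] reduces the inequality to Cauchy-Schwarz on the positive complement of [y]. *)
Lemma d_tri y x z : inH x -> inH y -> inH z -> d x z <= d x y + d y z.
Proof.
move=> hx hy hz; have a1 := lorN_ge1 hx hy; have b1 := lorN_ge1 hy hz.
rewrite /d -arcoshD // arcosh_le ?lorN_ge1 //; last first.
  have : 0 <= Num.sqrt ((- lor x y) ^+ 2 - 1) by rewrite sqrtr_ge0.
  have : 0 <= Num.sqrt ((- lor y z) ^+ 2 - 1) by rewrite sqrtr_ge0.
  nra.
pose v := x + lor x y *: y; pose w := z + lor y z *: y.
have yv : lor y v = 0 by rewrite /v !lorL (inH_lor hy) (lorC y); ring.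
have yw : lor y w = 0 by rewrite /w !lorL (inH_lor hy); ring.
have vv : lor v v = (- lor x y) ^+ 2 - 1.
  by rewrite /v !lorL (inH_lor hy) (inH_lor hx) (lorC y x); ring.
have ww : lor w w = (- lor y z) ^+ 2 - 1.
  by rewrite /w !lorL (inH_lor hy) (inH_lor hz) (lorC z y); ring.
have vw : lor v w = lor x z + lor x y * lor y z.
  by rewrite /v /w !lorL (inH_lor hy); ring.
rewrite -vv -ww -sqrtrM ?(perp_ge0 hy) // mulrNN.
suff : - lor v w <= Num.sqrt (lor v v * lor w w) by rewrite vw; lra.
apply: (le_trans (ler_norm _)); rewrite normrN -sqrtr_sqr ler_wsqrtr //.
exact: (perp_CS hy).
Qed.

Lemma d_small e : 0 < e -> exists2 r, 0 < r &
  forall x y, inH x -> inH y -> - lor x y <= 1 + r -> d x y < e.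
Proof.
move=> /arcosh_small[r r0 hr]; exists r => // x y hx hy; apply: hr.
exact: lorN_ge1.
Qed.

Lemma d_smallP r : 0 < r -> exists2 e, 0 < e &
  forall x y, inH x -> inH y -> d x y < e -> - lor x y < 1 + r.
Proof.
move=> r0; exists (arcosh (1 + r)); first by apply: arcosh_gt0; rewrite ltrDl.
by move=> x y hx hy; rewrite /d arcosh_lt ?lorN_ge1 // lerDl ltW.
Qed.

Lemma hcoord_cont x e : inH x -> 0 < e -> exists2 r, 0 < r &
  forall y, inH y -> d x y < r -> forall k, (k < 5)%N -> `|hcoord y k - hcoord x k| < e.
Proof.
move=> hx e0; have x0 : 0 < hcoord x 0 by case/andP: hx.
(* [y - x = (c - 1) x + w] with [w] orthogonal to [x] and [lor w w = c ^+ 2 - 1], [c = - lor x y] *)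
pose M := \sum_(k < 5) `|hcoord x k| + hcoord x 0 + 1.
have M1 : 1 <= M by rewrite /M lerDr addr_ge0 ?(ltW x0) // sumr_ge0.
pose q := Num.min 1 ((e / (4 * M)) ^+ 2).
have E0 : 0 < e / (4 * M) by rewrite divr_gt0 // mulr_gt0 //; lra.
have q0 : 0 < q by rewrite lt_min ltr01 exprn_gt0.
have [r r0 hr] := d_smallP q0; exists r => // y hy /(hr _ _ hx hy) cq k k5.
have c1 := lorN_ge1 hx hy.
set c := - lor x y in cq c1; pose w := y - c *: x.
have xw : lor x w = 0 by rewrite /w !lorL (inH_lor hx) /c; ring.
have ww : lor w w = c ^+ 2 - 1.
  by rewrite /w !lorL (inH_lor hx) (inH_lor hy) (lorC y x) /c; ring.
have q1 : q <= 1 by rewrite ge_min lexx.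
have qe : q <= (e / (4 * M)) ^+ 2 by rewrite ge_min lexx orbT.
have hk := perp_bound hx xw k5; rewrite ww in hk.
have Mk : `|hcoord x k| <= M - 1.
  rewrite /M addrK -[X in `|hcoord x X|](inordK k5) (bigD1 (inord k)) //= -addrA lerDl.
  by rewrite addr_ge0 ?(ltW x0) // sumr_ge0.
have Mx0 : hcoord x 0 <= M.
  have S0 : 0 <= \sum_(k < 5) `|hcoord x k| by apply: sumr_ge0.
  by rewrite /M; lra.
have eM : e / (4 * M) * M = e / 4 by field; lra.
set E := e / (4 * M) in E0 qe eM.
have wk : `|hcoord w k| < 3 / 4 * e.
  have : hcoord w k ^+ 2 < (3 / 4 * e) ^+ 2.
    apply: (le_lt_trans hk).
    have -> : 3 / 4 * e = 3 * M * E by lra.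
    have h1 : c ^+ 2 - 1 <= 8 * E ^+ 2 by nra.
    have h2 : hcoord x 0 ^+ 2 <= M ^+ 2 by rewrite ler_pXn2r ?nnegrE //; lra.
    apply: (@le_lt_trans _ _ (M ^+ 2 * (8 * E ^+ 2))).
      by apply: ler_pM => //; [exact: sqr_ge0 | nra].
    have : 0 < M ^+ 2 * E ^+ 2 by rewrite mulr_gt0 // exprn_gt0 //; lra.
    by rewrite !exprMn; lra.
  by rewrite -[X in X < _]real_normK ?num_real // ltr_pXn2r ?nnegrE //; lra.
have xk : `|(c - 1) * hcoord x k| <= e / 4.
  rewrite normrM ger0_norm ?subr_ge0 // -eM.
  apply: (@le_trans _ _ (q * (M - 1))).
    by apply: ler_pM => //; lra.
  have qE : q <= E.
    have [E1|E1] := leP 1 E; first exact: (le_trans q1).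
    by apply: (le_trans qe); nra.
  nra.
have -> : hcoord y k - hcoord x k = (c - 1) * hcoord x k + hcoord w k.
  by rewrite /w !hcoordE; ring.
apply: (le_lt_trans (ler_normD _ _)); lra.
Qed.

Lemma lor_cont v x e : inH x -> 0 < e -> exists2 r, 0 < r &
  forall y, inH y -> d x y < r -> `|lor v y - lor v x| < e.
Proof.
move=> hx e0.
pose M := 1 + (`|hcoord v 0| + (`|hcoord v 1| + `|hcoord v 2| + `|hcoord v 3| + `|hcoord v 4|)).
have M0 : 0 < M by rewrite ltr_pwDl // !addr_ge0.
have [r r0 hr] := hcoord_cont hx (divr_gt0 e0 M0); exists r => // y hy /(hr y hy) hk.
set q := e / M in hk; have q0 : 0 < q by rewrite divr_gt0.
have -> : lor v y - lor v x = - (hcoord v 0 * (hcoord y 0 - hcoord x 0)) +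
  (hcoord v 1 * (hcoord y 1 - hcoord x 1) + hcoord v 2 * (hcoord y 2 - hcoord x 2)
  + hcoord v 3 * (hcoord y 3 - hcoord x 3) + hcoord v 4 * (hcoord y 4 - hcoord x 4)).
  by rewrite !lorE; ring.
have e1 : e = M * q by rewrite /q; field; lra.
have B k : (k < 5)%N -> - (`|hcoord v k| * q) <= hcoord v k * (hcoord y k - hcoord x k)
    <= `|hcoord v k| * q.
  by move=> k5; rewrite -ler_norml normrM ler_wpM2l // ltW // hk.
have /andP[] := B 0 isT; have /andP[] := B 1 isT; have /andP[] := B 2 isT.
have /andP[] := B 3 isT; have /andP[] := B 4 isT.
have : (M - 1) * q < e by rewrite e1; nra.
rewrite /M ltr_norml; lra.
Qed.

Definition nrm v : 'rV[R]_5 := (Num.sqrt (- lor v v))^-1 *: v.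

Lemma nrm_inH v : future v -> inH (nrm v).
Proof.
case/andP => v0 vp; have s0 : 0 < Num.sqrt (- lor v v) by rewrite sqrtr_gt0 oppr_gt0.
rewrite /inH /nrm hcoordZ mulr_gt0 ?invr_gt0 // andbT !lorL mulrA -expr2 exprVn.
by rewrite sqr_sqrtr ?oppr_ge0 ?(ltW v0) // invrN mulNr mulVf ?(lt_eqF v0).
Qed.

Lemma nrm_id x : inH x -> nrm x = x.
Proof. by move=> hx; rewrite /nrm (inH_lor hx) opprK sqrtr1 invr1 scale1r. Qed.

Lemma nrmE v : future v -> exists2 a, 0 < a & nrm v = a *: v.
Proof.
by case/andP=> v0 vp; exists (Num.sqrt (- lor v v))^-1; rewrite // invr_gt0 sqrtr_gt0 oppr_gt0.
Qed.

(** The right side is the square of the left side, which is at least 1. The loss is harmless near 1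
    and keeps square roots out of the continuity estimates. *)
Lemma lor_nrm v w : future v -> future w ->
  - lor (nrm v) (nrm w) <= lor v w ^+ 2 / (lor v v * lor w w).
Proof.
move=> hv hw; have c1 := lorN_ge1 (nrm_inH hv) (nrm_inH hw).
have : (- lor (nrm v) (nrm w)) ^+ 2 = lor v w ^+ 2 / (lor v v * lor w w).
  case/andP: hv => v0 _; case/andP: hw => w0 _.
  rewrite sqrrN /nrm !lorL !exprMn !exprVn !sqr_sqrtr ?oppr_ge0 ?ltW //.
  by field; rewrite !lt_eqF.
by move=> <-; nra.
Qed.

End HyperbolicDistance.

(** * Lorentz matrices *)

Section LorentzMatrices.
Variable R : realType.
Implicit Types (x y z v w p u : 'rV[R]_5) (a b e r s : R) (L M N Q : 'M[R]_5).

Lemma inH_side y z : inH y -> lor z z = -1 -> lor y z < 0 -> inH z.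
Proof.
move=> hy hz yz; rewrite /inH hz eqxx /= ltNge; apply/negP => z0.
move: z0; rewrite le_eqVlt => /orP[/eqP z0|z0].
  move: hz; rewrite lorE z0 -!expr2 => hz.
  by have : 0 <= hcoord z 1 ^+ 2 + hcoord z 2 ^+ 2 + hcoord z 3 ^+ 2 + hcoord z 4 ^+ 2;
    [rewrite !addr_ge0 ?sqr_ge0 | lra].
have nz : inH (- z) by rewrite /inH !lorL hcoordN oppr_gt0 z0 opprK hz eqxx.
have := lor_leN1 hy nz; rewrite lorNr; lra.
Qed.

Definition Jm : 'M[R]_5 := diag_mx (vec5 (-1) 1 1 1 1).

Lemma sum5 (F : 'I_5 -> R) :
  \sum_i F i = F (inord 0) + (F (inord 1) + F (inord 2) + F (inord 3) + F (inord 4)).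
Proof.
rewrite !big_ord_recr big_ord0 /= add0r !addrA.
by congr (F _ + F _ + F _ + F _ + F _); apply/val_inj; rewrite /= inordK.
Qed.

Lemma lor_mx m n (A : 'M[R]_(m, 5)) (B : 'M[R]_(n, 5)) i j :
  (A *m Jm *m B^T) i j = lor (row i A) (row j B).
Proof.
by rewrite /Jm mul_mx_diag mxE sum5 lorE /hcoord !mxE !inordK //=; ring.
Qed.

Lemma lor_mulmx v w : v *m Jm *m w^T = (lor v w)%:M.
Proof. by apply/rowP => j; rewrite !ord1 lor_mx !mxE eqxx mulr1n !row_id. Qed.

Lemma JmK : Jm *m Jm = 1%:M.
Proof.
apply/matrixP => i j; rewrite /Jm mul_mx_diag !mxE.
have [->|_] := eqVneq; last by rewrite !mulr0n mul0r.
by rewrite !mulr1n; case: j => [[|[|[|[|[|]]]]]] //= _; ring.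
Qed.

Lemma Jm_unit : Jm \in unitmx.
Proof. by case/mulmx1_unit: JmK. Qed.

Lemma lor_nondeg v : (forall y, lor v y = 0) -> v = 0.
Proof.
move=> h; apply/row5P => k k5; rewrite [RHS]mxE.
have := h (delta_mx 0 (inord k)).
rewrite lorE /hcoord !mxE !eqxx /=.
have E i : (i < 5)%N -> (inord i == inord k :> 'I_5) = (i == k).
  by move=> i5; rewrite -val_eqE /= !inordK.
rewrite !E //; case: k k5 {E} => [|[|[|[|[|]]]]] //= _ ; lra.
Qed.

(** The orthochronous Lorentz group. It acts on row vectors from the right, so products are read
    from left to right. *)
Definition Lo M : Prop :=
  (forall v w, lor (v *m M) (w *m M) = lor v w) /\ (forall x, inH x -> inH (x *m M)).

Lemma Lo_J M : Lo M -> M *m Jm *m M^T = Jm.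
Proof.
have J1 : Jm = 1%:M *m Jm *m 1%:M^T by rewrite mul1mx trmx1 mulmx1.
by case=> hM _; apply/matrixP => i j; rewrite [in RHS]J1 !lor_mx !rowE hM !mulmx1.
Qed.

Lemma Lo_unit M : Lo M -> M \in unitmx.
Proof.
move/Lo_J => h; have : M *m (Jm *m M^T *m Jm) = 1%:M by rewrite !mulmxA h JmK.
by case/mulmx1_unit.
Qed.

Lemma Lo_side M x : (forall v w, lor (v *m M) (w *m M) = lor v w) ->
  inH x -> inH (x *m M) -> Lo M.
Proof.
move=> hM hx hxM; split=> // y hy; apply: (inH_side hxM).
  by rewrite hM (inH_lor hy).
by rewrite hM; apply: future_lor_lt0; apply: inH_future.
Qed.

Lemma Lo1 : Lo 1%:M.
Proof. by split=> [v w|x]; rewrite !mulmx1. Qed.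

Lemma LoM M N : Lo M -> Lo N -> Lo (M *m N).
Proof.
move=> [hM hM'] [hN hN']; split=> [v w|x hx]; first by rewrite !mulmxA hN hM.
by rewrite mulmxA; apply/hN'/hM'.
Qed.

Definition ctr : 'rV[R]_5 := vec5 1 0 0 0 0.

Lemma ctr_inH : inH ctr.
Proof. by rewrite /inH lorE !hcoord_vec5 //= ltr01 andbT; apply/eqP; ring. Qed.

Lemma LoV M : Lo M -> Lo (invmx M).
Proof.
move=> LM; have MU := Lo_unit LM; case: (LM) => hM hM'.
have h v w : lor (v *m invmx M) (w *m invmx M) = lor v w.
  by rewrite -hM -!mulmxA mulVmx // !mulmx1.
split=> // x hx; apply: (inH_side ctr_inH); first by rewrite h inH_lor.
rewrite -hM -mulmxA mulVmx // mulmx1.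
by apply: future_lor_lt0; apply: inH_future => //; apply: hM'; apply: ctr_inH.
Qed.

Lemma Lo_d M x y : Lo M -> d (x *m M) (y *m M) = d x y.
Proof. by case=> hM _; rewrite /d hM. Qed.

(** A ball of the hyperboloid sees every direction of the ambient space, so linear identities
    checked on a small ball extend to all vectors. *)
Lemma perturb p u r : inH p -> 0 < r -> exists2 e, 0 < e &
  future (p + e *: u) /\ d p (nrm (p + e *: u)) < r.
Proof.
move=> hp /(@d_small R)[q q0 hq].
have p0 : 0 < hcoord p 0 by case/andP: hp.
pose b := lor p u; pose c := lor u u; pose t := Num.min 1 q.
(* [K] dominates every coefficient, so with [e = t / (8 * K)] each first-order term is at most
   [t / 8] in absolute value. This keeps the vector time-like and future, and the ratio in [lor_nrm]
   at most [1 + t]. *)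
pose K := 1 + `|b| + `|c| + `|hcoord u 0| / hcoord p 0.
have U0 : 0 <= `|hcoord u 0| / hcoord p 0 by rewrite divr_ge0 // ltW.
have K1 : 1 <= K by have := normr_ge0 b; have := normr_ge0 c; rewrite /K; lra.
have t0 : 0 < t by rewrite lt_min ltr01.
have t1 : t <= 1 by rewrite ge_min lexx.
have tq : t <= q by rewrite ge_min lexx orbT.
pose e := t / (8 * K); have e0 : 0 < e by rewrite divr_gt0 //; lra.
have eK : e * K = t / 8 by rewrite /e; field; lra.
exists e => //.
have bnd X : `|X| <= K -> - (t / 8) <= e * X <= t / 8.
  by move=> XK; rewrite -ler_norml normrM (gtr0_norm e0) -eK ler_pM2l.
have /andP[b1 b2] : - (t / 8) <= e * b <= t / 8.
  by apply: bnd; have := normr_ge0 c; rewrite /K; lra.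
have /andP[c1 c2] : - (t / 8) <= e * c <= t / 8.
  by apply: bnd; have := normr_ge0 b; rewrite /K; lra.
have /andP[u1 u2] : - (t / 8) <= e * (hcoord u 0 / hcoord p 0) <= t / 8.
  apply: bnd; rewrite normf_div (gtr0_norm p0).
  by have := normr_ge0 c; have := normr_ge0 b; rewrite /K; lra.
have et : e <= t / 8 by rewrite -eK; nra.
have W : lor (p + e *: u) (p + e *: u) = -1 + 2 * (e * b) + e * (e * c).
  by rewrite !lorL (inH_lor hp) (lorC u p) /b /c; ring.
have pW : lor p (p + e *: u) = -1 + e * b.
  by rewrite !lorL (inH_lor hp).
have ee : - (t / 64) <= e * (e * c) <= t / 64 by apply/andP; split; nra.
case/andP: ee => ee1 ee2.
have F : future (p + e *: u).
  rewrite /future W !hcoordE; apply/andP; split; first by lra.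
  have -> : e * hcoord u 0 = (e * (hcoord u 0 / hcoord p 0)) * hcoord p 0.
    by field; lra.
  by nra.
split=> //; apply: hq => //; first exact: nrm_inH.
have := lor_nrm (inH_future hp) F; rewrite nrm_id // => /le_trans; apply.
rewrite W pW (inH_lor hp).
set A := e * b in b1 b2 W pW F *; set B := e * (e * c) in ee1 ee2 W F *.
rewrite ler_pdivrMr; last by lra.
apply: (@le_trans _ _ ((1 + t) * (1 - 2 * A - B))); last by nra.
by nra.
Qed.

Lemma ball_eq p r L M : inH p -> 0 < r ->
  (forall y, inH y -> d p y < r -> y *m L = y *m M) -> L = M.
Proof.
move=> hp r0 h; apply/row_matrixP => i; rewrite !rowE.
have [e e0 [F dF]] := perturb (delta_mx 0 i) hp r0.
have := h _ (nrm_inH F) dF; have := h p hp; rewrite dxx // => /(_ r0) pLM.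
have [a a0 ->] := nrmE F; rewrite -!scalemxAl => /(scalerI (lt0r_neq0 a0)).
rewrite !mulmxDl pLM => /addrI; rewrite -!scalemxAl.
exact: (scalerI (lt0r_neq0 e0)).
Qed.

Lemma ball_eq_hyperplane p r v L M : inH p -> 0 < r -> lor v p = 0 ->
  (forall y, inH y -> lor v y = 0 -> d p y < r -> y *m L = y *m M) ->
  forall y, lor v y = 0 -> y *m L = y *m M.
Proof.
move=> hp r0 vp h y vy.
have [e e0 [F dF]] := perturb y hp r0.
have := h p hp vp; rewrite dxx // => /(_ r0) pLM.
have [a a0 E] := nrmE F.
have := h _ (nrm_inH F); rewrite E -!scalemxAl !lorL vp vy mulr0 addr0 mulr0.
move=> /(_ erefl); rewrite -E => /(_ dF) /(scalerI (lt0r_neq0 a0)).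
rewrite !mulmxDl pLM => /addrI; rewrite -!scalemxAl.
exact: (scalerI (lt0r_neq0 e0)).
Qed.

Lemma ball_basis p r : inH p -> 0 < r -> exists2 Q, Q \in unitmx &
  forall i, inH (row i Q) /\ d p (row i Q) < r.
Proof.
move=> hp r0.
have /(_ _)/cid2 pt i := perturb (delta_mx 0 i) hp r0.
(* Row 0 is [p] itself: its coordinate 0 is positive, so it is independent of the four space
   directions in which the other rows are pushed. *)
pose Q : 'M[R]_5 := \matrix_(i < 5) if i == 0 then p else
  nrm (p + sval (pt i) *: delta_mx 0 i).
exists Q => [|i]; last first.
  rewrite rowK; case: eqP => _; first by rewrite dxx.
  by case: (pt i) => e /= e0 [F dF]; split=> //; apply: nrm_inH.
rewrite -unitmx_tr -row_free_unit -kermx_eq0; apply/rowV0P => u /sub_kermxP uQ.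
have [w uw] : exists w, u = w *m Jm by exists (u *m Jm); rewrite -mulmxA JmK mulmx1.
have wQ i : lor w (row i Q) = 0.
  have := lor_mx w Q 0 i; rewrite row_id => <-.
  by rewrite -uw uQ mxE.
have wp : lor w p = 0 by have := wQ 0; rewrite rowK eqxx.
have wk i : i != 0 -> w 0 i = 0.
  move=> i0; have := wQ i; rewrite rowK (negPf i0).
  case: (pt i) => e /= e0 [F _]; have [a a0 ->] := nrmE F.
  rewrite !lorL wp add0r => /eqP; rewrite !mulf_eq0 (gt_eqF a0) (gt_eqF e0) /= => /eqP.
  rewrite lorE /hcoord !mxE eqxx /=.
  have E k : (k < 5)%N -> (inord k == i :> 'I_5) = (k == i :> nat).
    by move=> k5; rewrite -val_eqE /= inordK.
  have wi : w 0 i = w 0 (inord i) by rewrite inord_val.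
  rewrite !E // wi; case: i i0 {E wi F} => [[|[|[|[|[|]]]]]] //= i5 _; lra.
have wz k : (0 < k < 5)%N -> hcoord w k = 0.
  by case/andP=> k0 k5; rewrite /hcoord wk // -val_eqE /= inordK // -lt0n.
have w0 : w = 0.
  apply/row5P => k k5; rewrite [RHS]mxE; case: k k5 => [_|k k5]; last exact: wz.
  move: wp; rewrite lorE (wz 1%N isT) (wz 2%N isT) (wz 3%N isT) (wz 4%N isT) !mul0r !addr0.
  move/eqP; rewrite oppr_eq0 mulf_eq0.
  by case/andP: hp => _ /gt_eqF ->; rewrite orbF => /eqP.
by rewrite uw w0 mul0mx.
Qed.

(** The images of the basis [Q] have the Gram matrix of [Q], so they form a basis too, and a vector
    is determined by its products with a basis. Hence [z] is linear on [S]. *)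
Lemma lor_extension (S : set 'rV[R]_5) (z : 'rV[R]_5 -> 'rV[R]_5) Q :
  Q \in unitmx -> (forall i, S (row i Q)) ->
  (forall x, S x -> inH x /\ inH (z x)) ->
  (forall x y, S x -> S y -> lor (z x) (z y) = lor x y) ->
  exists2 M, Lo M & forall x, S x -> z x = x *m M.
Proof.
move=> QU SQ SH iso.
pose Z : 'M[R]_5 := \matrix_(i < 5) z (row i Q).
have gram : Z *m Jm *m Z^T = Q *m Jm *m Q^T.
  by apply/matrixP => i j; rewrite !lor_mx !rowK iso.
have JZU : Jm *m Z^T \in unitmx.
  have : Z *m (Jm *m Z^T *m invmx (Q *m Jm *m Q^T)) = 1%:M.
    by rewrite !mulmxA gram mulmxV // !unitmx_mul QU Jm_unit unitmx_tr QU.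
  case/mulmx1_unit => _; rewrite unitmx_mul => /andP[-> //].
pose M := invmx Q *m Z.
have hM v w : lor (v *m M) (w *m M) = lor v w.
  have : (v *m M) *m Jm *m (w *m M)^T = v *m Jm *m w^T.
    transitivity (v *m invmx Q *m (Z *m Jm *m Z^T) *m (w *m invmx Q)^T).
      by rewrite /M (mulmxA w) (trmx_mul (w *m _)) !mulmxA.
    rewrite gram.
    transitivity ((v *m invmx Q *m Q) *m Jm *m (w *m invmx Q *m Q)^T); last by rewrite !mulmxKV.
    by rewrite (trmx_mul (w *m invmx Q)) !mulmxA.
  by rewrite !lor_mulmx => /matrixP/(_ 0 0); rewrite !mxE eqxx !mulr1n.
have zM x : S x -> z x = x *m M.
  move=> Sx; apply: (can_inj (mulmxK JZU)); rewrite !mulmxA.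
  rewrite /M -!mulmxA (mulmxA Z) gram !mulmxA mulmxKV //.
  apply/rowP => j; rewrite !lor_mx !row_id rowK iso //.
exists M => //; have [h1 h2] := SH _ (SQ 0).
by apply: (Lo_side hM h1); rewrite -zM.
Qed.

Definition refl v : 'M[R]_5 := 1%:M - (2 / lor v v) *: (Jm *m v^T *m v).

Lemma reflE v x : x *m refl v = x - (2 * lor x v / lor v v) *: v.
Proof.
rewrite /refl mulmxBr mulmx1 -scalemxAr !mulmxA lor_mulmx mul_scalar_mx scalerA.
by congr (_ - _ *: _); ring.
Qed.

Lemma refl_perp v x : lor x v = 0 -> x *m refl v = x.
Proof. by move=> h; rewrite reflE h mulr0 mul0r scale0r subr0. Qed.

Lemma refl_self v : lor v v != 0 -> v *m refl v = - v.
Proof.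
by move=> v0; rewrite reflE mulfK // scaler_nat mulr2n opprD addrA subrr add0r.
Qed.

Lemma refl_Lo v : 0 < lor v v -> Lo (refl v).
Proof.
move=> v0; have hM x y : lor (x *m refl v) (y *m refl v) = lor x y.
  by rewrite !reflE !lorL (lorC v y); field; rewrite gt_eqF.
split=> // x hx; apply: (inH_side hx); first by rewrite hM inH_lor.
rewrite reflE !lorL (inH_lor hx).
suff : 0 <= 2 * lor x v / lor v v * lor x v by lra.
by rewrite mulrAC divr_ge0 ?(ltW v0) // -mulrA mulr_ge0 // -expr2 sqr_ge0.
Qed.

(** [v *m N] is orthogonal to the fixed hyperplane, hence a multiple of [v], and preservation of the
    norm leaves only the factors 1 and -1. *)
Lemma fix_hyperplane v N : lor v v != 0 -> Lo N ->
  (forall y, lor v y = 0 -> y *m N = y) -> N = 1%:M \/ N = refl v.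
Proof.
move=> v0 LN fixN; pose a := lor (v *m N) v / lor v v.
have dec x : exists2 y, lor v y = 0 & x = y + (lor x v / lor v v) *: v.
  exists (x - (lor x v / lor v v) *: v); last by rewrite subrK.
  by rewrite !lorL (lorC v x); field.
have vN : v *m N = a *: v.
  apply/eqP; rewrite -subr_eq0; apply/eqP; apply: lor_nondeg => x.
  have [y vy ->] := dec x; rewrite !lorL vy -{1}(fixN y vy) (proj1 LN) vy /a.
  by field.
have : a ^+ 2 = 1.
  have := proj1 LN v v; rewrite vN !lorL => h; apply: (mulIf v0).
  by rewrite mul1r -{2}h; ring.
move/eqP; rewrite sqrf_eq1 => /orP[]/eqP a1; [left|right].
  apply/row_matrixP => i; rewrite !rowE mulmx1.
  by have [y vy ->] := dec (delta_mx 0 i); rewrite mulmxDl fixN // -scalemxAl vN a1 scale1r.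
apply/row_matrixP => i; rewrite !rowE.
have [y vy ->] := dec (delta_mx 0 i); rewrite !mulmxDl fixN // -!scalemxAl vN a1 scaleN1r.
by rewrite refl_perp ?refl_self // lorC.
Qed.

(** The chord in the ambient space. Its image under [nrm] runs along the geodesic, and linear
    functionals stay affine in [s], which makes half-spaces easy to follow. *)
Definition seg x y s : 'rV[R]_5 := x + s *: (y - x).

Lemma seg_future x y s : inH x -> inH y -> 0 <= s -> s <= 1 ->
  future (seg x y s) /\ lor (seg x y s) (seg x y s) <= -1.
Proof.
move=> hx hy s0 s1; have xy := lor_leN1 hx hy.
have E : lor (seg x y s) (seg x y s) <= -1.
  have -> : lor (seg x y s) (seg x y s) = -1 + 2 * (s * (1 - s)) * (1 + lor x y).
    by rewrite /seg !lorL (inH_lor hx) (inH_lor hy) (lorC y x); ring.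
  have : 0 <= s * (1 - s) by apply: mulr_ge0; lra.
  by nra.
split=> //; rewrite /future (le_lt_trans E) ?ltrN10 //= /seg !hcoordE.
case/andP: hx => _ hx; case/andP: hy => _ hy; nra.
Qed.

Lemma seg_cont x y s r : inH x -> inH y -> 0 <= s <= 1 -> 0 < r ->
  exists2 e, 0 < e & forall t, 0 <= t <= 1 -> `|t - s| < e ->
    d (nrm (seg x y s)) (nrm (seg x y t)) < r.
Proof.
move=> hx hy /andP[s0 s1] /(@d_small R)[q q0 hq].
pose K := lor x y ^+ 2; have K0 : 0 <= K by rewrite sqr_ge0.
pose e := Num.min 1 (q / (K + 1)).
have E0 : 0 < q / (K + 1) by rewrite divr_gt0 //; lra.
exists e => [|t /andP[t0 t1] ts]; first by rewrite lt_min ltr01.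
have [Fs Es] := seg_future hx hy s0 s1; have [Ft Et] := seg_future hx hy t0 t1.
apply: hq; rewrite ?nrm_inH //; apply: (le_trans (lor_nrm Fs Ft)).
have B1 : 1 <= lor (seg x y s) (seg x y s) * lor (seg x y t) (seg x y t) by nra.
rewrite ler_pdivrMr; last by lra.
have -> : lor (seg x y s) (seg x y t) ^+ 2 =
   lor (seg x y s) (seg x y s) * lor (seg x y t) (seg x y t) + (t - s) ^+ 2 * (K - 1).
  by rewrite /seg !lorL (inH_lor hx) (inH_lor hy) (lorC y x) /K; ring.
have ts2 : (t - s) ^+ 2 <= q / (K + 1).
  rewrite -[X in X <= _](@real_normK _ (t - s)) ?num_real //.
  have h1 : e <= 1 by rewrite ge_min lexx.
  have h2 : e <= q / (K + 1) by rewrite ge_min lexx orbT.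
  by have := normr_ge0 (t - s); nra.
have : (t - s) ^+ 2 * (K + 1) <= q by rewrite -ler_pdivlMr //; lra.
by have := sqr_ge0 (t - s); nra.
Qed.

Lemma seg0 x y : seg x y 0 = x.
Proof. by rewrite /seg scale0r addr0. Qed.

Lemma seg1 x y : seg x y 1 = y.
Proof. by rewrite /seg scale1r addrC subrK. Qed.

Lemma lor_seg v x y s : lor v (seg x y s) = (1 - s) * lor v x + s * lor v y.
Proof. by rewrite /seg !lorL; ring. Qed.

End LorentzMatrices.

(** * Quotient metrics *)

Section Quotients.
Variable R : realType.
Implicit Types X : presented_space R.

Lemma glued_eq_invariant X (E : pt X -> pt X -> Prop) T (phi : pt X -> T) :
  (forall x y, same x y -> phi x = phi y) -> (forall x y, E x y -> phi x = phi y) ->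
  forall x y, glued_eq E x y -> phi x = phi y.
Proof.
move=> hs hE x y; elim=> {x y} [x y [/hs|/hE]||x y _ ->|x y z _ -> _ ->] //.
Qed.

Definition lipschitz1 X (phi : pt X -> R) : Prop :=
  (forall x y, same x y -> phi x = phi y) /\
  (forall x y, (`|phi x - phi y|%:E <= dist x y)%E).

(** The tool for bounding a quotient distance from below: jumps do not change [phi], and moves
    change it by at most their cost, so the bound adds up along a chain. *)
Lemma lipschitz1_quotient X (E : pt X -> pt X -> Prop) (phi : pt X -> R) :
  lipschitz1 phi -> (forall x y, E x y -> phi x = phi y) ->
  @lipschitz1 (quotient_space E) phi.
Proof.
move=> [hs hd] hE; have inv := glued_eq_invariant hs hE.
split=> [x y|x y]; first exact: inv.
apply/ereal_infP => l /=; elim=> [|{l}u v l _ IH /inv <- //|{l}u v l _ IH].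
  by rewrite subrr normr0.
apply: (@le_trans _ _ (`|phi x - phi u|%:E + `|phi u - phi v|%:E)%E).
  by rewrite -EFinD lee_fin; apply: le_trans (ler_normD _ _); rewrite addrA subrK.
exact: leeD.
Qed.

Lemma quotient_dist_le X (E : pt X -> pt X -> Prop) (x y : pt X) :
  (@dist R (quotient_space E) x y <= dist x y)%E.
Proof.
apply: ereal_inf_lbound => /=; rewrite -[X in chain _ _ _ X]add0e.
exact: (chain_move _ (chain_start _ _)).
Qed.

Lemma quotient_dist_same X (E : pt X -> pt X -> Prop) x x' y y' :
  glued_eq E x x' -> glued_eq E y y' ->
  (@dist R (quotient_space E) x y <= @dist R (quotient_space E) x' y')%E.
Proof.
move=> xx' yy'; apply/ereal_infP => l /= c; apply: ereal_inf_lbound => /=.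
apply: (@chain_jump _ _ _ _ y'); last exact: rst_sym.
elim: c => [|u v {}l _ IH uv|u v {}l _ IH].
- by apply: (chain_jump (chain_start _ _)).
- exact: chain_jump uv.
- exact: chain_move.
Qed.

Lemma orbit_glued (G : set (H4 R -> H4 R)) : is_isometry_group G ->
  forall x y, glued_eq (orbit_rel G) x y -> exists2 g, G g & g x = y.
Proof.
case=> [_ Gid Gcomp Ginv] x y; elim=> {x y}.
- by move=> x y [->|//]; exists id.
- by move=> x; exists id.
- move=> x y _ [g Gg <-]; have [h [Gh gh _]] := Ginv g Gg.
  by exists h => //; rewrite gh.
- move=> x y z _ [g Gg <-] _ [h Gh <-]; exists (h \o g) => //.
  exact: Gcomp.
Qed.

Lemma hdistE (x y : H4 R) : hdist x y = d (val x) (val y).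
Proof. by []. Qed.

(** The jumps of a chain are absorbed into one group element applied to its endpoint; since that
    element is an isometry, the remaining moves obey the triangle inequality of the hyperbolic
    space. *)
Lemma orbit_chain (G : set (H4 R -> H4 R)) : is_isometry_group G ->
  forall x y l, chain (orbit_rel G) x y l ->
  exists2 g, G g & ((hdist x (g y))%:E <= l)%E.
Proof.
move=> iG; have [Giso Gid Gcomp Ginv] := iG.
move=> x y l; elim=> [|{}y z {}l _ [g Gg gl] yz|{}y z {}l _ [g Gg gl]].
- by exists id => //; rewrite hdistE dxx ?lexx //; case: x.
- have [h Gh hz] : exists2 h, G h & h z = y by apply: (orbit_glued iG); exact: rst_sym.
  rewrite -hz in gl.
  by exists (g \o h) => //; exact: Gcomp.
- exists g => //; apply: (@le_trans _ _ ((hdist x (g y))%:E + (hdist y z)%:E)%E).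
    have [_ giso] := Giso g Gg.
    rewrite -EFinD lee_fin -(giso y z) !hdistE; apply: d_tri; exact: valP.
  exact: leeD.
Qed.

End Quotients.

(** * The walls of the polytope *)

Lemma min_radius (R : realType) (T : eqType) (s : seq T) (Q : T -> R -> Prop) :
  (forall v r r', r' <= r -> Q v r -> Q v r') ->
  (forall v, v \in s -> exists2 r, 0 < r & Q v r) ->
  exists2 r, 0 < r & forall v, v \in s -> Q v r.
Proof.
move=> mono; elim: s => [_|v s IH h]; first by exists 1.
have [r r0 hr] := IH (fun w ws => h w (mem_behead (s := v :: s) ws)).
have [r' r'0 hr'] := h v (mem_head _ _).
exists (Num.min r r'); first by rewrite lt_min r0.
move=> w; rewrite inE => /orP[/eqP->|/hr]; first by apply: mono hr'; rewrite ge_min lexx orbT.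
by apply: mono; rewrite ge_min lexx.
Qed.

Section Walls.
Variables (R : realType) (t : R).
Hypotheses (t0 : 0 < t) (t2 : 1 / 2 < t ^+ 2).
Implicit Types (x y z v w p q : 'rV[R]_5) (a b c e r : R).

Local Notation sq2 := (Num.sqrt (2 : R)).

Lemma sq2K : sq2 ^+ 2 = 2. Proof. by rewrite sqr_sqrtr. Qed.
Lemma sq2_gt0 : 0 < sq2. Proof. by rewrite sqrtr_gt0. Qed.

Definition sign a := a = 1 \/ a = -1.

Lemma signN a : sign a -> sign (- a).
Proof. by case=> ->; [right|left; rewrite opprK]. Qed.

Lemma signM a b : sign a -> sign b -> sign (a * b).
Proof. by case=> -> [] ->; rewrite ?mulr1 ?mul1r ?mulrNN ?mulr1; [left|right|right|left]. Qed.

(* The sign (-1)^i of the last coordinate is the product of the three signs in eps i. *)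
Definition pos_wall v := exists a b c, [/\ sign a, sign b, sign c &
  v = vec5 sq2 a b c (a * b * c / t)].
Definition neg_wall v := exists a b c, [/\ sign a, sign b, sign c &
  v = vec5 sq2 a b c (- (a * b * c * t))].
Definition letter_wall v := exists2 a, sign a &
  [\/ v = vec5 1 (a * sq2) 0 0 0, v = vec5 1 0 (a * sq2) 0 0,
      v = vec5 1 0 0 (a * sq2) 0 | v = vec5 1 0 0 0 (a * (sq2 * t))].
Definition wall v := [\/ pos_wall v, neg_wall v | letter_wall v].

Let I8 (P : 'I_8 -> Prop) : P (inord 0) -> P (inord 1) -> P (inord 2) -> P (inord 3) ->
  P (inord 4) -> P (inord 5) -> P (inord 6) -> P (inord 7) -> forall i, P i.
Proof.
move=> ? ? ? ? ? ? ? ? i; rewrite -[i]inord_val.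
by case: i => [[|[|[|[|[|[|[|[|]]]]]]]]].
Qed.

Lemma pos_negE : exists f : 'I_8 -> R * R * R,
  (forall i, let: (a, b, c) := f i in [/\ sign a, sign b, sign c,
    pos_vec t i = vec5 sq2 a b c (a * b * c / t) &
    neg_vec t i = vec5 sq2 a b c (- (a * b * c * t))]) /\
  (forall a b c, sign a -> sign b -> sign c -> exists i, f i = (a, b, c)).
Proof.
exists (@eps R); split.
  by elim/I8; rewrite /pos_vec /neg_vec /eps !inordK //=;
    (split; [by [left|right] | by [left|right] | by [left|right] |
      congr vec5; ring | congr vec5; ring]).
move=> a b c [] -> [] -> [] ->;
  [exists (inord 0)|exists (inord 3)|exists (inord 1)|exists (inord 2)
  |exists (inord 5)|exists (inord 4)|exists (inord 6)|exists (inord 7)];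
  by rewrite /eps inordK.
Qed.

Lemma pos_wallP v : pos_wall v <-> exists i, v = pos_vec t i.
Proof.
have [f [h1 h2]] := pos_negE; split=> [[a [b [c [sa sb sc ->]]]]|[i ->]].
  by have [i fi] := h2 a b c sa sb sc; exists i; have := h1 i; rewrite fi => -[].
by have := h1 i; case: (f i) => -[a b] c [*]; exists a, b, c; split.
Qed.

Lemma neg_wallP v : neg_wall v <-> exists i, v = neg_vec t i.
Proof.
have [f [h1 h2]] := pos_negE; split=> [[a [b [c [sa sb sc ->]]]]|[i ->]].
  by have [i fi] := h2 a b c sa sb sc; exists i; have := h1 i; rewrite fi => -[].
by have := h1 i; case: (f i) => -[a b] c [*]; exists a, b, c; split.
Qed.

Lemma letter_wallP v : letter_wall v <-> exists i, v = letter_vec t i.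
Proof.
have E : forall k, (k < 8)%N -> letter_vec t (inord k) = nth 0
    [:: vec5 1 sq2 0 0 0; vec5 1 0 sq2 0 0; vec5 1 0 0 sq2 0; vec5 1 0 0 (- sq2) 0;
        vec5 1 0 (- sq2) 0 0; vec5 1 (- sq2) 0 0 0;
        vec5 1 0 0 0 (- (sq2 * t)); vec5 1 0 0 0 (sq2 * t)] k.
  by move=> k k8; rewrite /letter_vec inordK.
split=> [[a [] -> [] ->]|[i ->]]; last first.
  elim/I8: i; rewrite E //=.
  - by exists 1; [left | constructor 1; rewrite mul1r].
  - by exists 1; [left | constructor 2; rewrite mul1r].
  - by exists 1; [left | constructor 3; rewrite mul1r].
  - by exists (-1); [right | constructor 3; rewrite mulN1r].
  - by exists (-1); [right | constructor 2; rewrite mulN1r].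
  - by exists (-1); [right | constructor 1; rewrite mulN1r].
  - by exists (-1); [right | constructor 4; rewrite mulN1r].
  - by exists 1; [left | constructor 4; rewrite mul1r].
all: rewrite ?mul1r ?mulN1r.
- by exists (inord 6); rewrite E.
- by exists (inord 3); rewrite E.
- by exists (inord 4); rewrite E.
- by exists (inord 5); rewrite E.
- by exists (inord 7); rewrite E.
- by exists (inord 2); rewrite E.
- by exists (inord 1); rewrite E.
- by exists (inord 0); rewrite E.
Qed.

Lemma rsymE a b c e r : rsym (vec5 a b c e r : 'rV[R]_5) = vec5 a (-b) (-c) (-e) (-r).
Proof. by rewrite /rsym !hcoord_vec5. Qed.

Lemma hcoord_rsym x k : (k < 5)%N -> hcoord (rsym x) k = (if k == 0 then 1 else -1) * hcoord x k.
Proof. by case: k => [|[|[|[|[|]]]]] // _; rewrite hcoord_vec5 //= ?mul1r ?mulN1r. Qed.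

Lemma rsymK x : rsym (rsym x) = x.
Proof.
apply/row5P => k k5; rewrite !hcoord_rsym // mulrA; case: (k == 0); first by rewrite !mul1r.
by rewrite mulrNN !mul1r.
Qed.

Lemma lor_rsym x y : lor (rsym x) (rsym y) = lor x y.
Proof. by rewrite !lorE !hcoord_rsym //=; ring. Qed.

Lemma inH_rsym x : inH (rsym x) = inH x.
Proof. by rewrite /inH lor_rsym hcoord_rsym // mul1r. Qed.

Lemma d_rsym x y : d (rsym x) (rsym y) = d x y.
Proof. by rewrite /d lor_rsym. Qed.

Lemma neg_wall_rsym v : neg_wall v -> neg_wall (rsym v).
Proof.
case=> a [b [c [sa sb sc ->]]]; exists (- a), (- b), (- c).
by rewrite rsymE; split; try exact: signN; congr vec5; ring.
Qed.

Lemma pos_wall_rsym v : pos_wall v -> pos_wall (rsym v).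
Proof.
case=> a [b [c [sa sb sc ->]]]; exists (- a), (- b), (- c).
by rewrite rsymE; split; try exact: signN; congr vec5; ring.
Qed.

Lemma letter_wall_rsym v : letter_wall v -> letter_wall (rsym v).
Proof.
case=> a sa h; exists (- a); first exact: signN.
by case: h => ->; rewrite rsymE oppr0 !mulNr; [constructor 1|constructor 2|constructor 3|constructor 4].
Qed.

Lemma wall_rsym v : wall v -> wall (rsym v).
Proof.
case=> [/pos_wall_rsym|/neg_wall_rsym|/letter_wall_rsym];
  [exact: Or31|exact: Or32|exact: Or33].
Qed.

Lemma pos_wall_sym v k : (k < 8)%N -> odd k -> pos_wall v -> pos_wall (wall_sym k v).
Proof.
move=> k8 ok [a [b [c [sa sb sc ->]]]]; case: k k8 ok => [|[|[|[|[|[|[|[|]]]]]]]] // _ _;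
  rewrite /wall_sym !hcoord_vec5 //=.
- by exists c, a, (- b); split=> //; [exact: signN|congr vec5; ring].
- by exists b, c, (- a); split=> //; [exact: signN|congr vec5; ring].
- by exists (- c), a, b; split=> //; [exact: signN|congr vec5; ring].
- by exists b, (- c), a; split=> //; [exact: signN|congr vec5; ring].
Qed.

Lemma lor_wall_sym k x y : (k < 8)%N -> lor (wall_sym k x) (wall_sym k y) = lor x y.
Proof.
by case: k => [|[|[|[|[|[|[|[|]]]]]]]] // _; rewrite /wall_sym // !lorE !hcoord_vec5 //=; ring.
Qed.

Lemma sqr_sign a : sign a -> a ^+ 2 = 1.
Proof. by case=> ->; rewrite ?sqrrN expr1n. Qed.

(** The bound on [t] enters through the last pair of letter walls, whose norm is
    [2 * t ^+ 2 - 1]. *)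
Lemma wall_norm v : wall v -> 0 < lor v v.
Proof.
have S2 := sq2K; have S0 := sq2_gt0.
case=> [[a [b [c [/sqr_sign sa /sqr_sign sb /sqr_sign sc ->]]]]|
  [a [b [c [/sqr_sign sa /sqr_sign sb /sqr_sign sc ->]]]]|[a /sqr_sign sa h]].
- have -> : lor (vec5 sq2 a b c (a * b * c / t)) (vec5 sq2 a b c (a * b * c / t)) =
    - sq2 ^+ 2 + (a ^+ 2 + b ^+ 2 + c ^+ 2 + a ^+ 2 * b ^+ 2 * c ^+ 2 / t ^+ 2).
    by rewrite lorE !hcoord_vec5 //=; field; rewrite gt_eqF.
  rewrite S2 sa sb sc !mul1r; have : 0 < (t ^+ 2)^-1 by rewrite invr_gt0 exprn_gt0.
  lra.
- have -> : lor (vec5 sq2 a b c (- (a * b * c * t))) (vec5 sq2 a b c (- (a * b * c * t))) =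
    - sq2 ^+ 2 + (a ^+ 2 + b ^+ 2 + c ^+ 2 + a ^+ 2 * b ^+ 2 * c ^+ 2 * t ^+ 2).
    by rewrite lorE !hcoord_vec5 //=; ring.
  by rewrite S2 sa sb sc !mul1r; have := exprn_gt0 2 t0; lra.
- have E : a ^+ 2 * sq2 ^+ 2 = 2 by rewrite sa S2 mul1r.
  have E' : a ^+ 2 * sq2 ^+ 2 * t ^+ 2 = 2 * t ^+ 2 by rewrite E.
  by have t2' := t2; case: h => ->; rewrite lorE !hcoord_vec5 //=; lra.
Qed.

Lemma wall_ctr v : wall v -> lor v (ctr R) < 0.
Proof.
have S0 := sq2_gt0.
by case=> [[a [b [c [_ _ _ ->]]]]|[a [b [c [_ _ _ ->]]]]|[a _ []->]];
  rewrite lorE /ctr !hcoord_vec5 //=; lra.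
Qed.

Definition inP p := inH p /\ forall v, wall v -> lor v p <= 0.
Definition inPo p := inH p /\ forall v, wall v -> lor v p < 0.

Lemma inPo_inP p : inPo p -> inP p.
Proof. by case=> hp h; split=> // v /h/ltW. Qed.

Lemma inPo_ctr : inPo (ctr R).
Proof. by split; [exact: ctr_inH | exact: wall_ctr]. Qed.

Lemma wall_vec i : [/\ wall (pos_vec t i), wall (neg_vec t i) & wall (letter_vec t i)].
Proof.
by split; [constructor 1; apply/pos_wallP|constructor 2; apply/neg_wallP
  |constructor 3; apply/letter_wallP]; exists i.
Qed.

Lemma inPP p : inP p <-> exists A : polytope t, pvec A = p.
Proof.
split=> [[hp h]|[A <-]].
  have hA : [forall i : 'I_8, [&& lor (pos_vec t i) (val (exist _ p hp : H4 R)) <= 0,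
       lor (neg_vec t i) (val (exist _ p hp : H4 R)) <= 0
     & lor (letter_vec t i) (val (exist _ p hp : H4 R)) <= 0]].
    by apply/forallP => i /=; have [w1 w2 w3] := wall_vec i; rewrite !h.
  by exists (exist _ (exist _ p hp : H4 R) hA).
split; first exact: (valP (val A)).
move=> v; have /forallP hA := valP A.
by case=> [/pos_wallP|/neg_wallP|/letter_wallP] [i ->]; have /and3P[] := hA i.
Qed.

Lemma inP_rsym p : inP p -> inP (rsym p).
Proof.
case=> hp h; split; first by rewrite inH_rsym.
by move=> v wv; rewrite -(rsymK v) lor_rsym; apply/h/wall_rsym.
Qed.

Lemma wall_seq : exists s : seq 'rV[R]_5, forall v, wall v <-> v \in s.
Proof.
exists ([seq pos_vec t i | i <- enum 'I_8] ++ [seq neg_vec t i | i <- enum 'I_8]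
  ++ [seq letter_vec t i | i <- enum 'I_8]) => v; rewrite !mem_cat; split.
  by case=> [/pos_wallP|/neg_wallP|/letter_wallP] [i ->]; rewrite map_f ?mem_enum ?orbT.
by case/or3P => /mapP[i _ ->]; have [] := wall_vec i.
Qed.

Lemma wall_ball p (W : 'rV[R]_5 -> Prop) : inH p -> (forall v, W v -> wall v) ->
  (forall v, W v -> lor v p < 0) -> exists2 r, 0 < r &
  forall y, inH y -> d p y < r -> forall v, W v -> lor v y < 0.
Proof.
move=> hp WW hW; have [s hs] := wall_seq.
have [] := @min_radius R _ s (fun v r => W v -> forall y, inH y -> d p y < r -> lor v y < 0).
- by move=> v r r' rr h Wv y hy yr; apply: h => //; apply: lt_le_trans rr.
- move=> v _; have [Wv|nW] := pselect (W v); last by exists 1.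
  have e0 : 0 < - lor v p by rewrite oppr_gt0 hW.
  have [r r0 h] := lor_cont v hp e0; exists r => // _ y hy /(h y hy).
  by rewrite ltr_norml => /andP[_]; rewrite ltrBlDr addNr.
- by move=> r r0 h; exists r => // y hy yr v Wv; apply: h => //; apply/hs/WW.
Qed.

Lemma inPo_ball p : inPo p -> exists2 r, 0 < r & forall y, inH y -> d p y < r -> inPo y.
Proof.
case=> hp h; have [r r0 hr] := wall_ball hp (fun v wv => wv) h.
by exists r => // y hy yr; split=> // v wv; apply: hr yr v wv.
Qed.

Lemma nrm_seg_inP p q s : inPo p -> inP q -> 0 <= s -> s <= 1 ->
  inP (nrm (seg p q s)) /\ (s < 1 -> inPo (nrm (seg p q s))).
Proof.
move=> [hp ip] [hq iq] s0 s_1; have [F _] := seg_future hp hq s0 s_1.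
have [a a0 E] := nrmE F.
split=> [|s_lt1]; (split; first exact: nrm_inH) => v wv; rewrite E lorZr.
  by rewrite pmulr_rle0 // lor_seg; have := ip v wv; have := iq v wv; nra.
by rewrite pmulr_rlt0 // lor_seg; have := ip v wv; have := iq v wv; nra.
Qed.

End Walls.

(** * Rational isometries *)

Lemma countable_image T U (f : T -> U) (A : set T) : countable A -> countable (f @` A).
Proof. exact/sub_countable/card_image_le. Qed.

Lemma countable_subset T (A B : set T) : A `<=` B -> countable B -> countable A.
Proof. by move=> AB; apply/sub_countable/subset_card_le. Qed.

Section RationalGroup.
Variables (R : realType) (t : R).
Hypotheses (t0 : 0 < t).
Implicit Types (x y z v w p q : 'rV[R]_5) (a b c e r : R) (M N : 'M[R]_5).

Local Notation sq2 := (Num.sqrt (2 : R)).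

Definition ratl a := exists q : rat, a = ratr q.

Lemma ratl0 : ratl 0. Proof. by exists 0; rewrite rmorph0. Qed.
Lemma ratl1 : ratl 1. Proof. by exists 1; rewrite rmorph1. Qed.
Lemma ratlN a : ratl a -> ratl (- a).
Proof. by case=> q ->; exists (- q); rewrite rmorphN. Qed.
Lemma ratlD a b : ratl a -> ratl b -> ratl (a + b).
Proof. by move=> [q ->] [r ->]; exists (q + r); rewrite rmorphD. Qed.
Lemma ratlM a b : ratl a -> ratl b -> ratl (a * b).
Proof. by move=> [q ->] [r ->]; exists (q * r); rewrite rmorphM. Qed.
Lemma ratlV a : ratl a -> ratl a^-1.
Proof. by move=> [q ->]; exists q^-1; rewrite fmorphV. Qed.
Lemma ratl_nat n : ratl n%:R.
Proof. by exists n%:R; rewrite rmorph_nat. Qed.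
Lemma ratl_sign a : sign a -> ratl a.
Proof. by case=> ->; [|apply: ratlN]; exact: ratl1. Qed.

Definition dcoef (k : nat) : R := if k == 0%N then sq2 else if k == 4%N then t else 1.

Hypothesis t_rat : ratl (t ^+ 2).

Lemma dcoef_gt0 k : 0 < dcoef k.
Proof. by rewrite /dcoef; case: ifP => _; [exact: sq2_gt0|case: ifP]. Qed.

Lemma dcoef_rat k : ratl (dcoef k ^+ 2).
Proof.
rewrite /dcoef; case: ifP => _; first by rewrite sq2K; exact: ratl_nat.
by case: ifP => _ //; rewrite expr1n; exact: ratl1.
Qed.

(* In the basis rescaled by dcoef, the Lorentz form and all walls are rational. *)
Definition rat_vec v := forall k, (k < 5)%N -> ratl (hcoord v k / dcoef k).

Lemma rat_vecD v w : rat_vec v -> rat_vec w -> rat_vec (v + w).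
Proof. by move=> hv hw k k5; rewrite hcoordD mulrDl; apply: ratlD; [exact: hv|exact: hw]. Qed.

Lemma rat_vecZ a v : ratl a -> rat_vec v -> rat_vec (a *: v).
Proof. by move=> ha hv k k5; rewrite hcoordZ -mulrA; apply: ratlM => //; exact: hv. Qed.

Lemma rat_vec_lor v w : rat_vec v -> rat_vec w -> ratl (lor v w).
Proof.
move=> hv hw; have H k : (k < 5)%N -> ratl (hcoord v k * hcoord w k).
  move=> k5; have -> : hcoord v k * hcoord w k =
     (hcoord v k / dcoef k) * (hcoord w k / dcoef k) * dcoef k ^+ 2.
    by field; rewrite gt_eqF // dcoef_gt0.
  by apply: ratlM (dcoef_rat k); apply: ratlM; [exact: hv|exact: hw].
by rewrite lorE; apply: ratlD; [apply: ratlN; exact: H|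
  apply: ratlD; [apply: ratlD; [apply: ratlD|]|]; exact: H].
Qed.

Definition rat_basis k : 'rV[R]_5 := dcoef k *: delta_mx 0 (inord k).

Lemma hcoord_delta i k : (i < 5)%N -> (k < 5)%N ->
  hcoord (delta_mx 0 (inord i) : 'rV[R]_5) k = (k == i)%:R.
Proof. by move=> i5 k5; rewrite /hcoord mxE eqxx /= -val_eqE /= !inordK. Qed.

Lemma rat_basis_rat k : (k < 5)%N -> rat_vec (rat_basis k).
Proof.
move=> k5 i i5; rewrite hcoordZ hcoord_delta //; case: eqP => [->|_].
  by rewrite mulr1 divff ?gt_eqF ?dcoef_gt0 //; exact: ratl1.
by rewrite mulr0 mul0r; exact: ratl0.
Qed.

(** The orthochronous rational points of the orthogonal group of the form [<-2, 1, 1, 1, t^2>],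
    written in the original coordinates. *)
Definition WQ M := Lo M /\ forall x, rat_vec x -> rat_vec (x *m M).

Lemma WQ1 : WQ 1%:M.
Proof. by split=> [|x]; [exact: Lo1|rewrite mulmx1]. Qed.

Lemma WQM M N : WQ M -> WQ N -> WQ (M *m N).
Proof.
by move=> [LM hM] [LN hN]; split=> [|x hx]; [exact: LoM|rewrite mulmxA; exact/hN/hM].
Qed.

Lemma lor_delta x k : (k < 5)%N ->
  lor x (delta_mx 0 (inord k)) = (if k == 0%N then -1 else 1) * hcoord x k.
Proof. by case: k => [|[|[|[|[|]]]]] // _; rewrite lorE !hcoord_delta //=; ring. Qed.

(** The coordinates of [x *m invmx M] are, up to rational factors, its products with the rational
    basis, and these equal the products of [x] with the images of that basis under [M]. *)
Lemma WQV M : WQ M -> WQ (invmx M).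
Proof.
move=> [LM hM]; split=> [|x hx k k5]; first exact: LoV.
have := rat_vec_lor hx (hM _ (rat_basis_rat k5)).
rewrite -(proj1 (LoV LM)) -(mulmxA (rat_basis k)) mulmxV ?Lo_unit // mulmx1.
rewrite /rat_basis lorZr lor_delta // => h.
have -> : hcoord (x *m invmx M) k / dcoef k = (if k == 0%N then -1 else 1) *
   (dcoef k * ((if k == 0%N then -1 else 1) * hcoord (x *m invmx M) k)) / dcoef k ^+ 2.
  by case: ifP => _; field; rewrite gt_eqF // dcoef_gt0.
apply: ratlM; last exact/ratlV/dcoef_rat.
by apply: ratlM h; case: ifP => _; [apply: ratlN|]; exact: ratl1.
Qed.

(** A reflection depends only on the line of [v], so only this line has to be rational; the letter
    walls require this freedom. *)
Lemma WQ_refl v : 0 < lor v v -> (exists2 a, a != 0 & rat_vec (a *: v)) -> WQ (refl v).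
Proof.
move=> v0 [a a0 av]; split=> [|x hx]; first exact: refl_Lo.
have -> : x *m refl v = x + (- (2 * lor x (a *: v) / lor (a *: v) (a *: v))) *: (a *: v).
  rewrite reflE scalerA -scaleNr; congr (_ + _ *: _); rewrite !lorL; field.
  by rewrite a0 gt_eqF.
apply: rat_vecD => //; apply: rat_vecZ => //; apply: ratlN; apply: ratlM.
  by apply: ratlM; [exact: ratl_nat|exact: rat_vec_lor].
by apply: ratlV; exact: rat_vec_lor.
Qed.

Hypothesis t2 : 1 / 2 < t ^+ 2.

Lemma vec5_rat a0 a1 a2 a3 a4 : ratl (a0 / sq2) -> ratl a1 -> ratl a2 -> ratl a3 ->
  ratl (a4 / t) -> rat_vec (vec5 a0 a1 a2 a3 a4).
Proof.
move=> h0 h1 h2 h3 h4 [|[|[|[|[|]]]]] // _; rewrite hcoord_vec5 // /dcoef //= ?divr1 //.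
Qed.

Lemma wall_WQ v : wall t v -> WQ (refl v).
Proof.
move=> wv; apply: WQ_refl; first exact: wall_norm t0 t2 _ wv.
have tn : t != 0 by rewrite gt_eqF.
have sn : sq2 != 0 by rewrite gt_eqF // sq2_gt0.
have half : ratl (sq2^-1 / sq2).
  by rewrite -expr2 exprVn sq2K; apply: ratlV; exact: ratl_nat.
case: wv => [[a [b [c [/ratl_sign sa /ratl_sign sb /ratl_sign sc ->]]]]|
  [a [b [c [/ratl_sign sa /ratl_sign sb /ratl_sign sc ->]]]]|[a /ratl_sign sa h]].
- exists 1; rewrite ?oner_eq0 // scale1r; apply: vec5_rat => //.
    by rewrite divff //; exact: ratl1.
  rewrite -mulrA -invfM -expr2; apply: ratlM; last exact: ratlV.
  by apply: ratlM => //; exact: ratlM.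
- exists 1; rewrite ?oner_eq0 // scale1r; apply: vec5_rat => //.
    by rewrite divff //; exact: ratl1.
  rewrite mulNr mulfK //; apply: ratlN.
  by apply: ratlM => //; exact: ratlM.
(* Dividing by the root of 2 makes the space coordinates rational in the rescaled basis and turns
   coordinate 0 into one half. *)
- exists sq2^-1; first by rewrite invr_eq0.
  have E b0 b1 b2 b3 b4 : sq2^-1 *: vec5 b0 b1 b2 b3 b4 =
     vec5 (b0 / sq2) (b1 / sq2) (b2 / sq2) (b3 / sq2) (b4 / sq2).
    by apply/row5P => -[|[|[|[|[|]]]]] // _; rewrite hcoordZ !hcoord_vec5 //= mulrC.
  by case: h => ->; rewrite E ?mul0r -1?mulrA ?mulfK ?divff //;
    (apply: vec5_rat; rewrite ?mul0r ?mul1r ?mulfK // ?[sq2 * t]mulrC ?mulfK ?divff ?mulr1 //;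
     exact: ratl0).
Qed.

Lemma linear_rows (f : 'rV[R]_5 -> 'rV[R]_5) :
  (forall x y, f (x + y) = f x + f y) -> (forall a x, f (a *: x) = a *: f x) ->
  forall x, x *m (\matrix_(i < 5) f (delta_mx 0 i)) = f x.
Proof.
move=> fD fZ x; rewrite mulmx_sum_row [in RHS](row_sum_delta x).
have f0 : f 0 = 0 by have := fZ 0 0; rewrite !scale0r.
rewrite (big_morph f fD f0); by apply: eq_bigr => i _; rewrite rowK fZ.
Qed.

Lemma WQ_linear (f : 'rV[R]_5 -> 'rV[R]_5) :
  (forall x y, f (x + y) = f x + f y) -> (forall a x, f (a *: x) = a *: f x) ->
  (forall x y, lor (f x) (f y) = lor x y) -> (forall x, hcoord (f x) 0 = hcoord x 0) ->
  (forall x, rat_vec x -> rat_vec (f x)) ->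
  exists2 M, WQ M & forall x, x *m M = f x.
Proof.
move=> fD fZ flor f0 frat; have fE := linear_rows fD fZ.
exists (\matrix_(i < 5) f (delta_mx 0 i)) => //; split; last by move=> x; rewrite fE; exact: frat.
by split=> [v w|x]; rewrite !fE // /inH flor f0.
Qed.

Lemma WQ_rsym : exists2 M, WQ M & forall x, x *m M = rsym x.
Proof.
apply: WQ_linear => [x y|a x|x y|x|x hx].
- by apply/row5P => k k5; rewrite hcoordD !hcoord_rsym // hcoordD mulrDr.
- by apply/row5P => k k5; rewrite hcoordZ !hcoord_rsym // hcoordZ mulrCA.
- exact: lor_rsym.
- by rewrite hcoord_rsym // mul1r.
- move=> k k5; rewrite hcoord_rsym // -mulrA; apply: ratlM; last exact: hx.
  by case: ifP => _; [|apply: ratlN]; exact: ratl1.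
Qed.

Lemma WQ_wall_sym k : (k < 8)%N -> exists2 M, WQ M & forall x, x *m M = wall_sym k x.
Proof.
move=> k8; apply: WQ_linear => [x y|a x|x y|x|x hx].
- by case: k k8 => [|[|[|[|[|[|[|[|]]]]]]]] // _; rewrite /wall_sym //;
    apply/row5P => -[|[|[|[|[|]]]]] // _; rewrite !hcoordD !hcoord_vec5 //=; ring.
- by case: k k8 => [|[|[|[|[|[|[|[|]]]]]]]] // _; rewrite /wall_sym //;
    apply/row5P => -[|[|[|[|[|]]]]] // _; rewrite !hcoordZ !hcoord_vec5 //=; ring.
- exact: lor_wall_sym.
- by case: k k8 => [|[|[|[|[|[|[|[|]]]]]]]] // _; rewrite /wall_sym // !hcoord_vec5.
have h0 := hx 0 isT; have h1 := hx 1 isT; have h2 := hx 2 isT; have h3 := hx 3 isT.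
have h4 := hx 4 isT; move: h0 h1 h2 h3 h4; rewrite /dcoef /= !divr1 => h0 h1 h2 h3 h4.
case: k k8 => [|[|[|[|[|[|[|[|]]]]]]]] // _; rewrite /wall_sym //.
all: by apply: vec5_rat => //; rewrite ?mulNr; apply: ratlN.
Qed.

Lemma WQ_entry M (i j : 'I_5) : WQ M -> ratl (dcoef i * M i j / dcoef j).
Proof.
case=> _ hM; have := hM _ (rat_basis_rat (ltn_ord i)) j (ltn_ord j).
by rewrite /rat_basis -scalemxAl hcoordZ /hcoord !inord_val -rowE mxE.
Qed.

(** Keeps the family of subspaces that a generic segment has to avoid countable. *)
Lemma WQ_countable : countable [set M | WQ M].
Proof.
pose f (N : 'M[rat]_5) : 'M[R]_5 :=
  \matrix_(i, j) ((dcoef i)^-1 * ratr (N i j) * dcoef j).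
have : countable (f @` [set: 'M[rat]_5]) by apply: countable_image; exact: countableP.
apply: countable_subset => M /= WM; have /(_ _ _)/cid h := fun i j => WQ_entry i j WM.
exists (\matrix_(i, j) sval (h i j)) => //; apply/matrixP => i j; rewrite !mxE.
case: (h i j) => q /= <-; field.
by rewrite !gt_eqF ?dcoef_gt0.
Qed.

End RationalGroup.

(** * The covering map onto the glued space *)

Definition opp_copy (l : bool * bool) : bool * bool := (~~ l.1, ~~ l.2).
Definition letter_copy (l : bool * bool) : bool * bool := (~~ l.1, l.2).

Lemma opp_copyK l : opp_copy (opp_copy l) = l.
Proof. by case: l => i j; rewrite /opp_copy /= !negbK. Qed.

Lemma letter_copyK l : letter_copy (letter_copy l) = l.
Proof. by case: l => i j; rewrite /letter_copy /= !negbK. Qed.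

(* [over x l p] means that the covering map sends x to the point p of the copy l. *)
Record covering (R : realType) (t : R) (G : set 'M[R]_5)
    (over : 'rV[R]_5 -> bool * bool -> 'rV[R]_5 -> Prop) : Prop := Covering {
  cov_Lo : forall M, G M -> Lo M;
  cov_mul : forall M N, G M -> G N -> G (M *m N);
  cov_inv : forall M, G M -> G (invmx M);
  cov_free : forall M x, G M -> inH x -> x *m M = x -> M = 1%:M;
  cov_fin : forall x r, inH x -> finite_set [set M | G M /\ d x (x *m M) <= r];
  cov_dom : forall x l p, over x l p -> inH x /\ inP t p;
  cov_total : forall x, inH x -> exists l p, over x l p;
  cov_surj : forall l p, inP t p -> exists x, over x l p;
  cov_orbit : forall x l p M, over x l p -> G M -> over (x *m M) l p;
  cov_fiber : forall x y l p, over x l p -> over y l p -> exists2 M, G M & y = x *m M;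
  cov_near : forall x l p q r, over x l p -> inP t q -> d p q < r ->
    exists2 y, over y l q & d x y < r;
  cov_opp : forall x l p, over x l p -> over x (opp_copy l) (rsym p);
  cov_letter : forall x l p v, over x l p -> letter_wall t v -> lor v p = 0 ->
    over x (letter_copy l) p;
  cov_same : forall x l p l' p', over x l p -> over x l' p' ->
    exists2 M, WQ t M & p' = p *m M;
  cov_lip : forall x l p y l' q, over x l p -> over y l' q ->
    `|d (ctr R) p - d (ctr R) q| <= d x y;
  cov_int : forall x l p l' p', inPo t p -> over x l p -> over x l' p' ->
    (l' = l /\ p' = p) \/ (l' = opp_copy l /\ p' = rsym p);
  cov_dist : forall p, inPo t p -> exists2 r, 0 < r &
    forall l q q' x y, d p q < r -> d p q' < r -> over x l q -> over y l q' ->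
    d q q' <= d x y;
  cov_wall : forall v x l p l' p', letter_wall t v -> lor v p = 0 ->
    (forall w, wall t w -> w <> v -> lor w p < 0) -> over x l p -> over x l' p' ->
    ((l' = l \/ l' = letter_copy l) /\ p' = p) \/
    ((l' = opp_copy l \/ l' = opp_copy (letter_copy l)) /\ p' = rsym p)
}.

Section CoveringOfQuotient.
Variables (R : realType) (t : R).
Hypotheses (t0 : 0 < t) (t2 : 1 / 2 < t ^+ 2) (t_rat : ratl (t ^+ 2)).
Implicit Types (x y z v w p q : 'rV[R]_5) (a b : copies t) (M N : 'M[R]_5).

Lemma isometry_matrix (g : H4 R -> H4 R) : is_isometry g ->
  exists2 M, Lo M & forall X, val (g X) = val X *m M.
Proof.
case=> _ giso.
pose z x := if @idP (inH x) is ReflectT h then val (g (exist _ x h : H4 R)) else x.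
have zE X : z (val X) = val (g X).
  rewrite /z; case: {-}_ / (@idP (inH (val X))) => [h|]; last by case; exact: (valP X).
  by congr (val (g _)); apply: val_inj.
have [Q QU hQ] := ball_basis (ctr_inH R) ltr01.
have [|x hx|x y hx hy|M LM hM] := @lor_extension R [set x | inH x] z Q QU.
- by move=> i; case: (hQ i).
- split=> //; have -> : x = val (exist _ x hx : H4 R) by [].
  by rewrite zE; exact: (valP (g _)).
- have -> : x = val (exist _ x hx : H4 R) by [].
  have -> : y = val (exist _ y hy : H4 R) by [].
  rewrite !zE; apply: d_lor; try exact: (valP (_ : H4 R)).
  by rewrite -!hdistE giso.
- by exists M => // X; rewrite -zE hM //; exact: (valP X).
Qed.

Local Notation sameM := (@same R (N_mod_iota t)).
Local Notation distM := (@dist R (N_mod_iota t)).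

Lemma sameM_invariant T (phi : copies t -> T) :
  (forall a b, Defs.glue a b -> phi a = phi b) -> (forall a b, iota_rel a b -> phi a = phi b) ->
  forall a b, sameM a b -> phi a = phi b.
Proof.
move=> hg hi; apply: (@glued_eq_invariant _ (N_space t)) => //.
by apply: (@glued_eq_invariant _ (copies_space t)) => // a b ->.
Qed.

Lemma glue_sameM a b : Defs.glue a b -> sameM a b.
Proof. by move=> h; apply: rst_step; left; apply: rst_step; right. Qed.

Lemma iota_sameM a b : iota_rel a b -> sameM a b.
Proof. by move=> h; apply: rst_step; right. Qed.

Lemma distM_le l (A B : polytope t) : (distM (l, A) (l, B) <= (hdist (val A) (val B))%:E)%E.
Proof.
apply: le_trans (quotient_dist_le (X := N_space t) _ _ _) _.
apply: le_trans (quotient_dist_le (X := copies_space t) _ _ _) _.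
by rewrite /= eqxx.
Qed.

Lemma lipschitz_M (phi : copies t -> R) :
  (forall a b, Defs.glue a b -> phi a = phi b) -> (forall a b, iota_rel a b -> phi a = phi b) ->
  (forall l A B, `|phi (l, A) - phi (l, B)| <= d (pvec A) (pvec B)) ->
  @lipschitz1 _ (N_mod_iota t) phi.
Proof.
move=> hg hi hd; apply: (@lipschitz1_quotient _ (N_space t)) => //.
apply: (@lipschitz1_quotient _ (copies_space t)) => //; split=> [a b ->//|[l A] [l' B]] /=.
by case: eqP => [->|_]; [rewrite lee_fin; exact: hd|rewrite leey].
Qed.

Lemma d_lip z p q : inH z -> inH p -> inH q -> `|d z p - d z q| <= d p q.
Proof.
move=> hz hp hq; have := d_tri hp hz hq; have := d_tri hq hz hp; have := d_tri hp hq hz.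
rewrite ler_norml (d_sym q p).
by move: (@d_tri R p z q hz hp hq) (@d_tri R q z p hz hq hp); rewrite (d_sym q p); lra.
Qed.

Lemma min_lip (r a b : R) : `|Num.min r a - Num.min r b| <= `|a - b|.
Proof. by rewrite /Num.min; case: ltP => h1; case: ltP => h2; do !case: ler0P => ?; lra. Qed.

Lemma polytope_inH (A : polytope t) : inH (pvec A).
Proof. exact: (valP (val A)). Qed.

Lemma polytope_inP (A : polytope t) : inP t (pvec A).
Proof. by apply/inPP => //; exists A. Qed.

Lemma glue_P_wall (k : 'I_8) (A B : polytope t) : odd k -> on_wall (pos_vec t k) A ->
  pvec B = wall_sym k (pvec A) -> exists2 v, pos_wall t v & lor v (pvec B) = 0.
Proof.
move=> ok wA ->; exists (wall_sym k (pos_vec t k)); last by rewrite lor_wall_sym.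
by apply: pos_wall_sym => //; apply/pos_wallP => //; exists k.
Qed.

Lemma pvec_inj : injective (@pvec R t).
Proof. by move=> A B /val_inj/val_inj. Qed.

(** All gluing maps fix the centre. The resulting bound limits how deep into the ends of a tile a
    nearby point can lie, and local finiteness of the tiling rests on it. *)
Lemma center_lipschitz : @lipschitz1 _ (N_mod_iota t) (fun a => d (ctr R) (pvec a.2)).
Proof.
apply: lipschitz_M.
- move=> _ _ [//|//|k i j A B _ _ /= ->].
  rewrite /d !lorE !hcoord_vec5 //= !mul0r !addr0.
  by case: k => [[|[|[|[|[|[|[|[|]]]]]]]]] //= _; rewrite ?hcoord_vec5.
- by move=> _ _ [i j A B /= ->]; rewrite /d !lorE !hcoord_vec5 //= !mul0r.
- move=> l A B; apply: d_lip; try exact: polytope_inH; exact: ctr_inH.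
Qed.

(* The distance to the point q of the copy l, truncated below the distance to the walls,
   descends to the quotient. *)
Definition probe l q (r : R) (a : copies t) : R :=
  if a.1 == l then Num.min r (d q (pvec a.2))
  else if a.1 == opp_copy l then Num.min r (d (rsym q) (pvec a.2)) else r.

Lemma probe_lipschitz l q r : inH q ->
  (forall y v, inH y -> wall t v -> lor v y = 0 -> r <= d q y) ->
  @lipschitz1 _ (N_mod_iota t) (probe l q r).
Proof.
move=> hq far.
(* On every wall of every copy the probe takes its ceiling value, so no gluing along walls can break
   its invariance. *)
have wallr l' (A : polytope t) v : wall t v -> lor v (pvec A) = 0 -> probe l q r (l', A) = r.
  move=> wv vA; rewrite /probe /=; case: eqP => _.
    by apply/min_idPl; apply: far vA => //; exact: polytope_inH.
  case: eqP => _ //; apply/min_idPl.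
  rewrite -d_rsym rsymK; apply: (far _ (rsym v)); first by rewrite inH_rsym polytope_inH.
    exact: wall_rsym.
  by rewrite lor_rsym.
apply: lipschitz_M.
- move=> _ _ [k j A wA|k i A wA|k i j A B ok wA e].
  + by rewrite !(wallr _ _ (letter_vec t k)) //; have [] := wall_vec t k.
  + by rewrite !(wallr _ _ (neg_vec t k)) //; have [] := wall_vec t k.
  + rewrite (wallr _ _ (pos_vec t k)) //; last by have [] := wall_vec t k.
    have [v pv vB] := glue_P_wall ok wA e.
    by rewrite (wallr _ _ v) //; constructor 1.
- move=> _ _ [i j A B e]; rewrite /probe /= e.
  rewrite -[d q (rsym _)]d_rsym rsymK d_rsym -/(opp_copy (i, j)).
  have -> : (opp_copy (i, j) == opp_copy l) = ((i, j) == l).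
    by rewrite (inj_eq (can_inj opp_copyK)).
  have -> : (opp_copy (i, j) == l) = ((i, j) == opp_copy l).
    by rewrite -(inj_eq (can_inj opp_copyK)) opp_copyK.
  by case: eqP => [e1|_]; case: eqP => [e2|_] //; move: e2; rewrite e1; case: (l) => -[] [].
- move=> l' A B; rewrite /probe /=; case: eqP => _.
    apply: (le_trans (min_lip _ _ _)); apply: d_lip => //; exact: polytope_inH.
  case: eqP => _; last by rewrite subrr normr0 d_ge0 ?polytope_inH.
  apply: (le_trans (min_lip _ _ _)); apply: d_lip; rewrite ?inH_rsym //; exact: polytope_inH.
Qed.

Variable G : set (H4 R -> H4 R).
Hypothesis fG : is_fundamental_group G (N_mod_iota t).

Definition matrix_group : set 'M[R]_5 :=
  [set M | Lo M /\ exists2 g, G g & forall X, val (g X) = val X *m M].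

Lemma matrix_of g : G g -> exists2 M, matrix_group M & forall X, val (g X) = val X *m M.
Proof.
case: fG => -[Giso _ _ _] _ _ _ Gg; have [M LM hM] := isometry_matrix (Giso g Gg).
by exists M => //; split=> //; exists g.
Qed.

Lemma matrix_unique M N : (forall X : H4 R, val X *m M = val X *m N) -> M = N.
Proof.
move=> h; apply: (ball_eq (ctr_inH R) ltr01) => y hy _.
exact: (h (exist _ y hy)).
Qed.

Lemma covering_exists : exists over, covering t matrix_group over.
Proof.
have [iG freeG pdG [f [fsame fsurj fdist]]] := fG.
have [Giso Gid Gcomp Ginv] := iG.
pose over x l p := exists X A, [/\ val X = x, pvec A = p & sameM (f X) (l, A)].
have symM a b : sameM a b -> sameM b a by exact: rst_sym.
have transM a b c : sameM a b -> sameM b c -> sameM a c by exact: rst_trans.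
have lipo (phi : copies t -> R) : @lipschitz1 _ (N_mod_iota t) phi ->
    forall X Y a b, sameM (f X) a -> sameM (f Y) b -> `|phi a - phi b| <= hdist X Y.
  move=> [h1 h2] X Y a b /h1 <- /h1 <-; rewrite -lee_fin.
  apply: (le_trans (h2 _ _)); rewrite fdist.
  exact: (quotient_dist_le (X := H4_space R)).
have sameo X l l' p p' A A' : pvec A = p -> pvec A' = p' -> sameM (f X) (l, A) ->
    sameM (f X) (l', A') -> sameM (l, A) (l', A').
  by move=> _ _ h1 h2; apply: transM h2; exact: symM.
exists over; split.
- by move=> M [].
- move=> M N [LM [g Gg gM]] [LN [h Gh hN]]; split; first exact: LoM.
  by exists (h \o g) => [|X /=]; [exact: Gcomp|rewrite hN gM mulmxA].
- move=> M [LM [g Gg gM]]; split; first exact: LoV.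
  have [h [Gh gh hg]] := Ginv g Gg; exists h => // X.
  by rewrite -{2}(hg X) gM mulmxK // Lo_unit.
- move=> M x [LM [g Gg gM]] hx xM; apply: matrix_unique => X.
  rewrite mulmx1 -gM (_ : g = id) //; apply: (freeG g (exist _ x hx)) => //.
  by apply: val_inj; rewrite gM.
- move=> x r hx; have /choice[F hF] : forall g, exists M, is_isometry g ->
      forall X, val (g X) = val X *m M.
    move=> g; have [/isometry_matrix[M _ hM]|ng] := pselect (is_isometry g); first by exists M.
    by exists 0.
  have := finite_image F (pdG (exist _ x hx) r); apply: sub_finite_set.
  move=> M [[LM [g Gg gM]] xr]; exists g.
    by split=> //; rewrite hdistE gM.
  by apply: matrix_unique => X; rewrite -hF ?gM //; exact: Giso.
- move=> x l p [X [A [<- <- _]]]; split; [exact: (valP X)|exact: polytope_inP].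
- move=> x hx; case E : (f (exist _ x hx)) => [l A]; exists l, (pvec A).
  by exists (exist _ x hx), A; split=> //; rewrite E; apply: rst_refl.
- move=> l p /inPP[]// A <-; have [X hX] := fsurj (l, A).
  by exists (val X), X, A.
- move=> x l p M [X [A [<- <- fX]]] [LM [g Gg gM]]; exists (g X), A; split=> //.
  apply: transM fX; apply/fsame; apply: rst_sym; apply: rst_step; right.
  by exists g.
- move=> x y l p [X [A [<- <- fX]]] [Y [B [<- /pvec_inj-> fY]]].
  have /fsame/(orbit_glued iG)[g Gg <-] : sameM (f X) (f Y) by apply: transM fX _; exact: symM.
  by have [M GM hM] := matrix_of Gg; exists M.
- move=> x l p q r [X [A [<- <- fX]]] /inPP[]// B <- dr.
  (* A move inside the copy bounds the quotient distance by [d p q]; on the hyperbolic side a chain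
     of cost below [r] then ends, after a group element, within [r] of [x]. *)
  have [Z fZ] := fsurj (l, B).
  have : (dist (f X) (f Z) < r%:E)%E.
    apply: le_lt_trans (quotient_dist_same (X := N_space t) fX fZ) _.
    by apply: (le_lt_trans (distM_le _ _ _)); rewrite lte_fin.
  rewrite fdist => /ereal_inf_lt[e ce er]; have [g Gg ge] := orbit_chain iG ce.
  exists (val (g Z)); last by rewrite -hdistE -lte_fin; apply: le_lt_trans er.
  exists (g Z), B; split=> //; apply: transM fZ; apply/fsame/rst_sym/rst_step; right.
  by exists g.
- move=> x [i j] p [X [A [<- <- fX]]].
  have /inPP[B hB] := inP_rsym (polytope_inP A).
  by exists X, B; split=> //; apply: transM fX _; apply: iota_sameM; constructor.
- move=> x [i j] p v [X [A [<- <- fX]]] /letter_wallP[k ->] vA.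
  exists X, A; split=> //; apply: transM fX _; case: i => /=; [apply: symM|].
    by apply: glue_sameM; exact: glue_L vA.
  by apply: glue_sameM; exact: glue_L vA.
- move=> x l p l' p' [X [A [<- Ap fX]]] [Y [B [/val_inj YX Bp fY]]].
  rewrite YX in fY; have := sameo _ _ _ _ _ _ _ Ap Bp fX fY.
  (* A proposition-valued invariant: every gluing map and the involution act by rational Lorentz
     matrices, so the truth value of [phi] is constant on classes. *)
  pose phi (a : copies t) := exists2 M, WQ t M & pvec a.2 = p *m M.
  have phiE a b : (exists2 M, WQ t M & pvec b.2 = pvec a.2 *m M) -> phi a = phi b.
    move=> [N WN e]; apply/propext; rewrite /phi e; split=> -[M WM hM].
      by exists (M *m N); [exact: WQM|rewrite hM mulmxA].
    exists (M *m invmx N); first by apply: WQM => //; exact: WQV.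
    by rewrite mulmxA -hM mulmxK // Lo_unit //; case: WN.
  move=> /(@sameM_invariant _ phi) h.
  have : phi (l', B); last by case=> M WM hM; exists M => //; rewrite -Bp.
  rewrite -h; first by exists 1%:M; [exact: WQ1|rewrite mulmx1].
    move=> a b [k j C _|k i C _|k i j C D _ _ e]; apply: phiE => /=.
    + by exists 1%:M; [exact: WQ1|rewrite mulmx1].
    + by exists 1%:M; [exact: WQ1|rewrite mulmx1].
    + by have [M WM hM] := WQ_wall_sym t (ltn_ord k); exists M; rewrite ?hM.
  move=> a b [i j C D e]; apply: phiE => /=.
  by have [M WM hM] := WQ_rsym t; exists M; rewrite ?hM.
- move=> x l p y l' q [X [A [<- <- fX]]] [Y [B [<- <- fY]]].
  exact: (lipo _ center_lipschitz X Y (l, A) (l', B)).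
- move=> x l p l' p' ip [X [A [<- Ap fX]]] [Y [B [/val_inj YX Bp fY]]].
  rewrite YX in fY; have h := sameo _ _ _ _ _ _ _ Ap Bp fX fY.
  have [r r0 hr] := inPo_ball ip; have hp : inH p by case: ip.
  have far y v : inH y -> wall t v -> lor v y = 0 -> r <= d p y.
    move=> hy wv vy; rewrite leNgt; apply/negP => /(hr y hy)[_ /(_ v wv)].
    by rewrite vy ltxx.
  (* The probe centred at [p] vanishes at [(l, p)], hence on all representatives of that class, and
     its only zeros are [p] in [l] and [rsym p] in the opposite copy. *)
  have [inv _] := probe_lipschitz l hp far.
  have := inv _ _ h; rewrite /probe /= eqxx Ap dxx // min_r ?(ltW r0) //.
  have z0 q : inH q -> Num.min r (d q p') = 0 -> p' = q.
    move=> hq; have hp' : inH p' by rewrite -Bp polytope_inH.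
    have [->//|ne] := eqVneq p' q; have := d_gt0 hq hp'; rewrite eq_sym => /(_ ne).
    by move=> dp; case: (ltP r (d q p')) => _ e0; [move: r0|move: dp]; rewrite e0 ltxx.
  rewrite Bp; case: eqP => [-> /esym/z0 ->|_]; [by left|by []|].
  case: eqP => [-> /esym/z0 ->|_ r0']; [by right|by rewrite inH_rsym|].
  by move: r0; rewrite -r0' ltxx.
- move=> p ip; have [r r0 hr] := inPo_ball ip; have hp : inH p by case: ip.
  (* All walls are at distance at least [r] from [p], hence at least [r / 2] from [q], while
     [d q q' < r / 2]: the probe at [q] with ceiling [r / 2] is not truncated at [q']. *)
  exists (r / 4); first by lra.
  move=> l q q' x y dq dq' [X [A [<- Aq fX]]] [Y [B [<- Bq fY]]].
  have hq : inH q by rewrite -Aq polytope_inH.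
  have hq' : inH q' by rewrite -Bq polytope_inH.
  have far z v : inH z -> wall t v -> lor v z = 0 -> r / 2 <= d q z.
    move=> hz wv vz; have : ~~ (d p z < r).
      by apply/negP => /(hr z hz)[_ /(_ v wv)]; rewrite vz ltxx.
    by have := d_tri hp hq hz; lra.
  have := lipo _ (probe_lipschitz l hq far) X Y (l, A) (l, B) fX fY.
  rewrite /probe /= eqxx Aq Bq dxx // min_r; last by lra.
  rewrite sub0r normrN min_r ?ger0_norm ?d_ge0 //.
  by have := d_tri hq hp hq'; rewrite (d_sym q p); lra.
- move=> v x l p l' p' lv vp hw [X [A [<- Ap fX]]] [Y [B [/val_inj YX Bp fY]]].
  rewrite YX in fY; have h := sameo _ _ _ _ _ _ _ Ap Bp fX fY.
  (* The four expected representatives. As [v] is the only wall through [p], only a letter gluing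
     and the involution apply to them, and both permute the four. *)
  pose S (a : copies t) := ((a.1 = l \/ a.1 = letter_copy l) /\ pvec a.2 = p) \/
    ((a.1 = opp_copy l \/ a.1 = opp_copy (letter_copy l)) /\ pvec a.2 = rsym p).
  suff : S (l', B) by rewrite /S /= Bp.
  have hS a w : S a -> wall t w -> lor w (pvec a.2) = 0 -> w = v \/ w = rsym v.
    move=> Sa ww wa; have [wv|nwv] := pselect (w = v); first by left.
    have [wv|nrv] := pselect (rsym w = v); first by right; rewrite -wv rsymK.
    case: Sa wa => -[_ ->] /eqP; first by rewrite lt_eqF // hw.
    by rewrite -lor_rsym rsymK lt_eqF // hw //; exact: wall_rsym.
  have letv w : w = v \/ w = rsym v -> letter_wall t w.
    by case=> -> //; exact: letter_wall_rsym.
  (* Coordinate 0 separates the letter walls from the positive and negative ones, where it is the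
     root of 2. *)
  have c0 w : letter_wall t w -> hcoord w 0 = 1.
    by case=> c _ [] ->; rewrite hcoord_vec5.
  have c1 w : pos_wall t w \/ neg_wall t w -> hcoord w 0 <> 1.
    move=> h1 e1; have := sq2K R.
    by case: h1 e1 => -[a [b [c [_ _ _ ->]]]]; rewrite hcoord_vec5 //= => ->; lra.
  have noS a w : pos_wall t w \/ neg_wall t w -> lor w (pvec a.2) = 0 -> ~ S a.
    move=> ww wa Sa; apply: (c1 _ ww); apply/c0/letv/(hS a) => //.
    by case: ww; [constructor 1|constructor 2].
  have <- : S (l, A) = S (l', B); last by left; split; [left|].
  apply: sameM_invariant h; last first.
    move=> a b [i j C D e]; apply/propext; rewrite /S /= e.
    have E k : ((~~ i, ~~ j) = k) <-> ((i, j) = opp_copy k).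
      case: k => k1 k2; split=> -[]; first by move=> <- <-; rewrite /opp_copy /= !negbK.
      by move=> -> ->; rewrite !negbK.
    have rr : (rsym (pvec C) = p) <-> (pvec C = rsym p).
      by split=> [<-|->]; rewrite rsymK.
    have rr' : (rsym (pvec C) = rsym p) <-> (pvec C = p).
      by split=> [/(congr1 (@rsym R))|->//]; rewrite !rsymK.
    by rewrite !E !opp_copyK; tauto.
  move=> a b [k j C wC|k i C wC|k i j C D ok wC e]; apply/propext.
  + have E k' : (letter_copy (false, j) = k') <-> ((false, j) = letter_copy k').
      by split=> [<-|->]; rewrite letter_copyK.
    have comm k' : letter_copy (opp_copy k') = opp_copy (letter_copy k') by [].
    rewrite /S /= -[(true, j)]/(letter_copy (false, j)) !E !comm !letter_copyK; tauto.
  + by split=> /(noS _ (neg_vec t k)) []//; right; apply/neg_wallP => //; exists k.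
  + split=> [/(noS _ (pos_vec t k)) []//|]; first by left; apply/pos_wallP => //; exists k.
    have [w pw wD] := glue_P_wall ok wC e.
    by move=> /(noS _ w) []//; left.
Qed.

End CoveringOfQuotient.

(** * Lifting the polytope *)

(** The continuity method in one hypothesis: reaching [s] from the left and passing beyond it. The
    infimum of the counterexamples would contradict it. *)
Lemma segment_induction (R : realType) (Q : R -> Prop) :
  (forall s, 0 <= s <= 1 -> (forall u, 0 <= u < s -> Q u) ->
     exists2 e, 0 < e & forall u, 0 <= u <= 1 -> `|u - s| < e -> Q u) ->
  forall s, 0 <= s <= 1 -> Q s.
Proof.
move=> step s s01; apply: contrapT => nQ.
pose B := [set u : R | 0 <= u <= 1 /\ ~ Q u].
have Bs : B s by [].
have infB : has_inf B by split; [exists s|exists 0 => u [/andP[]]].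
have lowB u : B u -> inf B <= u by move=> Bu; apply: ge_inf => //; case: infB.
have s0 : 0 <= inf B by apply: lb_le_inf => [|u [/andP[]]] //; exists s.
have [||e e0 he] := step (inf B).
- by rewrite s0; apply: le_trans (lowB s Bs) _; case/andP: s01.
- move=> u /andP[u0 us]; apply: contrapT => nu.
  have : B u by split=> //; rewrite u0 (le_trans (ltW us)) //; apply: le_trans (lowB s Bs) _; case/andP: s01.
  by move/lowB; rewrite leNgt us.
have [u Bu ue] := inf_adherent e0 infB.
case: (Bu) => u01 nu; apply: nu; apply: he => //.
by rewrite ger0_norm ?subr_ge0 ?lowB // ltrBlDl.
Qed.

Lemma left_approx (R : realType) (s e : R) : 0 < s -> 0 < e ->
  exists2 u, 0 <= u < s & `|u - s| < e.
Proof.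
move=> s0 e0; exists (s - Num.min s e / 2).
  have : Num.min s e <= s by rewrite ge_min lexx.
  have : 0 < Num.min s e by rewrite lt_min s0.
  by move=> ? ?; apply/andP; split; lra.
rewrite addrAC subrr add0r normrN ger0_norm.
  have : Num.min s e <= e by rewrite ge_min lexx orbT.
  by have : 0 < Num.min s e; [rewrite lt_min s0 | lra].
by rewrite divr_ge0 // le_min !ltW.
Qed.

Lemma d_tri_half (R : realType) (y x z : 'rV[R]_5) r : inH x -> inH y -> inH z ->
  d x y < r / 2 -> d y z < r / 2 -> d x z < r.
Proof. by move=> hx hy hz; have := d_tri hx hy hz; lra. Qed.

Section Developing.
Variables (R : realType) (t : R) (G : set 'M[R]_5).
Variable over : 'rV[R]_5 -> bool * bool -> 'rV[R]_5 -> Prop.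
Hypothesis cov : covering t G over.
Implicit Types (x y z v w p q : 'rV[R]_5) (L M N h : 'M[R]_5) (l : bool * bool).

Local Notation c := (ctr R).

(** An injectivity radius at [x]: proper discontinuity leaves finitely many elements with small
    displacement, and freeness makes these displacements positive. *)
Lemma group_radius x : inH x -> exists2 r, 0 < r &
  forall M y, G M -> inH y -> d x y < r -> d x (y *m M) < r -> M = 1%:M.
Proof.
move=> hx; have /finite_seqP[s hs] := cov_fin cov 1 hx.
have [] := @min_radius R _ s (fun M r => G M -> M <> 1%:M -> 2 * r <= d x (x *m M)).
- by move=> M r r' rr h GM M1; have := h GM M1; lra.
- move=> M _; have [GM|nG] := pselect (G M); last by exists 1.
  have [->|M1] := eqVneq M 1%:M; first by exists 1.
  have hxM : inH (x *m M) by apply: (proj2 (cov_Lo cov GM)).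
  exists (d x (x *m M) / 2) => [|_ _]; last by lra.
  rewrite divr_gt0 // d_gt0 //; apply: contra_neq M1 => /esym.
  exact: (cov_free cov GM hx).
move=> r r0 hr; exists (Num.min r (1 / 2)); first by rewrite lt_min r0; lra.
move=> M y GM hy; rewrite !lt_min => /andP[y1 y2] /andP[y3 y4].
have LM := cov_Lo cov GM.
have := d_tri hx (proj2 LM _ hy) (proj2 LM _ hx).
rewrite (Lo_d _ _ LM) (d_sym y) => tri.
apply: contrapT => M1; have : M \in s.
  have : [set` s] M by rewrite -hs; split=> //; lra.
  by [].
by move=> /hr /(_ GM M1); lra.
Qed.

Lemma orbit_closed x z : inH x -> inH z ->
  (forall e, 0 < e -> exists2 M, G M & d x (z *m M) < e) -> exists2 M, G M & x = z *m M.
Proof.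
move=> hx hz near_x; apply: contrapT => no.
have /finite_seqP[s hs] := cov_fin cov (d z x + 1) hz.
have [] := @min_radius R _ s (fun M r => G M -> r <= d x (z *m M)).
- by move=> M r r' rr h /h; apply: le_trans.
- move=> M _; have [GM|nG] := pselect (G M); last by exists 1.
  exists (d x (z *m M)) => //; apply: d_gt0 => //; first exact: (proj2 (cov_Lo cov GM)).
  by apply/eqP => e; apply: no; exists M.
move=> r r0 hr; have m0 : 0 < Num.min r 1 by rewrite lt_min r0 ltr01.
have [M GM] := near_x _ m0; rewrite lt_min => /andP[M1 M2].
have hzM := proj2 (cov_Lo cov GM) _ hz.
have : [set` s] M.
  by rewrite -hs; split=> //; have := d_tri hz hx hzM; lra.
by move=> /hr/(_ GM); rewrite leNgt M1.
Qed.

(** Lifts of nearby points [q] yield, by [cov_near], lifts of [p] close to [p *m h]; these lie in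
    one orbit, and orbits are closed. *)
Lemma over_closed l h p : Lo h -> inP t p ->
  (forall e, 0 < e -> exists q, [/\ inP t q, d p q < e & over (q *m h) l q]) ->
  over (p *m h) l p.
Proof.
move=> Lh hp near_p; have hpH : inH p by case: hp.
have [z oz] := cov_surj cov l hp; have [hz _] := cov_dom cov oz.
have [|M GM ->] := @orbit_closed (p *m h) z (proj2 Lh _ hpH) hz; last exact: cov_orbit cov _ _ _ _ oz GM.
move=> e e0; have e20 : 0 < e / 2 by rewrite divr_gt0.
have [q [hq pq oq]] := near_p _ e20; have hqH : inH q by case: hq.
have [|y oy qy] := cov_near cov (r := e / 2) oq hp; first by rewrite d_sym.
have [M GM yE] := cov_fiber cov oz oy; exists M => //; rewrite -yE.
have [hy _] := cov_dom cov oy.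
have := d_tri (proj2 Lh _ hpH) (proj2 Lh _ hqH) hy.
by rewrite (Lo_d _ _ Lh); lra.
Qed.

Lemma germ l p x : inPo t p -> over x l p ->
  exists h r, [/\ Lo h, p *m h = x, 0 < r &
    forall q, inH q -> d p q < r -> inPo t q /\ over (q *m h) l q].
Proof.
move=> ip ox; have [hx _] := cov_dom cov ox; have hp : inH p by case: ip.
have [r1 r10 h1] := inPo_ball ip; have [r2 r20 h2] := cov_dist cov ip.
have [r3 r30 h3] := group_radius hx.
(* The factor 3 leaves room for two preimages within [r] of [x] and a competing preimage within
   [2 * r] of one of them, all inside the injectivity radius. *)
pose r := Num.min (Num.min r1 r2) (r3 / 3).
have r0 : 0 < r by rewrite !lt_min r10 r20 divr_gt0.
have [rr1 rr2 rr3] : [/\ r <= r1, r <= r2 & r <= r3 / 3].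
  by rewrite !ge_min !lexx !orbT.
pose S := [set q | inH q /\ d p q < r].
have iS q : S q -> inPo t q by case=> hq pq; apply: h1 => //; apply: lt_le_trans rr1.
have /choice[z hz] : forall q, exists y, S q -> over y l q /\ d x y < r.
  move=> q; have [Sq|nS] := pselect (S q); last by exists 0.
  have [y oy xy] := cov_near cov ox (inPo_inP (iS _ Sq)) (proj2 Sq).
  by exists y.
have zH q : S q -> inH (z q) by move=> /hz[/(cov_dom cov)[]].
(* The probe gives one inequality. If the other failed, [cov_near] would produce a closer preimage
   of [q'], distinct from [z q'] but still inside the injectivity radius. *)
have iso q q' : S q -> S q' -> d (z q) (z q') = d q q'.
  move=> Sq Sq'; have [oq xq] := hz q Sq; have [oq' xq'] := hz q' Sq'.
  apply: le_anti; apply/andP; split; last first.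
    by apply: (h2 l) => //; [case: Sq|case: Sq'] => _ /lt_le_trans; apply.
  rewrite leNgt; apply/negP => lt_qq'.
  have [y oy qy] := cov_near cov oq (inPo_inP (iS _ Sq')) lt_qq'.
  have [M GM yE] := cov_fiber cov oq' oy; have [hy _] := cov_dom cov oy.
  have hzq := zH q Sq; have hzq' := zH q' Sq'.
  have M1 : M = 1%:M.
    apply: (h3 M (z q') GM hzq'); first by lra.
    rewrite -yE; have := d_tri hx hzq hy; have := d_tri hzq hx hzq'.
    by rewrite (d_sym (z q) x); lra.
  by move: qy; rewrite yE M1 mulmx1 ltxx.
have [Q QU hQ] := ball_basis hp r0.
have [|q q' Sq Sq'|h Lh hE] := @lor_extension R S z Q QU hQ.
- by move=> q Sq; split; [case: Sq|exact: zH].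
- by apply: d_lor; [exact: zH|exact: zH|case: Sq|case: Sq'|exact: iso].
exists h, r; split=> // [|q hq pq].
  have Sp : S p by rewrite /S /= dxx.
  rewrite -hE //; have [op xp] := hz p Sp.
  have [M GM zE] := cov_fiber cov ox op.
  suff M1 : M = 1%:M by rewrite zE M1 mulmx1.
  by apply: (h3 M x GM hx); rewrite ?dxx // -zE; lra.
have Sq : S q by [].
by split; [exact: iS|rewrite -hE //; case: (hz q Sq)].
Qed.

Definition tile_map l L := Lo L /\ forall p, inP t p -> over (p *m L) l p.

Lemma lift_through l p x : inPo t p -> over x l p -> exists2 L, tile_map l L & p *m L = x.
Proof.
move=> ip ox; have hp : inH p by case: ip.
have [h [r [Lh phx r0 hr]]] := germ ip ox; exists h => //; split=> // q iq.
have hq : inH q by case: iq.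
pose W s := nrm (seg p q s).
have WH s : 0 <= s <= 1 -> inH (W s).
  by case/andP=> s0 s1; apply: nrm_inH; case: (seg_future hp hq s0 s1).
(* Asking that [h] lift a whole ball around [W s], not just the point, is what identifies the next
   germ with [h]. *)
pose good s := exists2 e, 0 < e & forall y, inH y -> d (W s) y < e ->
  inP t y /\ over (y *m h) l y.
have goodW s : 0 <= s <= 1 -> good s -> inP t (W s) /\ over (W s *m h) l (W s).
  by move=> s01 [e e0 he]; have hw := WH s s01; apply: he; rewrite ?dxx.
suff allgood s : 0 <= s <= 1 -> s < 1 -> good s.
  apply: over_closed => // e e0.
  have s11 : 0 <= (1 : R) <= 1 by rewrite ler01 lexx.
  have [e1 e10 he1] := seg_cont hp hq s11 e0.
  have [s /andP[s0 s1] se] := left_approx ltr01 e10.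
  have s01 : 0 <= s <= 1 by rewrite s0 ltW.
  have [iW oW] := goodW s s01 (allgood s s01 s1).
  exists (W s); split=> //.
  by have := he1 s s01 se; rewrite seg1 nrm_id.
move: s; apply: segment_induction => s s01 IH.
(* Nothing is asked at [s = 1], where [q] may lie on a wall; that endpoint is reached above by
   closedness. *)
have [s_lt1|s_ge1] := ltP s 1; last first.
  exists 1 => // u /andP[u0 u1] _ ult1; apply: IH; first by rewrite u0 (lt_le_trans ult1).
  by [].
have [s0 s1] := andP s01.
have [_ /(_ s_lt1) iWs] := nrm_seg_inP ip iq s0 s1.
have near_s e : 0 < e -> exists u, [/\ 0 <= u <= 1, good u & d (W s) (W u) < e].
  move=> e0; move: s0; rewrite le_eqVlt => /orP[/eqP s00|s_gt0].
    exists 0; rewrite /W -s00 seg0 nrm_id // dxx //; split=> //; first by rewrite lexx ler01.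
    exists r => // y hy; rewrite /W seg0 nrm_id // => /(hr y hy)[/inPo_inP].
    by split.
  have [e1 e10 he1] := seg_cont hp hq s01 e0.
  have [u us ue] := left_approx s_gt0 e10; have [u0 ults] := andP us.
  have u1 : u < 1 by exact: lt_trans s_lt1.
  have u01 : 0 <= u <= 1 by rewrite u0 ltW.
  by exists u; split=> //; [exact: IH|exact: he1].
have oWs : over (W s *m h) l (W s).
  apply: over_closed => [//||e /near_s[u [u01 gu su]]]; first exact: inPo_inP.
  by have [iu ou] := goodW u u01 gu; exists (W u).
have [h' [r' [Lh' Wh' r'0 hr']]] := germ iWs oWs.
have hWh : inH (W s *m h) by apply: (proj2 Lh); exact: WH.
have [r3 r30 h3] := group_radius hWh.
pose e := Num.min r' r3 / 2.
have m0 : 0 < Num.min r' r3 by rewrite lt_min r'0.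
have m1 : Num.min r' r3 <= r' by rewrite ge_min lexx.
have m2 : Num.min r' r3 <= r3 by rewrite ge_min lexx orbT.
have e0 : 0 < e by rewrite /e; lra.
have [u [u01 [eu eu0 heu] su]] := near_s e e0.
(* Both matrices lift a common small ball near [W s] into the injectivity radius, so the group
   element relating the two lifts of each of its points is trivial. *)
have hh' : h = h'.
  have mm0 : 0 < Num.min eu e by rewrite lt_min eu0.
  apply: (ball_eq (WH u u01) mm0) => y hy; rewrite lt_min => /andP[y1 y2].
  have sy : d (W s) y < Num.min r' r3 by exact: d_tri_half (WH s s01) (WH u u01) hy su y2.
  have [_ oy] := heu y hy y1; have [|_ oy'] := hr' y hy; first exact: lt_le_trans m1.
  have [M GM E] := cov_fiber cov oy oy'.
  suff M1 : M = 1%:M by rewrite E M1 mulmx1.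
  apply: (h3 M (y *m h) GM (proj2 Lh _ hy)).
    by rewrite (Lo_d _ _ Lh); exact: lt_le_trans m2.
  by rewrite -E -Wh' (Lo_d _ _ Lh'); exact: lt_le_trans m2.
have r'20 : 0 < r' / 2 by rewrite divr_gt0.
have [e1 e10 he1] := seg_cont hp hq s01 r'20.
exists e1 => // v v01 vs _; exists (r' / 2) => // y hy vy.
have [|/inPo_inP iy oy] := hr' y hy; last by rewrite hh'.
exact: d_tri_half (WH s s01) (WH v v01) hy (he1 v v01 vs) vy.
Qed.

Lemma lift_orbit l L M : tile_map l L -> G M -> tile_map l (L *m M).
Proof.
move=> [LL hL] GM; split=> [|p ip]; first exact: LoM LL (cov_Lo cov GM).
by rewrite mulmxA; apply: cov_orbit cov _ _ _ _ (hL p ip) GM.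
Qed.

Lemma lift_rigid l L L' p : tile_map l L -> tile_map l L' -> inPo t p -> p *m L = p *m L' -> L = L'.
Proof.
move=> [LL hL] [LL' hL'] ip e; have hp : inH p by case: ip.
have [r1 r10 h1] := inPo_ball ip; have [r3 r30 h3] := group_radius (proj2 LL _ hp).
have m0 : 0 < Num.min r1 r3 by rewrite lt_min r10.
apply: (ball_eq hp m0) => y hy; rewrite lt_min => /andP[y1 y3].
have iy := inPo_inP (h1 y hy y1).
have [M GM E] := cov_fiber cov (hL y iy) (hL' y iy).
suff M1 : M = 1%:M by rewrite E M1 mulmx1.
apply: (h3 M (y *m L) GM (proj2 LL _ hy)); first by rewrite (Lo_d _ _ LL).
by rewrite -E e (Lo_d _ _ LL').
Qed.

Lemma lift_fiber l L L' : tile_map l L -> tile_map l L' -> exists2 M, G M & L' = L *m M.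
Proof.
move=> HL HL'; have ic := inPo_ctr t.
have [M GM E] := cov_fiber cov (proj2 HL _ (inPo_inP ic)) (proj2 HL' _ (inPo_inP ic)).
exists M => //; apply/esym/(lift_rigid (lift_orbit HL GM) HL' ic).
by rewrite mulmxA.
Qed.

(** The tiles with label [l] form a single orbit of the group, so their finiteness is that of a
    properly discontinuous action. *)
Lemma lift_fin l z K : inH z -> finite_set [set L | tile_map l L /\ d z (c *m L) <= K].
Proof.
move=> hz; have [[L0 HL0]|no] := pselect (exists L, tile_map l L); last first.
  by apply: sub_finite_set (finite_set0 _) => L [HL _]; apply: no; exists L.
have hc := ctr_inH R; have hcL : inH (c *m L0) by apply: (proj2 (proj1 HL0)).
have := finite_image (mulmx L0) (cov_fin cov (d (c *m L0) z + K) hcL).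
apply: sub_finite_set => L [HL zL]; have [M GM E] := lift_fiber HL0 HL.
exists M => //; split=> //; rewrite -mulmxA -E.
by have := d_tri hcL hz (proj2 (proj1 HL) _ hc); lra.
Qed.

(** Local finiteness makes the union of any subfamily [C] of tiles closed. In place of a bound on
    the diameter of the polytope, [cov_lip] confines the centres of the tiles that come near [z]. *)
Lemma tile_closed (C : bool * bool -> 'M[R]_5 -> Prop) z : inH z ->
  (forall e, 0 < e -> exists l L p, [/\ tile_map l L, C l L, inP t p & d z (p *m L) < e]) ->
  exists l L p, [/\ tile_map l L, C l L, inP t p & z = p *m L].
Proof.
move=> hz near_z; apply: contrapT => no; have hc := ctr_inH R.
(* If [p *m L] is within 1 of [z], then [d c p] exceeds [d c p0] by at most 1, and one more unit is
   spent between [z] and [p *m L]. *)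
have [l0 [p0 oz]] := cov_total cov hz; pose K := d c p0 + 2.
have fin : finite_set (\bigcup_(l in [set: bool * bool])
    [set lL : (bool * bool) * 'M[R]_5 | lL.1 = l /\ tile_map l lL.2 /\ d z (c *m lL.2) <= K]).
  apply: bigcup_finite => [|l _]; first exact: finite_finset.
  apply: sub_finite_set (finite_image (fun L => (l, L)) (lift_fin l K hz)).
  by move=> [l' L] /= [-> [HL zL]]; exists L.
have /finite_seqP[s hs] := fin.
have [] := @min_radius R _ s (fun lL r => C lL.1 lL.2 -> tile_map lL.1 lL.2 ->
    forall p, inP t p -> r <= d z (p *m lL.2)).
- by move=> v r r' rr h h1 h2 p ip; apply: le_trans rr (h h1 h2 p ip).
- move=> [l L] _ /=; have [[CL HL]|nC] := pselect (C l L /\ tile_map l L); last first.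
    by exists 1 => // CL HL; case: nC.
  have LL := proj1 HL; have LU := Lo_unit LL.
  have hzL : inH (z *m invmx L) by apply: (proj2 (LoV LL)).
  have [v wv vz] : exists2 v, wall t v & 0 < lor v (z *m invmx L).
    apply: contrapT => nv; apply: no; exists l, L, (z *m invmx L); split=> //.
      by split=> // v wv; rewrite leNgt; apply/negP => h; apply: nv; exists v.
    by rewrite mulmxKV.
  have [r r0 hr] := lor_cont v hzL vz; exists r => // _ _ p [hp ip].
  rewrite leNgt; apply/negP; rewrite -{1}[z](mulmxKV LU) (Lo_d _ _ LL) => /(hr p hp).
  by rewrite ltr_norml => /andP[h _]; have := ip v wv; lra.
move=> r r0 hr; have m0 : 0 < Num.min r 1 by rewrite lt_min r0 ltr01.
have [l [L [p [HL CL ip]]]] := near_z _ m0; rewrite lt_min => /andP[z1 z2].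
have : (l, L) \in s; last by move=> /hr/(_ CL HL p ip) /=; rewrite leNgt z1.
have : [set` s] (l, L); last by [].
rewrite -hs; exists l => //; split=> //; split=> //=.
have hp : inH p by case: ip.
have LL := proj1 HL; have hpL := proj2 LL _ hp; have hcL := proj2 LL _ hc.
have := cov_lip cov oz (proj2 HL _ ip); have := d_tri hz hpL hcL.
by rewrite (Lo_d _ _ LL) (d_sym p) ler_norml /K => ? /andP[]; lra.
Qed.

(** A point over a wall cannot be lifted through directly; it is approached by points over the
    interior of the same copy, and the union of tiles is closed. *)
Lemma tiles_cover z : inH z -> exists l L p, [/\ tile_map l L, inP t p & z = p *m L].
Proof.
move=> hz; have [l0 [p0 oz]] := cov_total cov hz; have [_ ip0] := cov_dom cov oz.
have hp0 : inH p0 by case: ip0.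
have [e e0|l [L [p [HL _ ip zE]]]] := @tile_closed (fun _ _ => True) z hz; last by exists l, L, p.
have hc := ctr_inH R.
have s11 : 0 <= (1 : R) <= 1 by rewrite ler01 lexx.
have [e1 e10 he1] := seg_cont hc hp0 s11 e0.
have [s /andP[s0 s1] se] := left_approx ltr01 e10; have s1' := ltW s1.
have s01 : 0 <= s <= 1 by rewrite s0.
have [_ /(_ s1) iW] := nrm_seg_inP (inPo_ctr t) ip0 s0 s1'.
have [|y oy zy] := cov_near cov (r := e) oz (inPo_inP iW).
  by have := he1 s s01 se; rewrite seg1 nrm_id.
have [L HL LW] := lift_through iW oy.
by exists l0, L, (nrm (seg c p0 s)); split=> //; [exact: inPo_inP|rewrite LW].
Qed.

Definition opp_mx : 'M[R]_5 := sval (cid2 (WQ_rsym t)).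

Lemma opp_mx_WQ : WQ t opp_mx.
Proof. by rewrite /opp_mx; case: cid2. Qed.

Lemma opp_mxE x : x *m opp_mx = rsym x.
Proof. by rewrite /opp_mx; case: cid2. Qed.

Lemma lift_opp l L : tile_map l L -> tile_map (opp_copy l) (opp_mx *m L).
Proof.
move=> [LL hL]; split=> [|p ip]; first by apply: LoM LL; case: opp_mx_WQ.
rewrite mulmxA opp_mxE -{2}[p]rsymK; apply: (cov_opp cov); apply: hL.
exact: inP_rsym.
Qed.

(** A tile that meets the interior of another one is the same subset; the second alternative is its
    other label under the involution. *)
Lemma tile_rigid l L l' L' p p' : tile_map l L -> tile_map l' L' -> inPo t p -> inP t p' ->
  p *m L = p' *m L' -> (l' = l /\ L' = L) \/ (l' = opp_copy l /\ L' = opp_mx *m L).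
Proof.
move=> HL HL' ip ip' e; have o := proj2 HL p (inPo_inP ip).
have o' := proj2 HL' p' ip'; rewrite -e in o'.
have [[ll pp]|[ll pp]] := cov_int cov ip o o'; subst l' p'; [left|right]; split=> //.
  by apply/esym/(lift_rigid HL HL' ip).
have HL2 := lift_opp HL'; rewrite opp_copyK in HL2.
have -> : L = opp_mx *m L' by apply: (lift_rigid HL HL2 ip); rewrite e mulmxA opp_mxE.
rewrite mulmxA; have -> : opp_mx *m opp_mx = 1%:M; last by rewrite mul1mx.
by apply/row_matrixP => i; rewrite !rowE mulmxA !opp_mxE rsymK mulmx1.
Qed.

End Developing.

(** * Neighbouring tiles *)

Lemma poly_roots_seq (F : fieldType) (P : {poly F}) : P != 0 ->
  exists s : seq F, forall x, root P x -> x \in s.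
Proof.
elim: {P}(size P) {-2}P (leqnn (size P)) => [P|n IH P Pn P0].
  by rewrite leqn0 size_poly_eq0 => ->.
have [[x /factor_theorem[Q PQ]]|no] := pselect (exists x, root P x); last first.
  by exists [::] => x rx; case: no; exists x.
have Q0 : Q != 0 by apply: contraNneq P0 => Q0; rewrite PQ Q0 mul0r.
have [|s hs] := IH Q _ Q0.
  by move: Pn; rewrite PQ size_Mmonic ?monicXsubC // size_XsubC addn2.
exists (x :: s) => y; rewrite PQ rootM root_XsubC inE => /orP[/hs->|->] //.
by rewrite orbT.
Qed.

Lemma countable_avoid (R : realType) (S : set R) e : countable S -> 0 < e ->
  exists2 s, 0 < s < e & ~ S s.
Proof.
move=> cS e0; apply: contrapT => no.
have sub : `]0, e[ `<=` S.
  move=> s /=; rewrite in_itv /= => s0e; apply: contrapT => nS; apply: no.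
  by exists s.
have := countable_lebesgue_measure0 (countable_subset sub cS).
rewrite lebesgue_measure_itv /= lte_fin e0 sube0 => -[] /eqP.
by rewrite gt_eqF.
Qed.

Section LiftClasses.
Variables (R : realType) (t : R).
Hypotheses (t0 : 0 < t) (t2 : 1 / 2 < t ^+ 2) (t_rat : ratl (t ^+ 2)).
Variables (G : set 'M[R]_5) (over : 'rV[R]_5 -> bool * bool -> 'rV[R]_5 -> Prop).
Hypothesis cov : covering t G over.
Implicit Types (x y z v w p q n : 'rV[R]_5) (L M N h : 'M[R]_5) (l : bool * bool).

Local Notation c := (ctr R).
Local Notation tile_map := (tile_map t over).
Local Notation WQV := (WQV t0 t_rat).

(** A polynomial curve starting at the centre that meets every hyperplane through the origin in
    finitely many points. It supplies an endpoint outside countably many hyperplanes. *)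
Definition curve (s : R) : 'rV[R]_5 := vec5 (1 + s) (s ^+ 2) (s ^+ 3) (s ^+ 4) (s ^+ 5).

Lemma curve_inPo : exists2 e, 0 < e & forall s, 0 < s < e ->
  future (curve s) /\ inPo t (nrm (curve s)).
Proof.
have [s hs] := wall_seq t.
have [] := @min_radius R _ s (fun v r => wall t v -> forall u, 0 < u < r ->
   lor v (curve u) < 0).
- by move=> v r r' rr h wv u /andP[u0 ur]; apply: h; rewrite ?u0 // (lt_le_trans ur).
- move=> v _; have [wv|nw] := pselect (wall t v); last by exists 1.
  have v0 : 0 < hcoord v 0.
    by have := wall_ctr wv; rewrite lorE /ctr !hcoord_vec5 //=; lra.
  pose M := `|hcoord v 1| + `|hcoord v 2| + `|hcoord v 3| + `|hcoord v 4|.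
  have M0 : 0 <= M by rewrite /M !addr_ge0.
  exists (Num.min 1 (hcoord v 0 / (M + 1))) => [|_ u].
    by rewrite lt_min ltr01 divr_gt0 //; lra.
  rewrite lt_min => /and3P[u0 u1]; rewrite ltr_pdivlMr; last by lra.
  move=> uM; rewrite lorE /curve !hcoord_vec5 //=.
  have B k : (k < 5)%N -> forall m, (0 < m)%N -> hcoord v k * u ^+ m <= `|hcoord v k| * u.
    move=> _ m m0; apply: (le_trans (ler_norm _)); rewrite normrM ler_wpM2l //.
    rewrite normrX (gtr0_norm u0) -{2}(expr1 u).
    by apply: ler_wiXn2l; rewrite ?(ltW u0) ?(ltW u1).
  have b1 := B 1 isT 2 isT; have b2 := B 2 isT 3 isT.
  have b3 := B 3 isT 4 isT; have b4 := B 4 isT 5 isT.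
  have : M * u < hcoord v 0 by nra.
  rewrite /M => h; have := mulr_gt0 v0 u0; lra.
move=> r r0 hr; exists (Num.min r (1 / 2)) => [|u]; first by rewrite lt_min r0; lra.
rewrite lt_min => /and3P[u0 ur u2].
have F : future (curve u).
  rewrite /future lorE /curve !hcoord_vec5 //=; apply/andP; split; last by lra.
  have B m : u ^+ m * u ^+ m <= 1.
    have : u ^+ m <= 1 by rewrite exprn_ile1 //; lra.
    have : 0 <= u ^+ m by rewrite exprn_ge0 // ltW.
    nra.
  have B2 : u ^+ 2 <= 1 / 4 by nra.
  have B20 : 0 <= u ^+ 2 by exact: sqr_ge0.
  have e3 : u ^+ 3 = u * u ^+ 2 by rewrite exprS.
  have e4 : u ^+ 4 = u ^+ 2 * u ^+ 2 by rewrite -exprD.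
  have e5 : u ^+ 5 = u * (u ^+ 2 * u ^+ 2) by rewrite -e4 exprS.
  have b3 : u ^+ 3 <= 1 / 4 by rewrite e3; nra.
  have b30 : 0 <= u ^+ 3 by rewrite e3; nra.
  have b4 : u ^+ 4 <= 1 / 4 by rewrite e4; nra.
  have b40 : 0 <= u ^+ 4 by rewrite e4; nra.
  have b5 : u ^+ 5 <= 1 / 4 by rewrite e5 -e4; nra.
  have b50 : 0 <= u ^+ 5 by rewrite e5 -e4; nra.
  nra.
split=> //; split; first exact: nrm_inH.
move=> v wv; have [a a0 ->] := nrmE F; rewrite lorZr pmulr_rlt0 //.
by apply: (hr v _ wv); [apply/hs|rewrite u0].
Qed.

Lemma curve_roots n : n <> 0 -> countable [set s | lor n (curve s) = 0].
Proof.
move=> n0.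
pose P : {poly R} := Poly [:: - hcoord n 0; - hcoord n 0; hcoord n 1; hcoord n 2;
   hcoord n 3; hcoord n 4].
have P0 : P != 0.
  apply/eqP => P0; apply: n0; apply/row5P => k k5; rewrite [RHS]mxE.
  have E i : [:: - hcoord n 0; - hcoord n 0; hcoord n 1; hcoord n 2;
     hcoord n 3; hcoord n 4]`_i = 0 by rewrite -coef_Poly -/P P0 coef0.
  case: k k5 => [|[|[|[|[|]]]]] // _.
  - by have /= /eqP := E 0%N; rewrite oppr_eq0 => /eqP.
  - exact: (E 2).
  - exact: (E 3).
  - exact: (E 4).
  - exact: (E 5).
have [s hs] := poly_roots_seq P0; apply: finite_set_countable.
apply: sub_finite_set (finite_seq s) => u /= nu; apply: hs.
apply/eqP; rewrite horner_Poly /=; apply: etrans nu.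
by rewrite lorE /curve !hcoord_vec5 //=; ring.
Qed.

Definition same_class L L' := WQ t (L' *m invmx L).

Lemma same_class_trans L L' L'' : Lo L' ->
  same_class L L' -> same_class L' L'' -> same_class L L''.
Proof.
move=> /Lo_unit LU' h h'; have := WQM h' h.
by rewrite mulmxA mulmxKV.
Qed.

Lemma same_class_mul L M : Lo L -> WQ t M -> same_class L (M *m L).
Proof. by move=> /Lo_unit LU WM; rewrite /same_class mulmxK. Qed.

(* Two tiles of different classes meet at most in codimension 2 subspaces: on a wall, L and
   w L' cannot agree on the whole hyperplane, since then L' L^-1 would be w^-1 or w^-1
   composed with the (rational) reflection in that wall. *)
Lemma meeting_functional L L' (w : 'M[R]_5) v (a : 'rV[R]_5) : Lo L -> Lo L' -> WQ t w -> wall t v ->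
  ~ same_class L L' -> exists n, [/\ n <> 0, lor n a = 0 &
    forall p, lor v p = 0 -> p *m L = p *m w *m L' -> lor n (p *m L) = 0].
Proof.
move=> LL LL' Ww wv nc; have LU := Lo_unit LL; have [Lw _] := Ww.
have v0 := wall_norm t0 t2 wv.
have [p1 vp1 ne] : exists2 p1, lor v p1 = 0 & p1 *m L <> p1 *m w *m L'.
  apply: contrapT => no; apply: nc.
  pose N := w *m L' *m invmx L.
  have WN : WQ t N.
    have [|||->|->] := @fix_hyperplane R v N.
    - by rewrite gt_eqF.
    - by apply: LoM (LoV LL); apply: LoM.
    - move=> y vy; rewrite /N !mulmxA; apply: contrapT => h; apply: no; exists y => // e.
      by apply: h; rewrite -e mulmxK.
    - exact: WQ1.
    - exact: wall_WQ.
  have -> : L' = invmx w *m (N *m L).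
    by rewrite /N mulmxKV // mulKmx // Lo_unit.
  rewrite mulmxA; apply: same_class_mul => //; exact: WQM (WQV Ww) WN.
pose K := invmx L *m w *m L'.
have LK : Lo K by apply: LoM LL'; apply: LoM Lw; exact: LoV.
have [u u1] : exists u, lor u (p1 *m L - p1 *m w *m L') <> 0.
  apply: contrapT => no; apply: ne; apply/eqP; rewrite -subr_eq0; apply/eqP.
  apply: lor_nondeg => u; rewrite lorC; apply: contrapT => h; apply: no.
  by exists u.
(* Two functionals vanish on the meeting set: [m1] cuts out the wall, and [m2] measures, along [u],
   the difference of the two maps. Some member of their pencil also vanishes at [a]. *)
have [m1 m1E] : exists m1, forall p, lor m1 (p *m L) = lor v p.
  by exists (v *m L) => p; rewrite (proj1 LL).
have [m2 m2E] : exists m2, forall p, lor m2 (p *m L) = lor u (p *m L - p *m w *m L').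
  exists (u - u *m invmx K) => p.
  rewrite !lorL; congr (_ - _); rewrite -(proj1 LK) mulmxKV ?Lo_unit //.
  by congr lor; rewrite /K !mulmxA mulmxK.
have [m1a|m1a] := eqVneq (lor m1 a) 0.
  exists m1; split=> // [m10|p vp _]; last by rewrite m1E.
  by move: v0; rewrite -m1E m10 lor0l ltxx.
exists (lor m1 a *: m2 - lor m2 a *: m1); split=> [n0||p vp e].
- apply: u1; have : lor (lor m1 a *: m2 - lor m2 a *: m1) (p1 *m L) = 0.
    by rewrite n0 lor0l.
  rewrite !lorL m1E m2E vp1 mulr0 subr0 => /eqP.
  by rewrite mulf_eq0 (negPf m1a) /= !lorL => /eqP.
- by rewrite !lorL; ring.
- by rewrite !lorL m1E m2E vp -e subrr lor0r; ring.
Qed.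

Lemma lift_countable : countable [set lL : (bool * bool) * 'M[R]_5 | tile_map lL.1 lL.2].
Proof.
have hc := ctr_inH R.
have : countable (\bigcup_(k in [set: (bool * bool) * nat])
   [set lL : (bool * bool) * 'M[R]_5 | lL.1 = k.1 /\
      (tile_map k.1 lL.2 /\ d c (c *m lL.2) <= k.2%:R)]).
  apply: bigcup_countable => // k _; apply: finite_set_countable.
  apply: sub_finite_set (finite_image (fun L => (k.1, L)) (lift_fin cov k.1 k.2%:R hc)).
  by move=> [l L] /= [-> [HL cL]]; exists L.
apply: countable_subset => -[l L] /= HL.
exists (l, (Num.truncn (d c (c *m L))).+1) => //=; split=> //; split=> //.
by apply/ltW/truncnS_gt.
Qed.

Lemma lift_class l1 L1 l2 L2 : tile_map l1 L1 -> tile_map l2 L2 -> same_class L1 L2.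
Proof.
move=> H1 H2; apply: contrapT => nc12; have hc := ctr_inH R.
have LL1 := proj1 H1; have LL2 := proj1 H2.
pose a := c *m L1; have ha : inH a by apply: (proj2 LL1).
pose I := ([set lL : (bool * bool) * 'M[R]_5 | tile_map lL.1 lL.2] `*`
  [set lL : (bool * bool) * 'M[R]_5 | tile_map lL.1 lL.2]) `*`
  ([set w | WQ t w] `*` [set v | wall t v]).
have cI : countable I.
  apply: countableX; apply: countableX; try exact: lift_countable.
    exact: WQ_countable.
  have [s hs] := wall_seq t; apply: finite_set_countable.
  by apply: sub_finite_set (finite_seq s) => v /hs.
have /choice[n hn] : forall k, exists n, I k -> ~ same_class k.1.1.2 k.1.2.2 ->
   [/\ n <> 0, lor n a = 0 & forall p, lor k.2.2 p = 0 ->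
     p *m k.1.1.2 = p *m k.2.1 *m k.1.2.2 -> lor n (p *m k.1.1.2) = 0].
  move=> [[[l L] [l' L']] [w v]] /=.
  have [[[[HL HL'] [Ww wv]] nc]|no] := pselect
      (I ((l, L), (l', L'), (w, v)) /\ ~ same_class L L'); last first.
    by exists 0 => Ik nc; case: no.
  have [n hn] := meeting_functional a (proj1 HL) (proj1 HL') Ww wv nc.
  by exists n.
pose J := [set k | I k /\ ~ same_class k.1.1.2 k.1.2.2].
(* The functionals depend on the starting point [a] alone, so they are fixed before the other
   endpoint [b] is chosen off their kernels. *)
have cS : countable (\bigcup_(k in J) [set s | lor (n k) (curve s *m L2) = 0]).
  apply: bigcup_countable; first by apply: countable_subset cI => k [].
  move=> k [Ik nc]; have [n0 _ _] := hn k Ik nc.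
  have : n k *m invmx L2 <> 0.
    by move=> e; apply: n0; rewrite -[n k](mulmxKV (Lo_unit LL2)) e mul0mx.
  move/curve_roots; apply: countable_subset => s /=.
  by rewrite -(proj1 LL2 (n k *m invmx L2)) mulmxKV ?Lo_unit.
have [e e0 he] := curve_inPo.
have [s s0e sS] := countable_avoid cS e0.
have [Fs iq] := he s s0e; pose q := nrm (curve s); have hq : inH q by case: iq.
pose b := q *m L2; have hb : inH b by apply: (proj2 LL2).
have nb k : J k -> lor (n k) b <> 0.
  move=> Jk h; apply: sS; exists k => //=; move: h; rewrite /b /q.
  have [r r0 ->] := nrmE Fs; rewrite -scalemxAl lorZr => /eqP.
  by rewrite mulf_eq0 (gt_eqF r0) => /eqP.
pose U2 z := exists l L p, [/\ tile_map l L, ~ same_class L1 L, inP t p & z = p *m L].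
pose W u := nrm (seg a b u).
have WH u : 0 <= u <= 1 -> inH (W u).
  by case/andP=> u0 u1; apply: nrm_inH; case: (seg_future ha hb u0 u1).
have interior l L p l' L' p' : tile_map l L -> tile_map l' L' -> inPo t p -> inP t p' ->
    p *m L = p' *m L' -> same_class L L'.
  move=> HL HL' ip ip' E; case: (tile_rigid cov HL HL' ip ip' E) => -[_ ->].
    by rewrite -{2}[L]mul1mx; apply: same_class_mul; [case: HL|exact: WQ1].
  by apply: same_class_mul; [case: HL|exact: opp_mx_WQ].
have U2a : ~ U2 a.
  move=> [l [L [p [HL nc ip E]]]]; apply: nc; exact: interior H1 HL (inPo_ctr t) ip E.
suff : forall u, 0 <= u <= 1 -> ~ U2 (W u).
  move=> /(_ 1); rewrite ler01 lexx => /(_ isT); apply.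
  exists l2, L2, q; split=> //; first exact: inPo_inP.
  by rewrite /W seg1 nrm_id.
apply: segment_induction => u u01 IH; have hWu := WH u u01.
(* Earlier points of the segment lie in tiles, and by induction only in tiles of the first class;
   the union of these is closed. *)
have [l [L [p [HL CL ip E]]]] : exists l L p, [/\ tile_map l L, same_class L1 L, inP t p & W u = p *m L].
  have [u0|u0] := eqVneq u 0.
    exists l1, L1, c; split=> //; [|exact: inPo_inP (inPo_ctr t)|by rewrite /W u0 seg0 nrm_id].
    by rewrite -{2}[L1]mul1mx; apply: same_class_mul (WQ1 t).
  apply: (tile_closed cov (C := fun _ L => same_class L1 L)) => // r r0.
  have [e1 e10 he1] := seg_cont ha hb u01 r0.
  have [ug0 u1] : 0 < u /\ u <= 1 by case/andP: u01 => h1 h2; rewrite lt_neqAle eq_sym u0.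
  have [x xu xe] := left_approx ug0 e10; have [x0 xltu] := andP xu.
  have x01 : 0 <= x <= 1 by rewrite x0 (le_trans (ltW xltu)).
  have [l [L [p [HL ip E]]]] := tiles_cover cov (WH x x01).
  exists l, L, p; split=> //; last by rewrite -E; exact: he1.
  by apply: contrapT => nc; apply: (IH x xu); exists l, L, p.
have nU : ~ U2 (W u).
  move=> [l' [L' [p' [HL' nc' ip' E']]]].
  have LL := proj1 HL; have LL' := proj1 HL'.
  have ncLL' : ~ same_class L L'.
    by move=> h; apply: nc'; exact: same_class_trans LL CL h.
  have [iop|niop] := pselect (inPo t p).
    by apply: ncLL'; apply: (interior _ _ _ _ _ _ HL HL' iop ip'); rewrite -E E'.
  have [v wv vp] : exists2 v, wall t v & lor v p = 0.
    apply: contrapT => no; apply: niop; case: ip => hp ip; split=> // v wv.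
    by rewrite lt_neqAle ip // andbT; apply/eqP => h; apply: no; exists v.
  have o := proj2 HL p ip; have o' := proj2 HL' p' ip'; rewrite -E in o; rewrite -E' in o'.
  have [w Ww pw] := cov_same cov o o'.
  pose k := ((l, L), (l', L'), (w, v)).
  have Jk : J k by [].
  have [n0 na np] := hn k (proj1 Jk) ncLL'.
  (* [n k] vanishes at [a] and at [W u]. Being linear along the chord, it vanishes at [b] unless
     [u = 0], and both cases are excluded. *)
  have : lor (n k) (p *m L) = 0 by apply: np => //=; rewrite -E E' pw.
  rewrite -E; have [u0 u1] := andP u01.
  have [Fu _] := seg_future ha hb u0 u1; have [r r0] := nrmE Fu; rewrite -/(W u) => ->.
  rewrite lorZr lor_seg na mulr0 add0r => /eqP; rewrite !mulf_eq0 (gt_eqF r0) /=.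
  case/orP => /eqP h; last by case: (nb k Jk).
  by apply: U2a; exists l', L', p'; rewrite -E' /W h seg0 nrm_id.
(* The union of the other classes is closed as well, so it misses a whole neighbourhood of [W u]. *)
have [r r0 hr] : exists2 r, 0 < r & forall y, U2 y -> ~ d (W u) y < r.
  apply: contrapT => no; apply: nU.
  apply: (tile_closed cov (C := fun _ L => ~ same_class L1 L)) => // r r0.
  apply: contrapT => no'; apply: no; exists r => // y [l' [L' [p' [HL' nc' ip' yE]]]] yr.
  by apply: no'; exists l', L', p'; rewrite -yE.
have [e1 e10 he1] := seg_cont ha hb u01 r0; exists e1 => // x x01 xu Ux.
exact: (hr _ Ux (he1 x x01 xu)).
Qed.

(** Points just beyond the wall lie in tiles other than [L] and its opposite label, and closedness
    gives such a tile through [p *m L]. The letter gluing is the identity, so the two lifts agree on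
    the hyperplane and differ by its reflection. *)
Lemma lift_letter l L v p : letter_wall t v -> inH p -> lor v p = 0 ->
  (forall w, wall t w -> w <> v -> lor w p < 0) ->
  tile_map l L -> tile_map (letter_copy l) (refl v *m L).
Proof.
move=> lv hp vp hw HL; have wv : wall t v by constructor 3.
have v0 := wall_norm t0 t2 wv; have LL := proj1 HL; have LU := Lo_unit LL.
pose z := p *m L; have hz : inH z by apply: (proj2 LL).
have [r1 r10 h1] := @wall_ball R t p (fun w => wall t w /\ w <> v) hp (fun _ ww => proj1 ww)
   (fun w ww => hw w (proj1 ww) (proj2 ww)).
have iP q : inH q -> d p q < r1 -> lor v q = 0 -> inP t q.
  move=> hq pq vq; split=> // w ww; have [->|wv'] := eqVneq w v; first by rewrite vq.
  by apply/ltW/(h1 q) => //; split=> //; apply/eqP.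
have ip : inP t p by apply: iP; rewrite ?dxx.
have [l' [L' [p' [HL' [CL CL'] ip' zE]]]] : exists l' L' p',
    [/\ tile_map l' L', L' <> L /\ L' <> opp_mx t *m L, inP t p' & z = p' *m L'].
  apply: (tile_closed cov (C := fun _ L' => L' <> L /\ L' <> opp_mx t *m L)) => // e e0.
  have [e' e'0 [F pF]] := perturb v hp e0.
  set y := nrm _ in pF; have hy : inH y by apply: nrm_inH.
  have niy : ~ inP t y.
    case=> _ /(_ v wv); have [a a0 E] := nrmE F; rewrite /y E !lorL vp add0r.
    by apply/negP; rewrite -ltNge !mulr_gt0.
  have [l' [L' [p' [HL' ip' E]]]] := tiles_cover cov (proj2 LL _ hy).
  exists l', L', p'; split=> //; last by rewrite -E (Lo_d _ _ LL).
  split=> L'E; apply: niy; move: E; rewrite L'E.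
    by move/(can_inj (mulmxK LU)) => ->.
  by rewrite mulmxA opp_mxE => /(can_inj (mulmxK LU)) ->; exact: inP_rsym.
(* Passing to the opposite label exchanges the alternatives [p' = p] and [p' = rsym p]. *)
wlog pp' : l' L' p' HL' CL CL' ip' zE / p' = p.
  move=> W; have o' := proj2 HL' p' ip'; rewrite -zE in o'.
  have [[_ pp']|[_ pp']] := cov_wall cov lv vp hw (proj2 HL p ip) o'.
    exact: (W l' L' p').
  have oo : opp_mx t *m opp_mx t = 1%:M.
    by apply/row_matrixP => i; rewrite !rowE mulmxA !opp_mxE rsymK mulmx1.
  apply: (W (opp_copy l') (opp_mx t *m L') p) => //.
  - exact: (lift_opp cov HL').
  - by move=> E; apply: CL'; rewrite -E mulmxA oo mul1mx.
  - move=> E; apply: CL; have [U _] := mulmx1_unit oo; exact: (can_inj (mulKmx U)).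
  - by rewrite mulmxA opp_mxE -pp'.
subst p'.
have o' := proj2 HL' p ip; rewrite -zE in o'.
have [hz' _] := cov_dom cov o'.
have l'E : l' = letter_copy l.
  have [[[l'l|//] _]|[_ pr]] := cov_wall cov lv vp hw (proj2 HL p ip) o'.
    rewrite l'l in HL'; have [M GM L'E] := lift_fiber cov HL HL'.
    case: CL; rewrite L'E (cov_free cov (x := z) GM) ?mulmx1 //.
    by rewrite {2}zE L'E mulmxA.
  (* This alternative would give [p = rsym p], so [p] would also lie on the wall [rsym v], which
     differs from [v]. *)
  have : lor (rsym v) p < 0.
    apply: hw; first exact: wall_rsym.
    move=> rv; have hk k : (0 < k < 5)%N -> hcoord v k = 0.
      case/andP=> k0 k5; have := congr1 (fun x => hcoord x k) rv.
      by rewrite hcoord_rsym // gtn_eqF // => h; lra.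
    move: v0; rewrite lorE !(hk 1%N, hk 2, hk 3, hk 4) // !mul0r !addr0 oppr_gt0 -expr2.
    by rewrite ltNge sqr_ge0.
  by rewrite {1}pr lor_rsym vp ltxx.
subst l'.
have [r3 r30 h3] := group_radius cov hz.
have agree q : inH q -> lor v q = 0 -> d p q < Num.min r1 r3 -> q *m L = q *m L'.
  move=> hq vq; rewrite lt_min => /andP[q1 q3]; have iq := iP q hq q1 vq.
  have oq := cov_letter cov (proj2 HL q iq) lv vq.
  have [M GM E] := cov_fiber cov oq (proj2 HL' q iq).
  suff M1 : M = 1%:M by rewrite E M1 mulmx1.
  apply: (h3 M (q *m L) GM (proj2 LL _ hq)); first by rewrite (Lo_d _ _ LL).
  by rewrite -E zE (Lo_d _ _ (proj1 HL')).
have m0 : 0 < Num.min r1 r3 by rewrite lt_min r10.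
have agree' := ball_eq_hyperplane hp m0 vp agree.
have [||N1|N1] := @fix_hyperplane R v (L' *m invmx L) (lt0r_neq0 v0).
- exact: LoM (proj1 HL') (LoV LL).
- by move=> y vy; rewrite mulmxA -agree' // mulmxK.
- by case: CL; rewrite -[L'](mulmxKV LU) N1 mul1mx.
- by rewrite -N1 mulmxKV.
Qed.

End LiftClasses.

(** * Arithmetic of the quadratic forms *)

Definition dform (F : fieldType) n (s : seq F) : 'M[F]_n := diag_mx (\row_(i < n) s`_i).

Definition congruent (F : fieldType) n (s s' : seq F) : Prop :=
  exists Z : 'M[F]_n, Z *m dform n s *m Z^T = dform n s'.

Lemma congruent_trans (F : fieldType) n (s s' s'' : seq F) :
  congruent n s s' -> congruent n s' s'' -> congruent n s s''.
Proof.
move=> [Z ZE] [Z' Z'E]; exists (Z' *m Z).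
by rewrite trmx_mul -Z'E -ZE !mulmxA.
Qed.

Lemma dform_entry (F : fieldType) m n (s : seq F) (X Y : 'M[F]_(m, n)) i j :
  (X *m dform n s *m Y^T) i j = \sum_k X i k * s`_k * Y j k.
Proof. by rewrite /dform mul_mx_diag mxE; apply: eq_bigr => k _; rewrite !mxE. Qed.

Lemma congruentE (F : fieldType) n (s s' : seq F) (Z : 'M[F]_n) :
  (forall i j : 'I_n, \sum_k Z i k * s`_k * Z j k = s'`_i *+ (i == j)) ->
  congruent n s s'.
Proof.
by move=> h; exists Z; apply/matrixP => i j; rewrite dform_entry h !mxE.
Qed.

(* If q(u) = q(e) = a, then u - e or u + e is anisotropic, and the reflection in it
   maps u to e or -e. *)
Lemma witt_move (F : fieldType) n (a : F) (s : seq F) (u e : 'rV[F]_n) :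
  (2 : F) != 0 -> a != 0 ->
  u *m dform n s *m u^T = a%:M -> e *m dform n s *m e^T = a%:M ->
  exists2 S : 'M[F]_n, S *m dform n s *m S^T = dform n s &
    u *m S = e \/ u *m S = - e.
Proof.
move=> two a0; set Q := dform n s => uu ee.
pose b (x y : 'rV[F]_n) := \sum_k x 0 k * s`_k * y 0 k.
have entry (X : 'M[F]_n) i j : (X *m Q *m X^T) i j = b (row i X) (row j X).
  by rewrite dform_entry; apply: eq_bigr => k _; rewrite !mxE.
have sc (x y : 'rV[F]_n) : x *m Q *m y^T = (b x y)%:M.
  by apply/rowP => i; rewrite ord1 dform_entry mxE eqxx mulr1n.
have bC x y : b x y = b y x by apply: eq_bigr => k _; ring.
have bD x y z : b (x + y) z = b x z + b y z.
  by rewrite /b -big_split; apply: eq_bigr => k _; rewrite !mxE /=; ring.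
have bN x z : b (- x) z = - b x z.
  by rewrite /b -sumrN; apply: eq_bigr => k _; rewrite !mxE; ring.
have bZ r x z : b (r *: x) z = r * b x z.
  by rewrite /b big_distrr; apply: eq_bigr => k _; rewrite !mxE /=; ring.
have bDr x y z : b z (x + y) = b z x + b z y by rewrite bC bD !(bC z).
have bNr x z : b z (- x) = - b z x by rewrite bC bN (bC z).
have bZr r x z : b z (r *: x) = r * b z x by rewrite bC bZ (bC z).
have scal x r : x *m Q *m x^T = r%:M -> b x x = r.
  by rewrite sc => /matrixP/(_ 0 0); rewrite !mxE eqxx !mulr1n.
have buu := scal _ _ uu; have bee := scal _ _ ee.
have key f : b f f = a -> b (u - f) (u - f) != 0 ->
    exists2 S : 'M[F]_n, S *m Q *m S^T = Q & u *m S = f.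
  move=> bff; have [w wE] : exists w, w = u - f by exists (u - f).
  rewrite -wE => w0.
  have bww : b w w = 2 * (a - b u f).
    by rewrite wE !(bD, bN, bDr, bNr) buu bff (bC f u); ring.
  have buw : b u w = a - b u f by rewrite wE bDr bNr buu.
  have [S xS] : exists S : 'M[F]_n, forall x : 'rV[F]_n, x *m S = x - (2 / b w w * b x w) *: w.
    exists (1%:M - (2 / b w w) *: (Q *m w^T *m w)) => x.
    by rewrite mulmxBr mulmx1 -scalemxAr !mulmxA sc mul_scalar_mx scalerA.
  exists S.
    apply/matrixP => i j; have -> : Q i j = b (row i 1%:M) (row j 1%:M).
      by rewrite -entry trmx1 mulmx1 mul1mx.
    rewrite entry !rowE !mulmx1 !xS !(bD, bN, bDr, bNr, bZ, bZr) (bC w).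
    by field.
  have h : a - b u f != 0 by apply: contraNneq w0 => h; rewrite bww h mulr0.
  rewrite xS bww buw [X in X *: _](_ : _ = 1); last by field; rewrite h two.
  by rewrite scale1r wE opprB addrC subrK.
have [w0|w0] := eqVneq (b (u - e) (u - e)) 0; last first.
  by have [S h1 h2] := key e bee w0; exists S => //; left.
have bee' : b (- e) (- e) = a by rewrite bN bNr opprK.
have [|S h1 h2] := key (- e) bee'; last by exists S => //; right.
move: w0; rewrite !(bD, bN, bDr, bNr, opprK) buu bee (bC e u) => w0.
have -> : a + b u e + (b u e + a) = 2 * (2 * a) - (a - b u e - (b u e - a)) by ring.
by rewrite w0 subr0 !mulf_neq0.
Qed.

(** Once an isometry moves the first row to plus or minus the first basis vector, orthogonality
    kills the rest of the first column, and the remaining block is a congruence of the tails. *)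
Lemma witt_cancellation (F : fieldType) n (a : F) (s s' : seq F) :
  (2 : F) != 0 -> a != 0 -> congruent n.+1 (a :: s) (a :: s') -> congruent n s s'.
Proof.
move=> two a0 [Z ZE].
have uu : row 0 Z *m dform n.+1 (a :: s) *m (row 0 Z)^T = a%:M.
  apply/rowP => i; rewrite ord1 dform_entry mxE eqxx mulr1n.
  have := congr1 (fun M : 'M[F]_n.+1 => M 0 0) ZE; rewrite dform_entry !mxE eqxx mulr1n /=.
  by move=> h; rewrite -[RHS]h; apply: eq_bigr => k _; rewrite !mxE.
pose e : 'rV[F]_n.+1 := delta_mx 0 0.
have ee : e *m dform n.+1 (a :: s) *m e^T = a%:M.
  apply/rowP => i; rewrite ord1 dform_entry mxE eqxx mulr1n big_ord_recl /= !mxE !eqxx.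
  rewrite big1 ?addr0 ?mul1r ?mulr1 // => k _.
  by rewrite /e !mxE /= !mul0r.
have [S SS uS] := witt_move two a0 uu ee.
have [Y YE rowY] : exists2 Y : 'M[F]_n.+1,
    Y *m dform n.+1 (a :: s) *m Y^T = dform n.+1 (a :: s') & row 0 Y = row 0 Z *m S.
  by exists (Z *m S); [rewrite trmx_mul -ZE -[in RHS]SS !mulmxA|rewrite row_mul].
have [r r0 Y0] : exists2 r : F, r != 0 & forall j, Y 0 j = r * (j == 0)%:R.
  case: uS => uS; [exists 1|exists (-1)]; rewrite ?oppr_eq0 ?oner_eq0 // => j.
    have := congr1 (fun M : 'rV[F]_n.+1 => M 0 j) uS; rewrite -rowY !mxE eqxx /= => ->.
    by rewrite mul1r.
  have := congr1 (fun M : 'rV[F]_n.+1 => M 0 j) uS; rewrite -rowY !mxE eqxx /= => ->.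
  by rewrite mulN1r.
have Yi i : Y (lift ord0 i) 0 = 0.
  have := congr1 (fun M : 'M[F]_n.+1 => M (lift ord0 i) 0) YE.
  rewrite dform_entry !mxE /= mulr0n big_ord_recl /= big1 => [|k _]; last by rewrite Y0 /= !mulr0.
  by rewrite Y0 eqxx mulr1 addr0 => /eqP; rewrite !mulf_eq0 (negPf a0) (negPf r0) !orbF => /eqP.
apply: (@congruentE _ _ _ _ (\matrix_(i, j) Y (lift ord0 i) (lift ord0 j))) => i j.
have := congr1 (fun M : 'M[F]_n.+1 => M (lift ord0 i) (lift ord0 j)) YE.
rewrite dform_entry !mxE big_ord_recl /= Yi !mul0r add0r.
rewrite (inj_eq (@lift_inj _ ord0)) => <-.
by apply: eq_bigr => k _; rewrite !mxE.
Qed.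

(** Infinite descent: -2 is not a square modulo 5, so 5 divides [a] and [b], and then also [c]. *)
Lemma no_nat_solution a b c : (2 * a ^ 2 + b ^ 2 = 15 * c ^ 2)%N -> c = 0%N.
Proof.
elim: c {-2}c (leqnn c) a b => [c|n IH c cn a b e]; first by rewrite leqn0 => /eqP.
have [//|c0] := posnP c.
have mod5 : (a %% 5 = 0 /\ b %% 5 = 0)%N.
  have : ((2 * a ^ 2 + b ^ 2) %% 5 = 0)%N by rewrite e; lia.
  rewrite -modnDm -modnMmr -(modnXm 2 5 a) -(modnXm 2 5 b).
  have := ltn_pmod a (isT : (0 < 5)%N); have := ltn_pmod b (isT : (0 < 5)%N).
  by case: (a %% 5)%N => [|[|[|[|[|]]]]] //; case: (b %% 5)%N => [|[|[|[|[|]]]]].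
have [a' aE] : exists a', a = (5 * a')%N by exists (a %/ 5)%N; lia.
have [b' bE] : exists b', b = (5 * b')%N by exists (b %/ 5)%N; lia.
have c5 : (c %% 5 = 0)%N.
  have : ((3 * c ^ 2) %% 5 = 0)%N by rewrite aE bE in e; lia.
  rewrite -modnMmr -(modnXm 2 5 c); have := ltn_pmod c (isT : (0 < 5)%N).
  by case: (c %% 5)%N => [|[|[|[|[|]]]]].
have [c' cE] : exists c', c = (5 * c')%N by exists (c %/ 5)%N; lia.
have : c' = 0%N; last by lia.
apply: (IH c' _ a' b'); first by lia.
by rewrite aE bE cE in e; lia.
Qed.

Lemma no_rat_solution (x y : rat) : 2 * x ^+ 2 + y ^+ 2 <> 15.
Proof.
move=> e; pose a := `|(numq x * denq y)%R|%N; pose b := `|(numq y * denq x)%R|%N.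
pose c := `|(denq x * denq y)%R|%N.
have : c = 0%N; last by apply/eqP; rewrite absz_eq0 mulf_neq0 ?denq_neq0.
have dx : (denq x)%:~R != 0 :> rat by rewrite intr_eq0 denq_neq0.
have dy : (denq y)%:~R != 0 :> rat by rewrite intr_eq0 denq_neq0.
have ex : x * (denq x)%:~R = (numq x)%:~R by rewrite -{1}(divq_num_den x) divfK.
have ey : y * (denq y)%:~R = (numq y)%:~R by rewrite -{1}(divq_num_den y) divfK.
have : 2 * (numq x * denq y) ^+ 2 + (numq y * denq x) ^+ 2 = 15 * (denq x * denq y) ^+ 2.
  apply/eqP; rewrite -(eqr_int rat) !(rmorphD, rmorphM, rmorphXn) /= -ex -ey.
  apply/eqP; transitivity ((2 * x ^+ 2 + y ^+ 2) * ((denq x)%:~R * (denq y)%:~R) ^+ 2).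
    by ring.
  by rewrite e; ring.
have := sqr_ge0 (numq x * denq y); have := sqr_ge0 (numq y * denq x).
have := sqr_ge0 (denq x * denq y).
move=> h1 h2 h3 h4; apply: (@no_nat_solution a b); rewrite /a /b /c -!abszX.
move: h1 h2 h3 h4; move: (_ ^+ 2) (_ ^+ 2) (_ ^+ 2) => u v w; lia.
Qed.

Local Ltac entries := move=> [[|[|[|[|[|//]]]]] ?] [[|[|[|[|[|//]]]]] ?];
  rewrite !big_ord_recl big_ord0 !mxE /=; by field.

Definition mx_of_rows (F : fieldType) n (r : seq (seq F)) : 'M[F]_n :=
  \matrix_(i < n, j < n) (nth [::] r i)`_j.

Lemma not_similar (N : 'M[rat]_5) (m : rat) : m != 0 ->
  N *m dform 5 [:: -2; 1; 1; 1; 1] *m N^T <> m *: dform 5 [:: -2; 1; 1; 1; 3 / 5].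
Proof.
move=> m0 NE.
(* Chosen so that the determinant identity [\det N ^+ 2 * 5 = 3 * m ^+ 5] reads [m = 15 * s ^+ 2];
   the odd dimension leaves an odd power of [m]. *)
pose s := \det N / (3 * m ^+ 2).
have detE : \det N ^+ 2 * 5 = 3 * m ^+ 5.
  have := congr1 (fun M => \det M) NE; rewrite !det_mulmx det_tr detZ /dform !det_diag.
  rewrite !big_ord_recl !big_ord0 !mxE /=; lra.
have mE : m = 15 * s ^+ 2.
  rewrite /s expr_div_n; apply: (mulIf (_ : 3 * m ^+ 4 != 0)); first by rewrite mulf_neq0 // expf_neq0.
  transitivity (\det N ^+ 2 * 5); first by rewrite detE; ring.
  by field.
have s0 : s != 0 by apply: contraNneq m0 => s0; rewrite mE s0 expr0n mulr0.
have c1 : congruent 5 [:: -2 : rat; 1; 1; 1; 1] [:: -30; 15; 15; 15; 9].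
  exists (s^-1 *: N); rewrite linearZ /= -!scalemxAl -scalemxAr NE !scalerA mE.
  apply/matrixP => i j; rewrite /dform !mxE.
  have [->|_] := eqVneq i j; last by rewrite !mulr0n mulr0.
  rewrite !mulr1n; case: j => [[|[|[|[|[|//]]]]] ?] /=; by field.
(* Half the sum and half the difference of an orthogonal basis of [<2, 2>] give [<1, 1>]; this
   exposes the common part [<1, -2, 2>]. *)
have c0 : congruent 5 [:: 1 : rat; -2; 2; 2; 1] [:: -2; 1; 1; 1; 1].
  apply: (@congruentE _ _ _ _ (mx_of_rows 5 [:: [:: 0; 1; 0; 0; 0]; [:: 0; 0; 1/2; 1/2; 0];
    [:: 0; 0; 1/2; -(1/2); 0]; [:: 1; 0; 0; 0; 0]; [:: 0; 0; 0; 0; 1]])).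
  entries.
(* [<9>] is [<1>], and [<-30, 15, 15>] splits as [<-2, 2, 30>]: the vector [e2 - e3] has norm 30,
   and its complement [<-30, 30>] is a hyperbolic plane, hence also [<-2, 2>]. *)
have c2 : congruent 5 [:: -30 : rat; 15; 15; 15; 9] [:: 1; -2; 2; 30; 15].
  apply: (@congruentE _ _ _ _ (mx_of_rows 5 [:: [:: 0; 0; 0; 0; 1/3];
    [:: 8/15; -(7/15); -(7/15); 0; 0]; [:: -(7/15); 8/15; 8/15; 0; 0];
    [:: 0; 1; -1; 0; 0]; [:: 0; 0; 0; 1; 0]])).
  entries.
have two : (2 : rat) != 0 by [].
have := congruent_trans (congruent_trans c0 c1) c2.
move=> /(witt_cancellation two (oner_neq0 _)) /(witt_cancellation two (_ : -2 != 0)).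
move=> /(_ isT) /(witt_cancellation two two)[Z ZE].
have := congr1 (fun M : 'M[rat]_2 => M (lift ord0 ord0) (lift ord0 ord0)) ZE.
rewrite dform_entry !big_ord_recl big_ord0 !mxE /= => h.
apply: (@no_rat_solution (Z (lift ord0 ord0) ord0) (Z (lift ord0 ord0) (lift ord0 ord0))).
by rewrite !expr2; lra.
Qed.

(** * Boosts along the coordinate axes *)

Section Boosts.
Variable R : realType.
Implicit Types (y z : 'rV[R]_5) (X T : 'M[R]_5) (a b s : R) (k j n : nat).

Local Notation sq2 := (Num.sqrt (2 : R)).

Definition bvec k : 'rV[R]_5 := delta_mx 0 (inord k).

(** At [t = 1] all eight letter vectors have this form, one opposite pair for each space axis. *)
Definition letter_dir k s : 'rV[R]_5 := bvec 0 + (s * sq2) *: bvec k.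

Definition boost_mx k : 'M[R]_5 := refl (letter_dir k (-1)) *m refl (letter_dir k 1).

Lemma hcoord_bvec j k : (j < 5)%N -> (k < 5)%N -> hcoord (bvec j) k = (k == j)%:R.
Proof. exact: hcoord_delta. Qed.

Lemma lor_bvec0 y : lor y (bvec 0) = - hcoord y 0.
Proof. by rewrite lor_delta // mulN1r. Qed.

Lemma lor_bvec y k : (0 < k < 5)%N -> lor y (bvec k) = hcoord y k.
Proof. by case/andP=> k0 k5; rewrite lor_delta // gtn_eqF // mul1r. Qed.

(* T acts on the plane spanned by e_0, e_k as the matrix [[a, b], [b, a]], and trivially
   on the other basis vectors. *)
Definition boost k a b T : Prop := forall y, y *m T =
  y + ((a - 1) * hcoord y 0 + b * hcoord y k) *: bvec 0
    + (b * hcoord y 0 + (a - 1) * hcoord y k) *: bvec k.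

Lemma boost_hcoord k a b T : (0 < k < 5)%N -> boost k a b T -> forall y,
  [/\ hcoord (y *m T) 0 = a * hcoord y 0 + b * hcoord y k,
      hcoord (y *m T) k = b * hcoord y 0 + a * hcoord y k &
      forall j, (0 < j < 5)%N -> j != k -> hcoord (y *m T) j = hcoord y j].
Proof.
move=> /andP[k0 k5] hT y.
have nk : (k == 0%N) = false by rewrite gtn_eqF.
have nk' : (0%N == k) = false by rewrite eq_sym.
rewrite hT; split=> [||j /andP[j0 j5] jk]; rewrite !hcoordE !hcoord_bvec //.
- by rewrite nk' eqxx /=; ring.
- by rewrite nk eqxx /=; ring.
- by rewrite (gtn_eqF j0) (negPf jk) /=; ring.
Qed.

Lemma boostM k a b T a' b' T' : (0 < k < 5)%N -> boost k a b T -> boost k a' b' T' ->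
  boost k (a * a' + b * b') (a * b' + b * a') (T *m T').
Proof.
move=> hk hT hT' y; have [h0 h1 _] := boost_hcoord hk hT y.
rewrite mulmxA hT' h0 h1 hT; apply/row5P => j j5; rewrite !hcoordE; ring.
Qed.

(** The two unit normals have product -3, so the walls are at a distance with hyperbolic cosine 3.
    The boost translates by twice that distance: its cosine is [2 * 3 ^+ 2 - 1 = 17], and its sine
    is the root of 288. *)
Lemma boost_mxP k : (0 < k < 5)%N -> boost k 17 (12 * sq2) (boost_mx k).
Proof.
move=> hk y; have [k0 k5] := andP hk; have S2 := sq2K R.
have nk : (k == 0%N) = false by rewrite gtn_eqF.
have nk' : (0%N == k) = false by rewrite eq_sym.
have vE s z : lor z (letter_dir k s) = - hcoord z 0 + s * sq2 * hcoord z k.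
  by rewrite /letter_dir lorDr lorZr lor_bvec0 lor_bvec.
have h0 s : hcoord (letter_dir k s) 0 = 1.
  by rewrite /letter_dir hcoordD hcoordZ !hcoord_bvec // nk' /=; ring.
have h1 s : hcoord (letter_dir k s) k = s * sq2.
  by rewrite /letter_dir hcoordD hcoordZ !hcoord_bvec // nk eqxx /=; ring.
have vv s : s ^+ 2 = 1 -> lor (letter_dir k s) (letter_dir k s) = 1.
  move=> s2; rewrite vE h0 h1; transitivity (-1 + s ^+ 2 * sq2 ^+ 2); first by ring.
  by rewrite s2 S2; ring.
have v'v : lor (letter_dir k (-1)) (letter_dir k 1) = -3.
  by rewrite vE h0 h1; transitivity (-1 - sq2 ^+ 2); [ring|rewrite S2; ring].
rewrite /boost_mx mulmxA !reflE !vv ?expr1n ?sqrrN ?expr1n //.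
rewrite lorDl lorNl lorZl v'v !vE /letter_dir; apply/row5P => j j5; rewrite !hcoordE.
set u := hcoord (bvec 0) j; set v := hcoord (bvec k) j.
set y0 := hcoord y 0; set yk := hcoord y k; set yj := hcoord y j.
move: S2; move: (sq2) => r; rewrite expr2 => rr.
have E : r * r * (v * yk) = 2 * (v * yk) by rewrite rr.
rewrite !divr1; lra.
Qed.

Lemma boost_exp k n : (0 < k < 5)%N -> (0 < n)%N ->
  exists a b, [/\ 1 < a, 0 < b, a ^+ 2 - b ^+ 2 = 1 & boost k a b (boost_mx k ^+ n)].
Proof.
move=> hk; case: n => // n _; have S2 := sq2K R; have S0 := sq2_gt0 R.
have b0 : 17 ^+ 2 - (12 * sq2) ^+ 2 = 1 by rewrite exprMn S2; ring.
elim: n => [|n [a [b [a1 bp ab hb]]]].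
  exists 17, (12 * sq2); rewrite expr1; split=> [|||]; [lra|exact: mulr_gt0|exact: b0|].
  exact: boost_mxP.
exists (17 * a + 12 * sq2 * b), (17 * b + 12 * sq2 * a); split.
- have : 0 < 12 * sq2 * b by rewrite !mulr_gt0.
  by lra.
- by rewrite addr_gt0 // !mulr_gt0 //; lra.
- transitivity ((17 ^+ 2 - (12 * sq2) ^+ 2) * (a ^+ 2 - b ^+ 2)); first by ring.
  by rewrite b0 ab mulr1.
- by rewrite exprS; exact: boostM (boost_mxP hk) hb.
Qed.

(** For [j != k], [T k] fixes [bvec j], hence also its image under [X], and the vectors fixed by
    [T k] have no component along [e_0] and [e_k]. So each space axis is an eigenline; the boosts
    then tie all eigenvalues to that of [e_0]. *)
Lemma commute_scalar (T : nat -> 'M[R]_5) X :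
  (forall k, (0 < k < 5)%N -> exists a b, [/\ 1 < a, 0 < b, a ^+ 2 - b ^+ 2 = 1 & boost k a b (T k)]) ->
  (forall k, (0 < k < 5)%N -> X *m T k = T k *m X) -> exists r, X = r%:M.
Proof.
move=> hT comm.
have other j : (0 < j < 5)%N -> exists2 k, (0 < k < 5)%N & j != k.
  by move=> hj; have [->|ne] := eqVneq j 1%N; [exists 2|exists 1%N].
have fixed j k : (0 < j < 5)%N -> (0 < k < 5)%N -> j != k ->
    hcoord (bvec j *m X) 0 = 0 /\ hcoord (bvec j *m X) k = 0.
  move=> hj hk jk; have [a [b [a1 bp ab hb]]] := hT k hk.
  have [j0 j5] := andP hj; have [k0 k5] := andP hk.
  have ejT : bvec j *m T k = bvec j.
    rewrite hb !hcoord_bvec // [0%N == j]eq_sym gtn_eqF // eq_sym (negPf jk).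
    by rewrite !mulr0 addr0 !scale0r !addr0.
  have : bvec j *m X *m T k = bvec j *m X by rewrite -mulmxA comm // mulmxA ejT.
  move=> E; have [] := boost_hcoord hk hb (bvec j *m X); rewrite E.
  set z0 := hcoord _ 0; set zk := hcoord _ k => e1 e2 _.
  have f1 : (a - 1) * z0 = - (b * zk) by lra.
  have f2 : (a - 1) * zk = - (b * z0) by lra.
  (* The determinant of [T k - 1] on the boosted plane, equal to [2 - 2 * a]. *)
  have nz : (a - 1) ^+ 2 - b ^+ 2 != 0.
    have -> : (a - 1) ^+ 2 - b ^+ 2 = (a ^+ 2 - b ^+ 2) + 1 - 2 * a by ring.
    by rewrite ab lt_eqF //; lra.
  split; apply: (mulfI nz); rewrite mulr0.
    transitivity ((a - 1) * ((a - 1) * z0) - b * (b * z0)); first by ring.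
    by rewrite f1 -[b * z0]opprK -f2; ring.
  transitivity ((a - 1) * ((a - 1) * zk) - b * (b * zk)); first by ring.
  by rewrite f2 -[b * zk]opprK -f1; ring.
have row_j j : (0 < j < 5)%N -> exists x, bvec j *m X = x *: bvec j.
  move=> hj; have [j0 j5] := andP hj; exists (hcoord (bvec j *m X) j).
  apply/row5P => i i5; rewrite hcoordZ hcoord_bvec //.
  have [->|ij] := eqVneq i j; first by rewrite mulr1.
  rewrite mulr0; have [i0|i0] := posnP i.
    by have [k hk jk] := other j hj; rewrite i0; case: (fixed j k hj hk jk).
  by case: (fixed j i hj _ _) => //; rewrite ?i0 // eq_sym.
pose z := bvec 0 *m X.
have zT k a b : (0 < k < 5)%N -> boost k a b (T k) -> z *m T k = a *: z + b *: (bvec k *m X).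
  move=> hk hb; have [k0 k5] := andP hk.
  rewrite /z -mulmxA comm // mulmxA hb !hcoord_bvec // eqxx (gtn_eqF k0) !mulr0 !addr0 !mulr1.
  by rewrite -{1}[bvec 0]scale1r -scalerDl [1 + _]addrC subrK mulmxDl -!scalemxAl.
have zi i : (0 < i < 5)%N -> hcoord z i = 0.
  move=> hi; have [k hk ik] := other i hi; have [a [b [a1 bp ab hb]]] := hT k hk.
  have [x xk] := row_j k hk; have [i0 i5] := andP hi; have [k0 k5] := andP hk.
  have [_ _ /(_ i hi ik)] := boost_hcoord hk hb z.
  rewrite (zT k a b) // xk hcoordD !hcoordZ hcoord_bvec // (negPf ik) !mulr0 addr0.
  move=> e; have : (a - 1) * hcoord z i = 0 by lra.
  by move/eqP; rewrite mulf_eq0 subr_eq0 gt_eqF // => /eqP.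
have z0 : z = hcoord z 0 *: bvec 0.
  apply/row5P => -[|i] i5; rewrite hcoordZ hcoord_bvec // ?mulr1 // mulr0.
  exact: zi.
exists (hcoord z 0); apply/row_matrixP => i; rewrite !rowE mul_mx_scalar.
rewrite -[i]inord_val -/(bvec i); case: i => [[|i] i5] /=; first by rewrite -z0.
have hi : (0 < i.+1 < 5)%N by [].
have [x xi] := row_j _ hi; have [a [b [a1 bp ab hb]]] := hT _ hi.
have [_ h _] := boost_hcoord hi hb z.
(* The boosted coordinate of the image of [z], computed in two ways, equates [b] times the
   eigenvalue of [e_0] with [b * x]. *)
rewrite xi; congr (_ *: _); move: h.
rewrite (zT _ a b) // xi hcoordD !hcoordZ hcoord_bvec // eqxx zi // !mulr0 add0r addr0 mulr1.
by move/(mulfI (lt0r_neq0 bp)).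
Qed.

End Boosts.

(** * Non-commensurability *)

Section LetterDirections.
Variable R : realType.
Local Notation sq2 := (Num.sqrt (2 : R)).

Lemma letter_wall_dirP (w : 'rV[R]_5) : letter_wall 1 w <->
  exists k s, [/\ (0 < k < 5)%N, sign s & w = letter_dir k s].
Proof.
have E k (s : R) : (0 < k < 5)%N -> letter_dir k s =
    vec5 1 (s * sq2 * (1%N == k)%:R) (s * sq2 * (2 == k)%:R) (s * sq2 * (3 == k)%:R)
      (s * sq2 * (4 == k)%:R).
  case/andP=> k0 k5; apply/row5P => j j5.
  rewrite /letter_dir hcoordD hcoordZ !hcoord_bvec // hcoord_vec5 //.
  case: j j5 => [|[|[|[|[|]]]]] // _; rewrite /= ?add0r //.
  by rewrite eq_sym (gtn_eqF k0) mulr0 addr0.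
split=> [[s ss []->]|[k [s [hk ss ->]]]].
- by exists 1%N, s; split=> //; rewrite E //= mulr1 !mulr0.
- by exists 2, s; split=> //; rewrite E //= mulr1 !mulr0.
- by exists 3, s; split=> //; rewrite E //= mulr1 !mulr0.
- by exists 4, s; split=> //; rewrite E //= !mulr1 !mulr0.
exists s => //; rewrite E //; case: k hk => [|[|[|[|[|]]]]] //= _.
all: rewrite !mulr0 ?mulr1; by [constructor 1|constructor 2|constructor 3|constructor 4].
Qed.

(** The witness is the foot of the perpendicular from the centre to the wall. Positive and negative
    walls give at most [-2 + 1] there, the other letter walls at most minus the root of 2. *)
Lemma letter_wall_point k (s : R) : (0 < k < 5)%N -> sign s -> exists p,
  [/\ inH p, lor (letter_dir k s) p = 0 &
      forall w, wall 1 w -> w <> letter_dir k s -> lor w p < 0].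
Proof.
move=> hk ss; have [k0 k5] := andP hk; have S2 := sq2K R; have S0 := sq2_gt0 R.
have s2 := sqr_sign ss.
have nk : (k == 0%N) = false by rewrite gtn_eqF.
have nk' : (0%N == k) = false by rewrite eq_sym.
pose p : 'rV[R]_5 := sq2 *: bvec R 0 + s *: bvec R k.
have lp w : lor w p = - (sq2 * hcoord w 0) + s * hcoord w k.
  by rewrite /p lorDr !lorZr lor_bvec0 lor_bvec //; ring.
have sgn1 a b : sign a -> sign b -> a * b <= 1 :> R.
  by case=> -> [] ->; rewrite ?mulr1 ?mul1r ?mulrNN ?mulr1 //; lra.
exists p; split.
- have p0 : hcoord p 0 = sq2 by rewrite /p hcoordD !hcoordZ !hcoord_bvec // nk' /=; ring.
  have pk : hcoord p k = s by rewrite /p hcoordD !hcoordZ !hcoord_bvec // nk eqxx /=; ring.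
  rewrite /inH lp p0 pk S0 andbT -!expr2 S2 s2; apply/eqP; ring.
- rewrite lp /letter_dir !hcoordD !hcoordZ !hcoord_bvec // nk nk' !eqxx /=.
  by transitivity (- sq2 + s ^+ 2 * sq2); [ring|rewrite s2; ring].
move=> w [[a [b [c [sa sb sc ->]]]]|[a [b [c [sa sb sc ->]]]]|/letter_wall_dirP[j [r [hj sr ->]]]] ne;
  rewrite lp.
- have h : hcoord (vec5 sq2 a b c (a * b * c / 1)) k \in [:: a; b; c; a * b * c].
    by case: k k0 k5 {hk nk nk' p lp ne} => [|[|[|[|[|]]]]] // _ _;
      rewrite hcoord_vec5 //= ?divr1 !inE eqxx ?orbT.
  have : s * hcoord (vec5 sq2 a b c (a * b * c / 1)) k <= 1.
    apply: sgn1 => //; move: h; rewrite !inE => /or4P[]/eqP-> //.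
    by apply: signM => //; exact: signM.
  by rewrite [hcoord _ 0]hcoord_vec5 //=; lra.
- have h : hcoord (vec5 sq2 a b c (- (a * b * c * 1))) k \in [:: a; b; c; - (a * b * c)].
    by case: k k0 k5 {hk nk nk' p lp ne} => [|[|[|[|[|]]]]] // _ _;
      rewrite hcoord_vec5 //= ?mulr1 !inE eqxx ?orbT.
  have : s * hcoord (vec5 sq2 a b c (- (a * b * c * 1))) k <= 1.
    apply: sgn1 => //; move: h; rewrite !inE => /or4P[]/eqP-> //.
    by apply: signN; apply: signM => //; exact: signM.
  by rewrite [hcoord _ 0]hcoord_vec5 //=; lra.
have [j0 j5] := andP hj.
rewrite /letter_dir !hcoordD !hcoordZ !hcoord_bvec // nk [0%N == j]eq_sym (gtn_eqF j0) /=.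
have [jk|jk] := eqVneq k j; last by rewrite /=; lra.
have rs : r = - s.
  case: sr ss ne => -> [] ->; rewrite ?opprK // => -[]; by rewrite jk.
have : s * s = 1 by rewrite -expr2.
rewrite rs /= => ssq; have : s * (s * sq2) = sq2 by rewrite mulrA ssq mul1r.
by lra.
Qed.

End LetterDirections.

(** * From a real intertwiner of boosts to a rational similarity of forms *)

Section RationalIntertwiner.
Variable R : realType.

Lemma rational_solution m n (C : 'M[rat]_(m, n)) (y : 'rV[R]_m) :
  y != 0 -> y *m map_mx ratr C = 0 -> exists2 v : 'rV[rat]_m, v != 0 & v *m C = 0.
Proof.
move=> y0 yC; have : kermx C != 0.
  rewrite kermx_eq0 -(row_free_map (ratr : {rmorphism rat -> R})) -kermx_eq0.
  by apply: contraNneq y0 => k0; have /sub_kermxP : y *m map_mx ratr C = 0 := yC;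
    rewrite k0 submx0.
by case/rowV0Pn => v /sub_kermxP vC v0; exists v.
Qed.

(** Intertwining is a linear system with rational coefficients, and rank does not change under field
    extension. The four systems are stacked so that one solution serves all of them. *)
Lemma rational_intertwiner n (A B : nat -> 'M[rat]_n) (Y : 'M[R]_n) : Y != 0 ->
  (forall k, (0 < k < 5)%N -> Y *m map_mx ratr (A k) = map_mx ratr (B k) *m Y) ->
  exists2 N : 'M[rat]_n, N != 0 & forall k, (0 < k < 5)%N -> N *m A k = B k *m N.
Proof.
move=> Y0 hY.
pose C k := lin_mx (mulmxr (A k)) - lin_mx (mulmx (B k)) : 'M[rat]_(n * n, n * n).
have CE k (N : 'M[rat]_n) : mxvec N *m C k = mxvec (N *m A k - B k *m N).
  by rewrite mulmxBr !mul_vec_lin linearB.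
have YC k : (0 < k < 5)%N -> mxvec Y *m map_mx ratr (C k) = 0.
  move=> hk; have mr (M : 'M[rat]_n) : map_mx ratr (mulmxr (A k) M) =
      mulmxr (map_mx ratr (A k)) (map_mx ratr M) :> 'M[R]_n by rewrite /= map_mxM.
  have ml (M : 'M[rat]_n) : map_mx ratr (mulmx (B k) M) =
      mulmx (map_mx ratr (B k)) (map_mx ratr M) :> 'M[R]_n by rewrite map_mxM.
  by rewrite map_mxB (map_lin_mx mr) (map_lin_mx ml) mulmxBr !mul_vec_lin /= hY // subrr.
have [||v v0 vC] := @rational_solution _ _ (row_mx (row_mx (C 1%N) (C 2)) (row_mx (C 3) (C 4))) (mxvec Y).
- by rewrite mxvec_eq0.
- by rewrite !map_row_mx !mul_mx_row !YC // !row_mx0.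
exists (vec_mx v); first by rewrite vec_mx_eq0.
move: vC; rewrite !mul_mx_row -(row_mx0 _ _ _ (n * n + n * n)) => /eq_row_mx[].
rewrite -!(row_mx0 _ _ _ (n * n)) => /eq_row_mx[h1 h2] /eq_row_mx[h3 h4].
have C0 k : v *m C k = 0 -> vec_mx v *m A k = B k *m vec_mx v.
  rewrite -{1}[v]vec_mxK CE => /eqP; rewrite mxvec_eq0 subr_eq0 => /eqP. by [].
by case=> [|[|[|[|[|k]]]]] // _; apply: C0.
Qed.

End RationalIntertwiner.

Section RationalMatrices.
Variables (R : realType) (t : R).
Hypothesis t0 : 0 < t.

Definition dmat : 'M[R]_5 := diag_mx (\row_(i < 5) dcoef t i).
Definition dmatV : 'M[R]_5 := diag_mx (\row_(i < 5) (dcoef t i)^-1).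

Lemma dmatK : dmat *m dmatV = 1%:M.
Proof.
apply/matrixP => i j; rewrite /dmat /dmatV mul_diag_mx !mxE.
have [->|_] := eqVneq i j; last by rewrite mulr0n mulr0.
by rewrite !mulr1n divff // gt_eqF // dcoef_gt0.
Qed.

Lemma dmatVK : dmatV *m dmat = 1%:M.
Proof. exact: mulmx1C dmatK. Qed.

Lemma WQ_ratr M : WQ t M -> exists N : 'M[rat]_5, map_mx ratr N = dmat *m M *m dmatV.
Proof.
move=> WM; have /(_ _ _)/cid h := fun i j => WQ_entry t0 i j WM.
exists (\matrix_(i, j) sval (h i j)); apply/matrixP => i j.
rewrite /dmat /dmatV mul_mx_diag mul_diag_mx !mxE.
by case: (h i j) => q /= <-.
Qed.

Lemma dmat_form (q : rat) : t ^+ 2 = ratr q ->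
  dmat *m Jm R *m dmat = map_mx ratr (dform 5 [:: -2; 1; 1; 1; q]).
Proof.
move=> tq; apply/matrixP => i j; rewrite /dmat /Jm /dform mulmx_diag mul_mx_diag !mxE.
have [->|_] := eqVneq i j; last by rewrite !mulr0n mul0r rmorph0.
rewrite !mulr1n; have S2 := sq2K R.
case: j => [[|[|[|[|[|//]]]]] ?]; rewrite /dcoef /= ?rmorphN ?rmorph_nat ?rmorph1 -?tq.
all: rewrite ?mulr1 ?mulrN1 ?mulNr -?expr2 ?S2 //.
Qed.

End RationalMatrices.

Lemma WQ_exp (R : realType) (t : R) M n : WQ t M -> WQ t (M ^+ n).
Proof. by move=> h; elim: n => [|n IH]; [exact: WQ1|rewrite exprS; exact: WQM]. Qed.

(** [X] itself need not be rational. A rational intertwiner [N] of the same boosts differs from [Y],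
    which is [X] in the rescaled bases, by an element of the commutant, hence by a scalar; thus [N]
    is a rational similarity of the two forms. *)
Lemma not_commensurable_forms (R : realType) (t : R) (X : 'M[R]_5) (n : nat -> nat) :
  0 < t -> t ^+ 2 = 3 / 5 -> Lo X ->
  (forall k, (0 < k < 5)%N -> (0 < n k)%N /\ WQ t (X *m boost_mx R k ^+ n k *m invmx X)) ->
  False.
Proof.
move=> t0 t2 LX h; have XU := Lo_unit LX.
have one0 : 0 < (1 : R) by exact: ltr01.
have one2 : 1 / 2 < (1 : R) ^+ 2 by rewrite expr1n; lra.
have oner : ratl ((1 : R) ^+ 2) by rewrite expr1n; exact: ratl1.
have WT k : (0 < k < 5)%N -> WQ 1 (boost_mx R k ^+ n k).
  move=> hk; apply: WQ_exp; apply: WQM; apply: wall_WQ => //; constructor 3;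
    apply/letter_wall_dirP; do 2!eexists; (split; last by reflexivity) => //; by [left|right].
pose T k := boost_mx R k ^+ n k.
have /choice[A hA] : forall k, exists N : 'M[rat]_5, (0 < k < 5)%N ->
    map_mx ratr N = dmat 1 *m T k *m dmatV 1.
  move=> k; case: (boolP (0 < k < 5)%N) => hk; last by exists 0.
  by have [N hN] := WQ_ratr one0 (WT k hk); exists N.
have /choice[B hB] : forall k, exists N : 'M[rat]_5, (0 < k < 5)%N ->
    map_mx ratr N = dmat t *m (X *m T k *m invmx X) *m dmatV t.
  move=> k; case: (boolP (0 < k < 5)%N) => hk; last by exists 0.
  by have [N hN] := WQ_ratr t0 (proj2 (h k hk)); exists N.
have [Y YE] : exists Y, Y = dmat t *m X *m dmatV 1 by exists (dmat t *m X *m dmatV 1).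
have Y0 : Y \in unitmx.
  rewrite YE !unitmx_mul XU; have [-> _] := mulmx1_unit (dmatK t0).
  by have [_ ->] := mulmx1_unit (dmatK one0).
have YAB k : (0 < k < 5)%N -> Y *m map_mx ratr (A k) = map_mx ratr (B k) *m Y.
  move=> hk; rewrite hA // hB // YE.
  transitivity (dmat t *m X *m (dmatV 1 *m dmat 1) *m T k *m dmatV 1).
    by rewrite !mulmxA.
  transitivity (dmat t *m X *m T k *m (invmx X *m (dmatV t *m dmat t) *m X) *m dmatV 1).
    by rewrite !dmatVK // !mulmx1 mulVmx // mulmx1.
  by rewrite !mulmxA.
have [|N N0 NAB] := rational_intertwiner _ YAB.
  apply/eqP => y0; move: (mulmxV Y0); rewrite y0 mul0mx => /matrixP/(_ 0 0)/eqP.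
  by rewrite !mxE eq_sym oner_eq0.
pose N' : 'M[R]_5 := map_mx ratr N.
have NAB' k : (0 < k < 5)%N -> N' *m map_mx ratr (A k) = map_mx ratr (B k) *m N'.
  by move=> hk; rewrite -!map_mxM NAB.
(* [invmx Y *m N'] commutes with the rational matrices of the boosts; undoing the rescaling makes it
   commute with the boosts themselves. *)
pose Z := dmatV 1 *m (invmx Y *m N') *m dmat 1.
have ZT k : (0 < k < 5)%N -> Z *m T k = T k *m Z.
  move=> hk; have TE : T k = dmatV 1 *m map_mx ratr (A k) *m dmat 1.
    rewrite hA // !mulmxA dmatVK // mul1mx -mulmxA dmatVK // mulmx1 //.
  have AY : invmx Y *m map_mx ratr (B k) = map_mx ratr (A k) *m invmx Y.
    apply: (can_inj (mulmxK Y0)); rewrite mulmxKV // -mulmxA -YAB // mulKmx //.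
  rewrite TE /Z.
  transitivity (dmatV 1 *m (invmx Y *m (N' *m map_mx ratr (A k))) *m dmat 1).
    transitivity (dmatV 1 *m (invmx Y *m N') *m (dmat 1 *m dmatV 1) *m map_mx ratr (A k) *m dmat 1).
      by rewrite !mulmxA.
    by rewrite dmatK // mulmx1 !mulmxA.
  rewrite NAB' // (mulmxA (invmx Y)) AY.
  transitivity (dmatV 1 *m map_mx ratr (A k) *m (dmat 1 *m dmatV 1) *m (invmx Y *m N') *m dmat 1).
    by rewrite dmatK // mulmx1 !mulmxA.
  by rewrite !mulmxA.
have [r Zr] : exists r, Z = r%:M.
  apply: (commute_scalar (T := T)) => // k hk; have [nk _] := h k hk.
  exact: boost_exp.
have NY : N' = r *: Y.
  have : dmat 1 *m Z *m dmatV 1 = r%:M.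
    by rewrite Zr mul_mx_scalar -scalemxAl dmatK // scalemx1.
  rewrite /Z !mulmxA dmatK // mul1mx -(mulmxA _ (dmat 1)) dmatK // mulmx1 => E.
  by rewrite -[N'](mulKVmx Y0) E mul_mx_scalar.
have r0 : r != 0.
  apply: contraNneq N0 => r0; rewrite -(map_mx_eq0 (ratr : {rmorphism rat -> R})).
  by rewrite -/N' NY r0 scale0r.
have t2' : t ^+ 2 = ratr (3 / 5) by rewrite t2 fmorph_div !rmorph_nat.
have F1 := dmat_form t2'.
have F0 : dmat 1 *m Jm R *m dmat 1 = map_mx ratr (dform 5 [:: -2; 1; 1; 1; 1]).
  by apply: dmat_form; rewrite expr1n rmorph1.
have dT (u : R) : (dmat u)^T = dmat u by rewrite /dmat tr_diag_mx.
have YF : Y *m map_mx ratr (dform 5 [:: -2; 1; 1; 1; 1]) *m Y^T =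
    map_mx ratr (dform 5 [:: -2; 1; 1; 1; 3 / 5]).
  rewrite -F0 -F1 YE !trmx_mul dT.
  have dVT : dmat 1 *m (dmatV 1)^T = 1%:M :> 'M[R]_5.
    by rewrite /dmatV tr_diag_mx dmatK.
  transitivity (dmat t *m X *m (dmatV 1 *m dmat 1) *m Jm R *m (dmat 1 *m (dmatV 1)^T) *m X^T *m dmat t).
    by rewrite !mulmxA.
  rewrite dmatVK // dVT !mulmx1 -{2}(Lo_J LX).
  by rewrite !mulmxA.
(* The target form has coefficient 1 at index 1, so this entry is the multiplier [r ^+ 2], which is
   thereby seen to be rational. *)
pose m := (N *m dform 5 [:: -2; 1; 1; 1; 1] *m N^T) (lift ord0 ord0) (lift ord0 ord0).
have NF : map_mx ratr (N *m dform 5 [:: -2; 1; 1; 1; 1] *m N^T) =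
    (r ^+ 2) *: map_mx ratr (dform 5 [:: -2; 1; 1; 1; 3 / 5]) :> 'M[R]_5.
  rewrite !map_mxM -map_trmx -/N' NY linearZ /= -!scalemxAl -scalemxAr scalerA.
  by rewrite YF expr2.
have mr : ratr m = r ^+ 2.
  transitivity (((map_mx ratr (N *m dform 5 [:: -2; 1; 1; 1; 1] *m N^T)) : 'M[R]_5)
    (lift ord0 ord0) (lift ord0 ord0)); first by rewrite mxE.
  by rewrite NF !mxE /= mulr1n rmorph1 mulr1.
have m0 : m != 0.
  by apply/eqP => m0; move: mr; rewrite m0 rmorph0 => /esym/eqP; rewrite expf_eq0 (negPf r0) andbF.
apply: (not_similar m0); apply: (@map_mx_inj _ _ (ratr : {rmorphism rat -> R})).
by apply: etrans NF _; rewrite map_mxZ /= mr.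
Qed.

(** Pigeonhole: infinitely many powers of the conjugate of [phi] fall into finitely many cosets of
    the intersection, and two powers in one coset differ by a positive power lying in [G1]. *)
Lemma finite_index_power (R : realType) (G0 G1 : set (H4 R -> H4 R)) (g phi : H4 R -> H4 R) :
  is_isometry_group G0 -> is_isometry_group G1 -> is_isometry g ->
  finite_index (conjugate g G0 `&` G1) (conjugate g G0) -> G0 phi ->
  exists f n, [/\ g \o f = phi \o g, (0 < n)%N & G1 (iter n f)].
Proof.
move=> [iso0 id0 comp0 inv0] [iso1 id1 comp1 inv1] [[h gh hg] _] [_ [S [finS SC CE]]] Gphi.
pose f := h \o phi \o g.
have iterphi n : G0 (iter n phi).
  by elim: n => [|n IH] //=; exact: (comp0 phi (iter n phi)).
have giter n x : g (iter n f x) = iter n phi (g x).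
  by elim: n => [//|n IH] /=; rewrite /f /= hg IH.
have Cf n : conjugate g G0 (iter n f).
  exists (iter n phi) => //; apply/funext => x /=; exact: giter.
have /choice[s hs] : forall n, exists s, S s /\ exists2 k, (conjugate g G0 `&` G1) k & s \o k = iter n f.
  move=> n; have : conjugate g G0 (iter n f) by [].
  by rewrite {1}CE => -[s Ss [k Kk e]]; exists s; split=> //; exists k.
have [i [j [ij sij]]] : exists i j, (i < j)%N /\ s i = s j.
  apply: contrapT => no; have : finite_set (s @^-1` S).
    apply: finite_preimage => // i j _ _ e; apply: contrapT => ne; apply: no.
    have [ij|ji|//] := ltngtP i j; first by exists i, j.
    by exists j, i.
  have -> : s @^-1` S = [set: nat] by apply/seteqP; split=> // n _; case: (hs n).
  exact: infinite_nat.
exists f, (j - i)%N; split; [by apply/funext => x /=; rewrite hg|by rewrite subn_gt0|].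
have [Si [k [_ Gk] ki]] := hs i; have [_ [k' [_ Gk'] kj]] := hs j.
have [q Gq gq] := SC _ Si; have [_ [q' [_ qq' _]]] := (Gq, inv0 q Gq).
have sinj : injective (s i).
  move=> x y e; apply: (can_inj gh); apply: (can_inj qq').
  by have := congr1 (fun u => u x) gq; have := congr1 (fun u => u y) gq => /= <- <-; rewrite e.
have [l [Gl kl lk]] := inv1 k Gk.
have -> : iter (j - i) f = l \o k'; last exact: comp1.
apply/funext => x; apply: (can_inj kl); apply: sinj; rewrite /= lk.
have := congr1 (fun u => u (iter (j - i) f x)) ki; rewrite /= => ->.
have := congr1 (fun u => u x) kj; rewrite /= -sij => ->.
by rewrite -iterD subnKC // ltnW.
Qed.

(** A group element carries the tile [L] to the tile [L *m M], and all tiles belong to one rational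
    class. *)
Lemma rational_deck_group (R : realType) (t : R) (G : set (H4 R -> H4 R)) :
  0 < t -> 1 / 2 < t ^+ 2 -> ratl (t ^+ 2) -> is_fundamental_group G (N_mod_iota t) ->
  exists2 L, Lo L & forall M, matrix_group G M -> WQ t (L *m M *m invmx L).
Proof.
move=> t0 t2 t_rat /(covering_exists t0 t_rat)[over cov].
have [l [L [p [HL _ _]]]] := tiles_cover cov (ctr_inH R).
exists L; first by case: HL.
by move=> M GM; apply: (lift_class t0 t2 t_rat cov HL (lift_orbit cov HL GM)).
Qed.

(** Each letter crossing toggles the first label, so two crossings return to the original label, and
    tiles with equal labels differ by a group element. *)
Lemma boosts_in_deck_group (R : realType) (G : set (H4 R -> H4 R)) :
  is_fundamental_group G (N_mod_iota 1) ->
  exists2 L, Lo L & forall k, (0 < k < 5)%N ->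
    exists2 M, matrix_group G M & boost_mx R k *m L = L *m M.
Proof.
have t0 : 0 < (1 : R) by exact: ltr01.
have t2 : 1 / 2 < (1 : R) ^+ 2 by rewrite expr1n; lra.
have t_rat : ratl ((1 : R) ^+ 2) by rewrite expr1n; exact: ratl1.
move=> /(covering_exists t0 t_rat)[over cov].
have [l [L [p [HL _ _]]]] := tiles_cover cov (ctr_inH R).
exists L; first by case: HL.
have cross k s l' L' : (0 < k < 5)%N -> sign s -> tile_map 1 over l' L' ->
    tile_map 1 over (letter_copy l') (refl (letter_dir k s) *m L').
  move=> hk ss; have [q [hq vq hw]] := letter_wall_point hk ss.
  have lw : letter_wall 1 (letter_dir k s) by apply/letter_wall_dirP; exists k, s.
  exact: (lift_letter t0 t2 cov lw hq vq hw).
move=> k hk; have s1 : sign (1 : R) by left.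
have sN1 : sign (-1 : R) by right.
have := cross k _ _ _ hk sN1 (cross k _ _ _ hk s1 HL).
rewrite letter_copyK mulmxA => HL'.
have [M GM ->] := lift_fiber cov HL HL'; by exists M.
Qed.

Lemma conj_exp (F : fieldType) n (U A : 'M[F]_n.+1) k : U \in unitmx ->
  (U *m A *m invmx U) ^+ k = U *m A ^+ k *m invmx U.
Proof.
move=> UU; elim: k => [|k IH]; first by rewrite !expr0 mulmx1 mulmxV.
by rewrite !exprS IH -[X in X = _]/(_ *m _) !mulmxA mulmxKV.
Qed.

Theorem proposition4p24 (R : realType) (G0 G1 : set (H4 R -> H4 R))
  (hG0 : is_fundamental_group G0 (M0 R))
  (hG1 : is_fundamental_group G1 (M1 R)) :
  ~ commensurable G0 G1.
Proof.
move=> [g [isog fin0 _]]; pose t : R := Num.sqrt (3 / 5).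
have t2 : t ^+ 2 = 3 / 5 by rewrite sqr_sqrtr //; lra.
have t0 : 0 < t by rewrite sqrtr_gt0; lra.
have t2' : 1 / 2 < t ^+ 2 by rewrite t2; lra.
have t_rat : ratl (t ^+ 2).
  by rewrite t2; apply: ratlM; [exact: ratl_nat|apply: ratlV; exact: ratl_nat].
have [L1 LL1 h1] := rational_deck_group t0 t2' t_rat hG1.
have [L0 LL0 h0] := boosts_in_deck_group hG0.
have [C LC gC] := isometry_matrix isog.
have CU := Lo_unit LC; have LU0 := Lo_unit LL0; have LU1 := Lo_unit LL1.
(* The commensurator expressed between the two tile coordinate systems: [L0] turns deck elements
   into boosts, and [L1] makes the other group rational. *)
pose X := L1 *m C *m invmx L0.
have LX : Lo X by apply: LoM (LoV LL0); exact: LoM.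
have /choice[n hn] : forall k, exists n, (0 < k < 5)%N ->
    (0 < n)%N /\ WQ t (X *m boost_mx R k ^+ n *m invmx X).
  move=> k; case: (boolP (0 < k < 5)%N) => hk; last by exists 0%N.
  have [M [LM [phi Gphi phiM]] bM] := h0 k hk.
  have iG0 : is_isometry_group G0 by case: hG0.
  have iG1 : is_isometry_group G1 by case: hG1.
  have [f [n [gf n0 Gf]]] := finite_index_power iG0 iG1 isog fin0 Gphi.
  exists n => _; split=> //.
  pose N := C *m M *m invmx C.
  have fN x : val (f x) = val x *m N.
    have := congr1 (fun u => val (u x)) gf; rewrite /= gC phiM gC => e.
    by rewrite /N !mulmxA -e mulmxK.
  have fNn m x : val (iter m f x) = val x *m N ^+ m.
    elim: m => [|m IH] /=; first by rewrite expr0 mulmx1.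
    by rewrite fN IH exprSr -mulmxE mulmxA.
  have [M' GM' M'E] := matrix_of hG1 Gf.
  have NM' : M' = N ^+ n by apply: matrix_unique => x; rewrite -M'E fNn.
  have := h1 M' GM'; rewrite NM' /N conj_exp //.
  have -> : M = invmx L0 *m boost_mx R k *m invmx (invmx L0).
    by rewrite invmxK -mulmxA bM mulKmx.
  rewrite conj_exp ?unitmx_inv // invmxK.
  congr (WQ t _); rewrite /X.
  have -> : invmx (L1 *m C *m invmx L0) = L0 *m invmx C *m invmx L1.
    have U : L1 *m C *m invmx L0 \in unitmx by rewrite !unitmx_mul LU1 CU unitmx_inv.
    apply: (can_inj (mulKmx U)); rewrite mulmxV // !mulmxA mulmxKV // mulmxK //.
    by rewrite mulmxV.
  by rewrite !mulmxA.
exact: (not_commensurable_forms t0 t2 LX hn).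
Qed.
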